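(* Assume $\delta(\Gamma)<\infty$. If $\Gamma$ is radially cocompact and $\theta\in(0,\pi/2)$ is such that $\delta_\theta(\Gamma)>0$, then $$\dim_{\mathrm{Hd}}(L_\Gamma^{rad}\cap\partial X_\theta)=\delta_\theta(\Gamma),$$ where the Hausdorff dimension is defined using $c$-balls for a fixed, sufficiently large constant $c>0$.
   Context: Setting. A Hadamard space is a complete geodesic CAT(0) metric space. $(X_1,d_1)$, $(X_2,d_2)$ are locally compact Hadamard spaces, and $X=X_1\times X_2$ carries the metric $d=\sqrt{d_1^2+d_2^2}$. $\partial X$, $\partial X_i$ are the geometric boundaries (classes of asymptotic geodesic rays, cone topology); $\sigma_{x,\tilde\xi}$ is the geodesic ray from $x$ in the class of $\tilde\xi$. An isometry $h$ of a Hadamard space is axial if there are $l>0$ and a geodesic line $\sigma$ with $h(\sigma(t))=\sigma(t+l)$ for all $t\in\mathbb R$; such $\sigma$ is an axis. It is rank one if it has an axis which does not bound a flat half-plane. Two rank one isometries are independent if their fixed point sets in the geometric boundary are disjoint. $\Gamma\subset \mathrm{Is}(X_1)\times \mathrm{Is}(X_2)$ is a discrete group containing elements $g=(g_1,g_2)$ and $h=(h_1,h_2)$ such that for $i=1,2$, $g_i$ and $h_i$ are independent rank one isometries of $X_i$. $o=(o_1,o_2)\in X$ is a fixed base point. Slope. Every geodesic ray in $X$ has the form $\sigma(t)=(\sigma_1(t\cos\theta),\sigma_2(t\sin\theta))$ with geodesic rays $\sigma_i$ in $X_i$ and $\theta\in[0,\pi/2]$ its slope (a factor being constant if its speed is $0$),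 which depends only on the boundary point. $\partial X_\theta$ is the set of points of $\partial X$ of slope $\theta$; for $\theta\in(0,\pi/2)$ it is identified with $\partial X_1\times\partial X_2$ and its points are written $(\eta_1,\eta_2,\theta)$; $\partial X_0\cong\partial X_1$ and $\partial X_{\pi/2}\cong\partial X_2$. Radial limit set. A point $\tilde\xi\in\partial X$ is a radial limit point if there is a sequence $\gamma_n=(\gamma_{n,1},\gamma_{n,2})\in\Gamma$ such that $\gamma_no\to\tilde\xi$ and: if $\tilde\xi=(\xi_1,\xi_2,\theta)$ with $\theta\in(0,\pi/2)$, then for both $i\in\{1,2\}$ the sequence $\gamma_{n,i}o_i$ stays at bounded distance of one (hence any) geodesic ray in the class of $\xi_i$; if $\tilde\xi=\xi_i\in\partial X_i$ ($i=1$ for slope $0$, $i=2$ for slope $\pi/2$), then $\gamma_{n,i}o_i$ stays at bounded distance of one (hence any) geodesic ray in the class of $\xi_i$. $L_\Gamma^{rad}$ is the set of radial limit points. Radially cocompact. $\Gamma$ is radially cocompact if there is a constant $c_\Gamma>0$ such that for every $\tilde\eta\in L_\Gamma^{rad}$ and all $t>0$ there is $\gamma\in\Gamma$ with $d(\gamma o,\sigma_{o,\tilde\eta}(t))<c_\Gamma$. Exponents. $\delta(\Gamma)=\inf\{s>0:\sum_{\gamma\in\Gamma}e^{-sd(o,\gamma o)}<\infty\}$. $\delta_\theta(\Gamma)=\liminf_{\varepsilon\to0}\limsup_{n\to\infty}\frac1n\log N_\theta^\varepsilon(n)$, where $N_\theta^\varepsilon(n)=\#\{\gamma=(\gamma_1,\gamma_2)\in\Gamma: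 n-1<d(o,\gamma o)\le n,\ |\arctan\frac{d_2(o_2,\gamma_2o_2)}{d_1(o_1,\gamma_1o_1)}-\theta|<\varepsilon\}$ (with $\arctan(a/0)=\pi/2$ for $a>0$). Hausdorff dimension (Knieper). Fix $c>0$. For $\tilde\xi\in\partial X$ and $0<r<e^{-c}$ the $c$-ball of radius $r$ is $B_r^c(\tilde\xi)=\{\tilde\eta\in\partial X: d(\sigma_{o,\tilde\eta}(-\log r),\sigma_{o,\tilde\xi}(-\log r))<c\}$. For a Borel set $E\subseteq\partial X$ put $\mathrm{Hd}^\alpha_\varepsilon(E)=\inf\{\sum_j r_j^\alpha: E\subseteq\bigcup_jB^c_{r_j}(\tilde\xi_j),\ r_j<\varepsilon\}$ (countable covers), $\mathrm{Hd}^\alpha(E)=\lim_{\varepsilon\to0}\mathrm{Hd}^\alpha_\varepsilon(E)$, and $\dim_{\mathrm{Hd}}(E)=\inf\{\alpha\ge0:\mathrm{Hd}^\alpha(E)<\infty\}$. *)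

(* Defs.v *)
From HB Require Import structures.
From mathcomp Require Import all_boot all_order all_algebra.
From mathcomp Require Import all_classical all_reals all_analysis.
From mathcomp Require Import ring lra.

Set Implicit Arguments.
Unset Strict Implicit.
Unset Printing Implicit Defensive.

Import Order.TTheory GRing.Theory Num.Theory.
Import numFieldNormedType.Exports.

Local Open Scope classical_set_scope.
Local Open Scope ring_scope.

Section L2Product.
Context {R : realType}.

(* X1 * X2 already carries the sup metric as a pseudometric in the library;
   this alias carries sqrt(d1^2 + d2^2) instead. *)
Definition l2prod (X1 X2 : metricType R) : Type := (X1 * X2)%type.

Variables X1 X2 : metricType R.

Definition l2dist (p q : X1 * X2) : R :=
  Num.sqrt (mdist p.1 q.1 ^+ 2 + mdist p.2 q.2 ^+ 2).

Let l2distxx p : l2dist p p = 0.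
Proof. by rewrite /l2dist !mdistxx expr0n addr0 sqrtr0. Qed.

Let l2dist_positivity p q : l2dist p q = 0 -> p = q.
Proof.
move/eqP; rewrite sqrtr_eq0 => le0.
have h1 := sqr_ge0 (mdist p.1 q.1); have h2 := sqr_ge0 (mdist p.2 q.2).
have e1 : mdist p.1 q.1 ^+ 2 = 0 by lra.
have e2 : mdist p.2 q.2 ^+ 2 = 0 by lra.
case: p q e1 e2 {le0 h1 h2} => [p1 p2] [q1 q2] /= /eqP e1 /eqP e2.
rewrite !sqrf_eq0 in e1 e2.
by move/eqP/mdist_positivity : e1 => ->; move/eqP/mdist_positivity : e2 => ->.
Qed.

Let l2dist_sym p q : l2dist p q = l2dist q p.
Proof. by rewrite /l2dist metric_sym [in mdist p.2 _]metric_sym. Qed.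

Let minkowski2 (a b c d : R) :
  Num.sqrt ((a + c) ^+ 2 + (b + d) ^+ 2) <=
  Num.sqrt (a ^+ 2 + b ^+ 2) + Num.sqrt (c ^+ 2 + d ^+ 2).
Proof.
have h1 : 0 <= a ^+ 2 + b ^+ 2 by rewrite addr_ge0 ?sqr_ge0.
have h2 : 0 <= c ^+ 2 + d ^+ 2 by rewrite addr_ge0 ?sqr_ge0.
have s0 : 0 <= Num.sqrt (a ^+ 2 + b ^+ 2) + Num.sqrt (c ^+ 2 + d ^+ 2).
  by rewrite addr_ge0 ?sqrtr_ge0.
rewrite -(ler_pXn2r (n := 2)) ?nnegrE ?sqrtr_ge0//.
rewrite sqr_sqrtr ?addr_ge0 ?sqr_ge0// [leRHS]sqrrD !sqr_sqrtr// -sqrtrM//.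
suff : a * c + b * d <= Num.sqrt ((a ^+ 2 + b ^+ 2) * (c ^+ 2 + d ^+ 2)).
  rewrite [X in _ -> _ <= X]addrAC mulr2n; nra.
rewrite (le_trans (ler_norm _))// -sqrtr_sqr ler_sqrt ?mulr_ge0//.
have := sqr_ge0 (a * d - b * c); nra.
Qed.

Let l2dist_triangle q p r : l2dist p r <= l2dist p q + l2dist q r.
Proof.
apply: le_trans (minkowski2 _ _ _ _).
rewrite /l2dist ler_sqrt ?addr_ge0 ?sqr_ge0//.
by rewrite lerD// ler_pXn2r ?nnegrE ?addr_ge0 ?mdist_ge0// metric_triangle.
Qed.

HB.instance Definition _ := Choice.copy (l2prod X1 X2) (X1 * X2)%type.
HB.instance Definition _ := @isMetric.Build R (l2prod X1 X2) l2dist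
  l2distxx l2dist_positivity l2dist_sym l2dist_triangle.

Lemma l2prod_mdistE (p q : l2prod X1 X2) :
  mdist p q = Num.sqrt (mdist p.1 q.1 ^+ 2 + mdist p.2 q.2 ^+ 2).
Proof. by []. Qed.

End L2Product.

Notation plane R := (l2prod R^o R^o).

Section Geodesics.
Context {R : realType} {X : metricType R}.
Implicit Types (x y : X) (s : R -> X) (h : X -> X).

(* Segments, rays and lines are functions on the whole of R, constrained only on
   [0, l], [0, +oo[ and R respectively. *)
Definition is_segment (l : R) s :=
  forall a b, 0 <= a <= l -> 0 <= b <= l -> mdist (s a) (s b) = `|a - b|.

Definition segment_between x y s :=
  [/\ is_segment (mdist x y) s, s 0 = x & s (mdist x y) = y].

Definition is_ray s :=
  forall a b, 0 <= a -> 0 <= b -> mdist (s a) (s b) = `|a - b|.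

Definition is_line s := forall a b, mdist (s a) (s b) = `|a - b|.

Definition asymptotic s s' :=
  exists C : R, forall t, 0 <= t -> mdist (s t) (s' t) <= C.

Definition is_isometry h :=
  (forall x y, mdist (h x) (h y) = mdist x y) /\ (forall y, exists x, h x = y).

Definition is_axis h s :=
  is_line s /\ exists2 l : R, 0 < l & forall t, h (s t) = s (t + l).

Definition bounds_flat_half_plane s :=
  exists f : plane R -> X,
    (forall p q : plane R, 0 <= p.2 -> 0 <= q.2 ->
       mdist (f p) (f q) = mdist p q) /\
    (forall t : R, f (t, 0) = s t).

Definition rank_one h :=
  is_isometry h /\ exists2 s, is_axis h s & ~ bounds_flat_half_plane s.

End Geodesics.

Section Hadamard.
Context {R : realType} (X : metricType R).

Definition complete_space :=
  forall F : set_system X, ProperFilter F -> cauchy F -> exists x : X, F --> x.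

Definition geodesic_space := forall x y : X, exists s, segment_between x y s.

(* Comparison triangle inequality. Two sides of a triangle have a vertex in
   common; s and s' are these sides, issuing from that vertex, and e, e' are the
   corresponding sides of a comparison triangle. *)
Definition cat0_inequality :=
  forall (l l' : R) (s s' : R -> X) (e e' : R -> plane R),
    0 <= l -> 0 <= l' ->
    is_segment l s -> is_segment l' s' -> s 0 = s' 0 ->
    is_segment l e -> is_segment l' e' -> e 0 = e' 0 ->
    mdist (e l) (e' l') = mdist (s l) (s' l') ->
    forall a b, 0 <= a <= l -> 0 <= b <= l' ->
      mdist (s a) (s' b) <= mdist (e a) (e' b).

Definition hadamard :=
  [/\ complete_space, geodesic_space & cat0_inequality].

End Hadamard.

Section Boundary.
Context {R : realType} (X : metricType R).
Implicit Types (x : X) (xi : set (R -> X)).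

(* A boundary point is an asymptote class, as a set of rays. *)
Definition boundary : set (set (R -> X)) :=
  [set xi | exists2 s, is_ray s & xi = [set s' | is_ray s' /\ asymptotic s s']].

(* In a Hadamard space the ray is unique on [0, +oo[; elsewhere, and at negative
   times, the value is irrelevant. *)
Definition ray_from x xi : R -> X :=
  xget (fun=> x) [set s | xi s /\ s 0 = x].

(* Traces on X of the basic neighbourhoods of xi in the cone topology of the
   union of X and its boundary. *)
Definition cone_nbhs x xi : set_system X :=
  filter_from [set p : R * R | 0 < p.1 /\ 0 < p.2]
    (fun p => [set z | p.1 < mdist x z /\
       exists2 s, segment_between x z s &
         mdist (s p.1) (ray_from x xi p.1) < p.2]).

Definition boundary_action (h : X -> X) xi : set (R -> X) :=
  [set h \o s | s in xi].

Definition boundary_fix (h : X -> X) : set (set (R -> X)) :=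
  [set xi | boundary xi /\ boundary_action h xi = xi].

Definition independent_rank_one (g h : X -> X) :=
  [/\ rank_one g, rank_one h & boundary_fix g `&` boundary_fix h = set0].

End Boundary.

Section HausdorffDimension.
Context {R : realType} {X : metricType R}.
Variables (o : X) (c : R).
Implicit Types E : set (set (R -> X)).

Definition cball (r : R) (xi : set (R -> X)) : set (set (R -> X)) :=
  [set eta | boundary eta /\
     mdist (ray_from o eta (- ln r)) (ray_from o xi (- ln r)) < c].

(* All radii are positive, so D ranges over subsets of nat to allow finite
   covers. No measurability of E is needed: hd_pre and hd are outer quantities. *)
Definition hd_pre (alpha eps : R) E : \bar R :=
  ereal_inf [set m | exists D (r : nat -> R) (xi : nat -> set (R -> X)),
    [/\ forall j, D j -> [/\ 0 < r j, r j < expR (- c), r j < eps &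
                            boundary (xi j)],
        E `<=` \bigcup_(j in D) cball (r j) (xi j) &
        m = \esum_(j in D) (r j `^ alpha)%:E]].

Definition hd (alpha : R) E : \bar R :=
  lim (hd_pre alpha eps E @[eps --> 0^'+]).

Definition hd_dim E : \bar R :=
  ereal_inf [set alpha%:E | alpha in
    [set alpha : R | 0 <= alpha /\ (hd alpha E < +oo)%E]].

End HausdorffDimension.

Section Products.
Context {R : realType} {X1 X2 : metricType R}.
Local Notation X := (l2prod X1 X2).
Local Notation G := ({compact-open, X1 -> X1} * {compact-open, X2 -> X2})%type.
Implicit Types (Gamma : set G) (gamma : G) (o : X).

Definition pair_action gamma (x : X) : X := (gamma.1 x.1, gamma.2 x.2).

Definition is_isometry_group Gamma :=
  [/\ forall gamma, Gamma gamma -> is_isometry gamma.1 /\ is_isometry gamma.2,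
      Gamma (id, id),
      forall f g, Gamma f -> Gamma g -> Gamma (f.1 \o g.1, f.2 \o g.2) &
      forall f, Gamma f -> exists g, [/\ Gamma g,
        cancel f.1 g.1, cancel g.1 f.1, cancel f.2 g.2 & cancel g.2 f.2]].

Definition is_discrete Gamma :=
  Gamma `<=` isolated Gamma.

(* A factor of speed 0 is constant, hence need not come from a ray. *)
Definition has_slope (theta : R) (s : R -> X) :=
  0 <= theta <= pi / 2 /\
  exists (s1 : R -> X1) (s2 : R -> X2),
    [/\ 0 < cos theta -> is_ray s1, 0 < sin theta -> is_ray s2 &
        forall t, 0 <= t -> s t = (s1 (t * cos theta), s2 (t * sin theta))].

Definition boundary_slope (theta : R) : set (set (R -> X)) :=
  [set xi | boundary xi /\ exists2 s, xi s & has_slope theta s].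

(* The boundary point written (xi1, xi2, theta), for 0 < theta < pi / 2. *)
Definition boundary_join (xi1 : set (R -> X1)) (xi2 : set (R -> X2))
    (theta : R) : set (R -> X) :=
  [set s | exists s1 s2, [/\ xi1 s1, xi2 s2 &
     forall t, 0 <= t -> s t = (s1 (t * cos theta), s2 (t * sin theta))]].

Definition boundary_inl (xi1 : set (R -> X1)) : set (R -> X) :=
  [set s | exists s1 x2, xi1 s1 /\ forall t, 0 <= t -> s t = (s1 t, x2)].

Definition boundary_inr (xi2 : set (R -> X2)) : set (R -> X) :=
  [set s | exists x1 s2, xi2 s2 /\ forall t, 0 <= t -> s t = (x1, s2 t)].

Definition bounded_from_ray (Y : metricType R) (u : nat -> Y)
    (xi : set (R -> Y)) :=
  exists2 s, xi s &
    exists C : R, forall n, exists2 t, 0 <= t & mdist (u n) (s t) <= C.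

Definition radial_limit_set Gamma o : set (set (R -> X)) :=
  [set xi | boundary xi /\ exists gamma : nat -> G,
    [/\ forall n, Gamma (gamma n),
        (fun n => pair_action (gamma n) o) @ \oo `=>` cone_nbhs o xi &
        [\/ exists xi1 xi2 (theta : R),
              [/\ boundary xi1, boundary xi2, 0 < theta < pi / 2,
                  xi = boundary_join xi1 xi2 theta &
                  bounded_from_ray (fun n => (gamma n).1 o.1) xi1 /\
                  bounded_from_ray (fun n => (gamma n).2 o.2) xi2],
            exists xi1, [/\ boundary xi1, xi = boundary_inl xi1 &
              bounded_from_ray (fun n => (gamma n).1 o.1) xi1] |
            exists xi2, [/\ boundary xi2, xi = boundary_inr xi2 &
              bounded_from_ray (fun n => (gamma n).2 o.2) xi2]]]].

Definition radially_cocompact Gamma o :=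
  exists2 c : R, 0 < c &
    forall eta, radial_limit_set Gamma o eta -> forall t, 0 < t ->
      exists2 gamma, Gamma gamma &
        mdist (pair_action gamma o) (ray_from o eta t) < c.

Definition critical_exponent Gamma o : \bar R :=
  ereal_inf [set s%:E | s in [set s : R | 0 < s /\
    (\esum_(gamma in Gamma)
       (expR (- s * mdist o (pair_action gamma o)))%:E < +oo)%E]].

Definition orbit_angle o gamma : R :=
  if mdist o.1 (gamma.1 o.1) == 0 then pi / 2
  else atan (mdist o.2 (gamma.2 o.2) / mdist o.1 (gamma.1 o.1)).

Definition slope_count Gamma o (theta eps : R) (n : nat) : \bar R :=
  counting [set gamma | [/\ Gamma gamma,
    n%:R - 1 < mdist o (pair_action gamma o) <= n%:R &
    `|orbit_angle o gamma - theta| < eps]].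

(* lne 0 = -oo: slopes not approached by the orbit have exponent -oo. *)
Definition slope_exponent Gamma o (theta : R) : \bar R :=
  limf_einf (fun eps : R =>
    limn_esup (fun n => (n%:R^-1)%:E * lne (slope_count Gamma o theta eps n))%E)
    0^'+.

End Products.

(* Main.v *)
Require Import Defs.
From HB Require Import structures.
From mathcomp Require Import all_boot all_order all_algebra.
From mathcomp Require Import all_classical all_reals all_analysis.
From mathcomp Require Import ring lra zify.
Import Order.TTheory GRing.Theory Num.Theory.
Import numFieldNormedType.Exports.
Local Open Scope classical_set_scope.
Local Open Scope ring_scope.

Set Implicit Arguments.
Unset Strict Implicit.
Unset Printing Implicit Defensive.

(** In a factor, an axis which does not bound a flat half-plane is contracting:
    a geodesic between two points whose projections to the axis are far apart
    passes close to the axis, since otherwise translates of larger and larger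
    pieces converge along an ultrafilter to a flat half-plane. Large powers of
    two independent rank one elements therefore play ping-pong in both factors
    at once, and a product of orbit elements with suitable such powers inserted
    stays close to a geodesic. Hence every orbit point whose direction is close
    to [theta] lies close to a ray of slope [theta] which is a radial limit
    point, with an error which is small relative to its distance to [o].

    Radial cocompactness then gives both inequalities. At time [n] every ray of
    the limit set is [c]-close to an orbit point counted by [N_theta^eps] near
    [n], so one ball for each of these points gives a cover. Conversely a cover
    by balls of radii [exp (- u j)] with [\sum_j exp (- a * u j) <= 1] can be
    made finite by compactness, and translating by the inverses of orbit points
    in its balls turns it into a recursion showing that at most [exp ((a +
    small) * n)] orbit points are close to rays of the limit set at time [n];
    the rays found above make this a bound for [N_theta^eps (n)]. *)

(** * CAT(0) geometry *)

(** The curvature hypothesis enters only through [stewart], a quadratic inequality that adds up over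
    the factors of an [l2] product, so the product needs no comparison triangles of its own. A pair
    of rank one elements moves along a flat spanned by two axes, so nothing contracts in the
    product: the ping-pong runs factorwise, with the same word in both factors. Each factor excludes
    at most one letter at a junction, and the four letters of two generators leave a choice. A
    radial limit ray must have slope exactly [theta] while the given element has it only
    approximately; later syllables therefore come from orbit points of ever better slope, which
    exist because [delta_theta > 0]. For the lower bound on the dimension, counting takes the place
    of a conformal density: each translation costs a bounded error in the radius, at most once per
    time [T], and [delta < oo] turns the total error of order [t / T] into a growth rate that tends
    to zero for large [T]. Large [T] is available because covers may use arbitrarily small radii. *)

Section Stewart.
Context {R : realType} {X : metricType R}.
Implicit Types (x y z : X) (s : R -> X).

(** Stewart's theorem as an inequality, multiplied by the length [l] so that degenerate segments are
    included. It is linear in squared distances, hence inherited by [l2] products. *)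
Definition stewart (Y : metricType R) := forall (l a : R) (s : R -> Y) (z : Y),
  0 <= a <= l -> is_segment l s ->
  l * mdist z (s a) ^+ 2 <=
  (l - a) * mdist z (s 0) ^+ 2 + a * mdist z (s l) ^+ 2 - a * (l - a) * l.

Lemma plane_mdist (p q : plane R) :
  mdist p q = Num.sqrt ((p.1 - q.1) ^+ 2 + (p.2 - q.2) ^+ 2).
Proof.
rewrite l2prod_mdistE; congr (Num.sqrt (_ + _)).
  by rewrite -[RHS]real_normK ?num_real// -normrN opprB.
by rewrite -[RHS]real_normK ?num_real// -normrN opprB.
Qed.

Lemma dist_diff x y z : `|mdist x y - mdist x z| <= mdist y z.
Proof.
have := metric_triangle x z y; have := metric_triangle x y z.
by rewrite (metric_sym z y) ler_norml => h1 h2; apply/andP; split; lra.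
Qed.

Lemma segment_dist l s a b : is_segment l s -> 0 <= a -> a <= b -> b <= l ->
  mdist (s a) (s b) = b - a.
Proof.
move=> seg a0 ab bl; rewrite seg ?a0 ?bl ?(le_trans ab bl) ?(le_trans a0 ab)//.
by rewrite distrC ger0_norm// subr_ge0.
Qed.

(** The comparison triangle is drawn with the segment on the first axis and the second side at polar
    angle [acos c]; the comparison is used at the far end [z] of that side. *)
Lemma cat0_stewart : geodesic_space X -> cat0_inequality X -> stewart X.
Proof.
move=> geo cat l a s z /andP[a0 al] segs.
have [l0|l0] := leP l 0.
  have [-> ->] : a = 0 /\ l = 0 by split; lra.
  lra.
have [t [segt t0 tz]] := geo (s 0) z.
set m := mdist (s 0) z in segt tz.
have m_ge0 : 0 <= m by exact: mdist_ge0.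
have s0l : mdist (s 0) (s l) = l.
  by rewrite segs ?lexx ?ltW// sub0r normrN gtr0_norm.
have [m0|m0] := leP m 0.
  have -> : z = s 0.
    by apply/esym/mdist_positivity; apply/eqP; rewrite eq_le m0 m_ge0.
  by rewrite mdistxx (segment_dist segs)// subr0 s0l expr0n/=; lra.
set D := mdist z (s l).
have [D1 D2] : `|l - m| <= D /\ D <= l + m.
  split; last by rewrite /D (le_trans (metric_triangle _ (s 0) _))// s0l
    (metric_sym z) addrC.
  by rewrite -s0l /D (metric_sym z) dist_diff.
have D0 : 0 <= D by exact: mdist_ge0.
(* The cosine of the comparison angle, from the law of cosines; the triangle inequality gives
   [|c| <= 1]. *)
pose c := (l ^+ 2 + m ^+ 2 - D ^+ 2) / (2 * l * m).
have cE : 2 * l * m * c = l ^+ 2 + m ^+ 2 - D ^+ 2.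
  by rewrite /c mulrC divfK// !mulf_neq0// ?lt0r_neq0.
have lm0 : 0 < l * m by rewrite mulr_gt0.
have c1 : c ^+ 2 <= 1.
  rewrite -[leRHS](expr1n _ 2) -ler_sqrt ?expr1n// sqrtr1 sqrtr_sqr ler_norml.
  apply/andP; split.
    rewrite -(ler_pM2l (_ : 0 < 2 * l * m)) ?cE; last lra.
    have : D ^+ 2 <= (l + m) ^+ 2 by rewrite ler_pXn2r ?nnegrE//; lra.
    by rewrite sqrrD; lra.
  rewrite -(ler_pM2l (_ : 0 < 2 * l * m)) ?cE; last lra.
  have : (l - m) ^+ 2 <= D ^+ 2.
    by rewrite -[(l - m) ^+ 2]real_normK ?num_real// ler_pXn2r ?nnegrE.
  by rewrite sqrrB; lra.
pose sn := Num.sqrt (1 - c ^+ 2).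
have snE : sn ^+ 2 = 1 - c ^+ 2 by rewrite sqr_sqrtr// subr_ge0.
pose e (u : R) : plane R := (u, 0).
pose e' (u : R) : plane R := (u * c, u * sn).
have hinge u v : mdist (e u) (e' v) ^+ 2 = u ^+ 2 + v ^+ 2 - 2 * u * v * c.
  rewrite plane_mdist sqr_sqrtr ?addr_ge0 ?sqr_ge0//=.
  have -> : (u - v * c) ^+ 2 + (0 - v * sn) ^+ 2 =
    u ^+ 2 - 2 * u * v * c + v ^+ 2 * c ^+ 2 + v ^+ 2 * sn ^+ 2 by ring.
  by rewrite snE; ring.
have := cat l m s t e e' (ltW l0) (ltW m0) segs segt (esym t0).
have segE : is_segment l e.
  by move=> u v _ _; rewrite plane_mdist/= subrr expr0n addr0 sqrtr_sqr.
have segE' : is_segment m e'.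
  move=> u v _ _; rewrite plane_mdist/= -sqrtr_sqr; congr Num.sqrt.
  have -> : (u * c - v * c) ^+ 2 + (u * sn - v * sn) ^+ 2 =
    (u - v) ^+ 2 * (c ^+ 2 + sn ^+ 2) by ring.
  by rewrite snE addrCA subrr addr0 mulr1.
have e00 : e 0 = e' 0 by rewrite /e /e' !mul0r.
have eD : mdist (e l) (e' m) = mdist (s l) (t m).
  rewrite tz metric_sym (metric_sym (s l)) -/D; apply/eqP.
  rewrite -(eqrXn2 (n := 2))// ?mdist_ge0// metric_sym hinge; apply/eqP.
  have -> : 2 * l * m * c = l ^+ 2 + m ^+ 2 - D ^+ 2 by [].
  ring.
move=> /(_ segE segE' e00 eD a m); rewrite a0 al lexx ltW// => /(_ isT isT).
rewrite tz => H.
have {H} : mdist z (s a) ^+ 2 <= mdist (e a) (e' m) ^+ 2.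
  by rewrite metric_sym ler_pXn2r ?nnegrE ?mdist_ge0.
rewrite hinge -/D (metric_sym z (s 0)) -/m => H.
have : l * mdist z (s a) ^+ 2 <= l * (a ^+ 2 + m ^+ 2 - 2 * a * m * c).
  by rewrite ler_pM2l.
have -> : l * (a ^+ 2 + m ^+ 2 - 2 * a * m * c) =
  l * (a ^+ 2 + m ^+ 2) - a * (2 * l * m * c) by ring.
by rewrite cE; lra.
Qed.

Hypothesis hS : stewart X.
Hypothesis geo : geodesic_space X.

Lemma segment_sub l l' s : l' <= l -> is_segment l s -> is_segment l' s.
Proof.
move=> l'l seg a b /andP[a0 al] /andP[b0 bl].
by apply: seg; apply/andP; split => //; lra.
Qed.

Lemma segment_rev l s : is_segment l s -> is_segment l (fun t => s (l - t)).
Proof.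
move=> seg a b /andP[a0 al] /andP[b0 bl].
rewrite seg; [|by apply/andP; split; lra..].
by rewrite distrC; congr `|_|; ring.
Qed.

Lemma ray_segment s l : is_ray s -> is_segment l s.
Proof. by move=> ray a b /andP[a0 _] /andP[b0 _]; exact: ray. Qed.

Lemma ray_dist s a b : is_ray s -> 0 <= a -> a <= b -> mdist (s a) (s b) = b - a.
Proof.
by move=> /(@ray_segment _ b) seg a0 ab; rewrite (segment_dist seg).
Qed.

Lemma line_segment s l a : is_line s -> is_segment l (fun t => s (a + t)).
Proof.
by move=> line b c _ _; rewrite line; congr `|_|; ring.
Qed.

(** One use of [stewart] on each side. The bound is the law of cosines with the comparison angle at
    the common vertex, the cosine being expressed by the third side and the denominators cleared. *)
Lemma cat0_hinge l l' s s' a b :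
  is_segment l s -> is_segment l' s' -> s 0 = s' 0 ->
  0 <= a <= l -> 0 <= b <= l' ->
  l * l' * mdist (s a) (s' b) ^+ 2 <=
  l * l' * (a ^+ 2 + b ^+ 2)
  - a * b * (l ^+ 2 + l' ^+ 2 - mdist (s l) (s' l') ^+ 2).
Proof.
move=> seg seg' s00 /andP[a0 al] /andP[b0 bl].
have S1 := @hS l' b s' (s a) _ seg'.
have S2 := @hS l a s (s' l') _ seg.
rewrite -s00 (metric_sym (s a) (s 0)) (segment_dist seg)// subr0 in S1.
rewrite s00 (metric_sym (s' l') (s' 0)) (segment_dist seg') ?subr0// in S2; last lra.
rewrite (metric_sym (s' l') (s a)) (metric_sym (s' l') (s l)) in S2.
have {}S1 : l * (l' * mdist (s a) (s' b) ^+ 2) <=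
   l * ((l' - b) * a ^+ 2 + b * mdist (s a) (s' l') ^+ 2 - b * (l' - b) * l').
  by rewrite ler_wpM2l ?S1 ?b0//; lra.
have {}S2 : b * (l * mdist (s a) (s' l') ^+ 2) <=
   b * ((l - a) * l' ^+ 2 + a * mdist (s l) (s' l') ^+ 2 - a * (l - a) * l).
  by rewrite ler_wpM2l ?S2 ?a0//; lra.
lra.
Qed.

Lemma hinge_scale l l' s s' u :
  is_segment l s -> is_segment l' s' -> s 0 = s' 0 ->
  0 <= l -> 0 <= l' -> 0 <= u <= 1 ->
  mdist (s (u * l)) (s' (u * l')) <= u * mdist (s l) (s' l').
Proof.
move=> seg seg' s00 l0 l'0 /andP[u0 u1].
have ul : u * l <= l by rewrite ler_piMl.
have ul' : u * l' <= l' by rewrite ler_piMl.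
have ul0 : 0 <= u * l by rewrite mulr_ge0.
have ul'0 : 0 <= u * l' by rewrite mulr_ge0.
have [lle|lp] := leP l 0.
  have -> : l = 0 by lra.
  by rewrite mulr0 s00 (segment_dist seg')// (segment_dist seg')//; lra.
have [lle|l'p] := leP l' 0.
  have -> : l' = 0 by lra.
  rewrite mulr0 -s00 ![mdist _ (s 0)]metric_sym.
  by rewrite (segment_dist seg)// (segment_dist seg)//; lra.
have := cat0_hinge seg seg' s00 (a := u * l) (b := u * l').
rewrite ul0 ul ul'0 ul' => /(_ isT isT) H.
have {H} : l * l' * mdist (s (u * l)) (s' (u * l')) ^+ 2 <=
   l * l' * (u * mdist (s l) (s' l')) ^+ 2 by lra.
by rewrite ler_pM2l ?mulr_gt0// ler_pXn2r// ?nnegrE ?mulr_ge0 ?mdist_ge0.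
Qed.

(** The diagonal from [s 0] to [s' l'] cuts the quadrilateral into two triangles, and [hinge_scale]
    applies to each. *)
Lemma dist_convex l l' s s' u :
  is_segment l s -> is_segment l' s' -> 0 <= l -> 0 <= l' -> 0 <= u <= 1 ->
  mdist (s (u * l)) (s' (u * l')) <=
  (1 - u) * mdist (s 0) (s' 0) + u * mdist (s l) (s' l').
Proof.
move=> seg seg' l0 l'0 /andP[u0 u1].
have [t [segt t0 tm]] := geo (s 0) (s' l').
set m := mdist (s 0) (s' l') in segt tm.
have m0 : 0 <= m by exact: mdist_ge0.
have H1 := hinge_scale seg segt (esym t0) l0 m0 (u := u).
have H2 := hinge_scale (segment_rev segt) (segment_rev seg') _ m0 l'0 (u := 1 - u).
rewrite !subr0 tm in H2.
have {}H1 := H1 ltac:(by rewrite u0).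
have {}H2 := H2 erefl ltac:(by apply/andP; split; lra).
rewrite tm in H1; rewrite !subrr t0 in H2.
have e1 : m - (1 - u) * m = u * m by ring.
have e2 : l' - (1 - u) * l' = u * l' by ring.
rewrite e1 e2 in H2.
have := metric_triangle (s (u * l)) (t (u * m)) (s' (u * l')).
lra.
Qed.

Lemma point_convex l s z a : is_segment l s -> 0 <= a <= l ->
  l * mdist z (s a) <= (l - a) * mdist z (s 0) + a * mdist z (s l).
Proof.
move=> seg /andP[a0 al].
have [l0|l0] := leP l 0.
  have [-> ->] : a = 0 /\ l = 0 by split; lra.
  lra.
have segz : is_segment 0 (fun _ => z).
  move=> b c; rewrite -!eq_le => /eqP <- /eqP <-.
  by rewrite mdistxx subrr normr0.
have := dist_convex segz seg (lexx 0) (ltW l0) (u := a / l).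
rewrite divr_ge0 ?(ltW l0)// ler_pdivrMr// mul1r al => /(_ isT).
rewrite divfK ?lt0r_neq0// -(ler_pM2l l0) => H; apply: (le_trans H).
have -> : l * ((1 - a / l) * mdist z (s 0) + a / l * mdist z (s l)) =
  (l - a / l * l) * mdist z (s 0) + a / l * l * mdist z (s l) by ring.
by rewrite divfK ?lt0r_neq0.
Qed.

(** A bounded convex function on a half-line cannot increase. *)
Lemma ray_asymptotic_le s s' t : is_ray s -> is_ray s' -> asymptotic s s' ->
  0 <= t -> mdist (s t) (s' t) <= mdist (s 0) (s' 0).
Proof.
move=> ray ray' [C hC] t0; rewrite leNgt; apply/negP => lt0.
set e := mdist (s t) (s' t) - mdist (s 0) (s' 0).
have e0 : 0 < e by rewrite subr_gt0.
have C0 : 0 <= C by apply: le_trans (hC 0 (lexx _)); exact: mdist_ge0.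
have tp : 0 < t.
  by rewrite lt_neqAle t0 andbT; apply/eqP => t_eq; move: lt0; rewrite -t_eq ltxx.
(* By this time a convex function that has risen by [e] on [[0, t]] would exceed the bound [C]. *)
pose T := t + t * C / e.
have T0 : 0 <= t * C / e by rewrite divr_ge0 ?mulr_ge0// ltW.
have Tp : 0 < T by rewrite /T; lra.
have := dist_convex (@ray_segment s T ray) (@ray_segment s' T ray') (ltW Tp) (ltW Tp)
  (u := t / T).
rewrite divr_ge0 ?(ltW Tp)// ler_pdivrMr// mul1r /T lerDl T0 -/T => /(_ isT).
rewrite divfK ?lt0r_neq0// -(ler_pM2l Tp).
have -> : T * ((1 - t / T) * mdist (s 0) (s' 0) + t / T * mdist (s T) (s' T)) =
  (T - t / T * T) * mdist (s 0) (s' 0) + t / T * T * mdist (s T) (s' T) by ring.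
rewrite divfK ?lt0r_neq0// => H.
have H1 : t * mdist (s T) (s' T) <= t * C by rewrite ler_wpM2l// hC// ltW.
have H2 : T * e = t * e + t * C by rewrite /T mulrDl divfK// lt0r_neq0.
have H3 : 0 < t * e by rewrite mulr_gt0.
have H4 : 0 <= t * mdist (s 0) (s' 0) by rewrite mulr_ge0// mdist_ge0.
move: H2; rewrite {1}/e; lra.
Qed.

Lemma ray_unique s s' t : is_ray s -> is_ray s' -> asymptotic s s' ->
  s 0 = s' 0 -> 0 <= t -> s t = s' t.
Proof.
move=> ray ray' as_ e0 t0; have := ray_asymptotic_le ray ray' as_ t0.
rewrite e0 mdistxx => H.
by apply/mdist_positivity/eqP; rewrite eq_le H mdist_ge0.
Qed.

Lemma asymptotic_sym s s' : asymptotic s s' -> asymptotic s' s.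
Proof. by move=> [C hC]; exists C => t t0; rewrite metric_sym hC. Qed.

Lemma asymptotic_trans s s' s'' :
  asymptotic s s' -> asymptotic s' s'' -> asymptotic s s''.
Proof.
move=> [C hC] [C' hC']; exists (C + C') => t t0.
by rewrite (le_trans (metric_triangle _ (s' t) _))// lerD ?hC ?hC'.
Qed.

Lemma cvg_mdist T (F : set_system T) {FF : Filter F}
    (f g : T -> X) x y :
  f @ F --> x -> g @ F --> y ->
  (fun t => mdist (f t) (g t)) @ F --> mdist x y.
Proof.
move=> /metricType_numDomainType.cvgr_dist_lt fx
  /metricType_numDomainType.cvgr_dist_lt gy.
apply/cvgrPdist_lt => e e0.
near=> t.
have h1 : mdist x (f t) < e / 2 by near: t; apply: fx; rewrite divr_gt0.
have h2 : mdist y (g t) < e / 2 by near: t; apply: gy; rewrite divr_gt0.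
have h3 := dist_diff (f t) y (g t); have h4 := dist_diff y x (f t).
rewrite !(metric_sym y) in h4.
have -> : mdist x y - mdist (f t) (g t) =
  (mdist x y - mdist (f t) y) + (mdist (f t) y - mdist (f t) (g t)) by ring.
rewrite (le_lt_trans (ler_normD _ _))//.
lra.
Unshelve. all: by end_near. Qed.

Lemma mdist_lim_le T (F : set_system T) {FF : ProperFilter F}
    (f g : T -> X) x y c : f @ F --> x -> g @ F --> y ->
  (\forall t \near F, mdist (f t) (g t) <= c) -> mdist x y <= c.
Proof. by move=> fx gy; apply: cvgr_to_le; exact: cvg_mdist. Qed.

Lemma mdist_lim_ge T (F : set_system T) {FF : ProperFilter F}
    (f g : T -> X) x y c : f @ F --> x -> g @ F --> y ->
  (\forall t \near F, c <= mdist (f t) (g t)) -> c <= mdist x y.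
Proof. by move=> fx gy; apply: cvgr_to_ge; exact: cvg_mdist. Qed.

Lemma mdist_lim_eq T (F : set_system T) {FF : ProperFilter F}
    (f g : T -> X) x y c : f @ F --> x -> g @ F --> y ->
  (\forall t \near F, mdist (f t) (g t) = c) -> mdist x y = c.
Proof.
move=> fx gy h; apply/eqP; rewrite eq_le; apply/andP; split.
  by apply: (mdist_lim_le fx gy); apply: filterS h => t ->.
by apply: (mdist_lim_ge fx gy); apply: filterS h => t ->.
Qed.

Definition passes x y z (K : R) := forall s, segment_between x y s ->
  exists t, 0 <= t <= mdist x y /\ mdist (s t) z <= K.

Lemma passesW x y z K K' : K <= K' -> passes x y z K -> passes x y z K'.
Proof.
by move=> KK' H s /H[t [? h]]; exists t; split=> //; exact: le_trans KK'.
Qed.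

Lemma passes_dist x y z K : passes x y z K ->
  mdist x z + mdist z y <= mdist x y + 2 * K.
Proof.
have [s sxy] := geo x y.
move=> /(_ s sxy)[t [/andP[t0 tl] h]]; case: sxy => [seg s0 sl].
have h1 : mdist x (s t) = t by rewrite -s0 (segment_dist seg) ?subr0.
have h2 : mdist (s t) y = mdist x y - t by rewrite -{1}sl (segment_dist seg).
have := metric_triangle x (s t) z; have := metric_triangle z (s t) y.
rewrite (metric_sym z (s t)); lra.
Qed.

(** The segment to [u k] passes near [u N], so by the hinge inequality it differs from the segment
    to [u N] by at most [t * K / r] at time [t] once [u N] is at distance [r + K]. In the last bound
    one [K] comes from the passage, the other from the difference of arrival times. *)
Lemma ray_limit (o : X) (u : nat -> X) (K : R) : complete_space X ->
  (forall r : R, exists N, forall n, (N <= n)%N -> r <= mdist o (u n)) ->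
  (forall j k, (j <= k)%N -> passes o (u k) (u j) K) ->
  exists s, [/\ is_ray s, s 0 = o &
    forall j, mdist (u j) (s (mdist o (u j))) <= 2 * K].
Proof.
move=> comp udiv upass.
have /choice[S HS] := fun k => geo o (u k).
have K0 : 0 <= K.
  have [t [_ h]] := upass 0%N 0%N (leqnn _) _ (HS 0%N).
  by apply: le_trans h; exact: mdist_ge0.
have close (t : R) (N k : nat) (r : R) : (N <= k)%N -> 0 <= t -> 0 < r ->
    t <= r -> r + K <= mdist o (u N) ->
    mdist (S k t) (S N t) * r <= t * K.
  move=> Nk t0 r0 tr rK.
  have [tau [/andP[tau0 tau1] htau]] := upass _ _ Nk _ (HS k).
  case: (HS k) => segk k0 kl; case: (HS N) => segN N0 Nl.
  have dtau : mdist o (S k tau) = tau by rewrite -k0 (segment_dist segk) ?subr0.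
  have := metric_triangle o (S k tau) (u N); rewrite dtau => tri.
  have tauK : r <= tau by lra.
  have := cat0_hinge (segment_sub tau1 segk) segN _ (a := t) (b := t).
  rewrite k0 N0 t0 (le_trans tr tauK) (_ : t <= mdist o (u N)) ?Nl; last lra.
  move=> /(_ erefl isT isT).
  set D := mdist (S k t) (S N t); set M := mdist o (u N) in rK tri *.
  have D0 : 0 <= D by exact: mdist_ge0.
  move=> H.
  have d2 : mdist (S k tau) (u N) ^+ 2 <= K ^+ 2.
    by rewrite ler_pXn2r ?nnegrE ?mdist_ge0.
  have h1 : tau * M * D ^+ 2 <= t ^+ 2 * K ^+ 2.
    have : t * t * mdist (S k tau) (u N) ^+ 2 <= t * t * K ^+ 2.
      by rewrite ler_wpM2l// mulr_ge0.
    have : 0 <= t ^+ 2 * (tau - M) ^+ 2 by rewrite mulr_ge0 ?sqr_ge0.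
    lra.
  have h2 : r * r * D ^+ 2 <= tau * M * D ^+ 2.
    rewrite ler_wpM2r ?sqr_ge0// ler_pM ?(ltW r0)//; lra.
  rewrite -(ler_pXn2r (n := 2)) ?nnegrE ?mulr_ge0 ?(ltW r0)//.
  by rewrite !exprMn; lra.
have cv t : exists p : X, 0 <= t -> (fun k => S k t) @ \oo --> p.
  have [t0|t0] := leP 0 t; last by exists o; lra.
  have : cauchy ((fun k => S k t) @ \oo).
    apply: cauchy_exP => e e0.
    pose r := t + 1 + t * K / e.
    have q0 : 0 <= t * K / e by rewrite divr_ge0 ?mulr_ge0// ltW.
    have r0 : 0 < r by rewrite /r; lra.
    have [N hN] := udiv (r + K).
    exists (S N t); exists N => // k /= Nk.
    rewrite -metricType_numDomainType.ball_mdistE/= metric_sym.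
    have tr : t <= r by rewrite /r; lra.
    have h := @close t N k r Nk t0 r0 tr (hN N (leqnn _)).
    rewrite -(ltr_pM2r r0); apply: (le_lt_trans h).
    have -> : e * r = e * (t + 1) + t * K / e * e by rewrite /r; ring.
    by rewrite divfK ?lt0r_neq0// ltrDr mulr_gt0//; lra.
  by move=> /comp[p hp]; exists p.
have /choice[s hs] := cv.
have s0 : s 0 = o.
  have := hs 0 (lexx 0).
  have -> : (fun k => S k 0) = (fun=> o) by apply/funext => k; case: (HS k).
  move=> h; apply/mdist_positivity.
  apply: (mdist_lim_eq h (cvg_cst o)); apply: nearW => k; exact: mdistxx.
exists s; split=> //.
  move=> a b a0 b0.
  apply: (mdist_lim_eq (hs a a0) (hs b b0)).
  have [N hN] := udiv (a + b).
  near=> k.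
  have Nk : (N <= k)%N by near: k; exact: nbhs_infty_ge.
  have h := hN k Nk; case: (HS k) => segk _ _.
  by apply: segk; apply/andP; split=> //; lra.
move=> j; set m := mdist o (u j).
have m0 : 0 <= m by exact: mdist_ge0.
apply: (mdist_lim_le (cvg_cst (u j)) (hs m m0)).
have [N hN] := udiv m.
near=> k.
have jk : (j <= k)%N by near: k; exact: nbhs_infty_ge.
have Nk : (N <= k)%N by near: k; exact: nbhs_infty_ge.
have mk := hN k Nk.
have [tau [/andP[tau0 tau1] htau]] := upass _ _ jk _ (HS k).
case: (HS k) => segk k0 kl.
have dtau : mdist o (S k tau) = tau by rewrite -k0 (segment_dist segk) ?subr0.
have := dist_diff o (S k tau) (u j); rewrite dtau -/m => h.
have := metric_triangle (u j) (S k tau) (S k m).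
rewrite (segk tau m) ?tau0 ?m0// (metric_sym (u j) (S k tau)).
lra.
Unshelve. all: by end_near. Qed.

(** [ray_limit] applies to the points [s n] with [K] the distance from [o] to [s 0], since by
    convexity the segment from [o] to [s k] stays within [K] of [s] at proportional parameters. *)
Lemma ray_exists (o : X) s : complete_space X -> is_ray s ->
  exists s', [/\ is_ray s', s' 0 = o & asymptotic s s'].
Proof.
move=> comp ray; set K := mdist o (s 0).
have K0 : 0 <= K by exact: mdist_ge0.
pose u (n : nat) := s n%:R.
have ud n : `|mdist o (u n) - n%:R| <= K.
  have := dist_diff (u n) o (s 0).
  by rewrite (metric_sym _ (s 0)) (ray_dist ray)// subr0 (metric_sym _ o).
have [||s' [ray' s'0 hs']] := @ray_limit o u K comp.
- move=> r; exists `|Num.ceil (r + K)|%N => n Nn.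
  have := ud n; rewrite ler_norml => /andP[h1 h2].
  have : r + K <= n%:R.
    apply: (le_trans (ceil_ge _)).
    rewrite (le_trans (ler_norm _))// -intr_norm -abszE.
    by rewrite -(ler_nat R) in Nn.
  lra.
- move=> j k jk t [segt t0 tl].
  have [k0|k0] := posnP k.
    have -> : j = k by rewrite k0 in jk *; apply/eqP; rewrite -leqn0.
    exists (mdist o (u k)); rewrite mdist_ge0 lexx tl mdistxx; split=> //.
  have kp : 0 < k%:R :> R by rewrite ltr0n.
  pose l := mdist o (u k).
  have l0 : 0 <= l by exact: mdist_ge0.
  have j1 : 0 <= (j%:R / k%:R : R) <= 1.
    by rewrite divr_ge0//= ler_pdivrMr// mul1r ler_nat.
  have := dist_convex segt (@ray_segment s k%:R ray) l0 (ltW kp) j1.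
  rewrite tl mdistxx mulr0 addr0 t0 divfK ?lt0r_neq0// -/K => h.
  exists (j%:R / k%:R * l); split.
    by case/andP: j1 => j0 j1; rewrite mulr_ge0// ler_piMl.
  apply: (le_trans h); rewrite ler_piMl//; case/andP: j1; lra.
exists s'; split=> //.
exists (4 * K + 2) => t t0.
have /andP[n1 n2] := Num.Theory.truncn_itv t0.
set n := Num.truncn t in n1 n2.
have h := hs' n; have h1 := ud n.
have := metric_triangle (s t) (u n) (s' t).
have := metric_triangle (u n) (s' (mdist o (u n))) (s' t).
rewrite (ray' (mdist o (u n)))// ?mdist_ge0// [mdist (s t) (u n)]metric_sym
  (ray_dist (s := s))//.
have -> : mdist o (u n) - t = (mdist o (u n) - n%:R) + (n%:R - t) by ring.
have := ler_normD (mdist o (u n) - n%:R) (n%:R - t).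
have : `|n%:R - t| <= 1.
  by rewrite -natr1 in n2; rewrite ler_norml; apply/andP; split; lra.
rewrite -natr1 in n2; lra.
Qed.

End Stewart.

(** * Ultralimits and projections to a line *)

(** Compactness of closed balls in ultrafilter form, so that limits along one ultrafilter can be
    taken for uncountably many families at once. *)
Definition proper_space {R : realType} (X : metricType R) :=
  forall T (U : set_system T) (u : T -> X) (x : X) (r : R),
    UltraFilter U -> (\forall t \near U, mdist x (u t) <= r) ->
    exists y : X, u @ U --> y.

Lemma fmap_ultra T S (U : set_system T) (f : T -> S) :
  UltraFilter U -> UltraFilter (f @ U).
Proof.
move=> UF; split; first exact: fmap_proper_filter.
move=> G GF UG; apply/seteqP; split=> [A GA|]; last exact: UG.
have [//|Uc] := in_ultra_setVsetC (f @^-1` A) UF.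
have /UG GAc : (f @ U) (~` A) by [].
by have /filter_ex[x [? ?]] : G (A `&` ~` A) by exact: filterI.
Qed.

Lemma ultra_bounded_cvg {R : realType} T (U : set_system T) (f : T -> R) (r : R) :
  UltraFilter U -> (\forall t \near U, `|f t| <= r) ->
  exists2 y : R, `|y| <= r & f @ U --> y.
Proof.
move=> UF hf; have := @segment_compact R (- r) r; rewrite compact_ultra.
move=> /(_ _ (fmap_ultra f UF)) [|y [yr fy]].
  by apply: filterS hf => t /=; rewrite in_itv/= ler_norml.
by exists y => //; move: yr; rewrite /= in_itv/= ler_norml.
Qed.

Lemma lip1_continuous {R : realType} (f : R -> R) :
  (forall a b, `|f a - f b| <= `|a - b|) -> continuous f.
Proof.
move=> lip t; apply/cvgrPdist_lt => e e0; apply/nbhs_ballP; exists e => // u tu.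
exact: le_lt_trans (lip _ _) tu.
Qed.

Section Line.
Context {R : realType} {X : metricType R}.
Hypotheses (hS : stewart X) (geo : geodesic_space X).
Variable sigma : R -> X.
Hypothesis lin : is_line sigma.
Implicit Types (x y z : X).

Lemma line_convex x a b c : a <= b -> b <= c ->
  (c - a) * mdist x (sigma b) <=
  (c - b) * mdist x (sigma a) + (b - a) * mdist x (sigma c).
Proof.
move=> ab bc.
have := @point_convex _ _ hS geo (c - a) (fun t => sigma (a + t)) x (b - a)
  (@line_segment _ _ _ _ a lin).
rewrite addr0 !(addrC a) !subrK subr_ge0 ab lerD2r bc => /(_ isT).
have -> : c - a - (b - a) = c - b by ring.
by [].
Qed.

Lemma line_stewart x a b c : a <= b -> b <= c ->
  (c - a) * mdist x (sigma b) ^+ 2 <=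
  (c - b) * mdist x (sigma a) ^+ 2 + (b - a) * mdist x (sigma c) ^+ 2
  - (b - a) * (c - b) * (c - a).
Proof.
move=> ab bc.
have := @hS (c - a) (b - a) (fun t => sigma (a + t)) x _
  (@line_segment _ _ _ _ a lin).
rewrite addr0 !(addrC a) !subrK subr_ge0 ab lerD2r bc => /(_ isT).
have -> : c - a - (b - a) = c - b by ring.
by [].
Qed.

Lemma line_lip x a b : `|mdist x (sigma a) - mdist x (sigma b)| <= `|a - b|.
Proof. by rewrite -lin; exact: dist_diff. Qed.

Definition is_foot x t := forall u, mdist x (sigma t) <= mdist x (sigma u).

Lemma foot_exists x : exists t, is_foot x t.
Proof.
have cont : continuous (fun t => mdist x (sigma t)).
  by apply: lip1_continuous => a b; exact: line_lip.
pose M := 2 * mdist x (sigma 0) + 1.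
have M0 : - M <= M.
  by have := mdist_ge0 x (sigma 0); rewrite /M; lra.
have [t _ tmin] := EVT_min M0 (continuous_subspaceT cont).
exists t => u.
have [uM|uM] := boolP (u \in `[(- M), M]); first exact: tmin.
have h0 : mdist x (sigma t) <= mdist x (sigma 0).
  by apply: tmin; rewrite in_itv/= /M; have := mdist_ge0 x (sigma 0); lra.
apply: (le_trans h0).
have : M < `|u|.
  rewrite ltNge; apply: contra uM; rewrite in_itv/= ler_norml//.
have := metric_triangle (sigma 0) x (sigma u).
rewrite lin sub0r normrN (metric_sym (sigma 0)) /M.
have := mdist_ge0 x (sigma 0); lra.
Qed.

(** The angle between the line and the direction to [x] is at least pi/2 at the nearest point, so
    Pythagoras holds as an inequality. *)
Lemma foot_le_sqr x t u : is_foot x t ->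
  mdist x (sigma t) ^+ 2 + (u - t) ^+ 2 <= mdist x (sigma u) ^+ 2.
Proof.
move=> foot.
have sqle v : mdist x (sigma t) ^+ 2 <= mdist x (sigma v) ^+ 2.
  by rewrite ler_pXn2r ?nnegrE ?mdist_ge0.
rewrite leNgt; apply/negP; set H := mdist x (sigma t) ^+ 2 in sqle *.
set U := mdist x (sigma u) ^+ 2 => lt.
have [eq|neq] := eqVneq u t.
  by move: lt; rewrite /U eq subrr expr0n addr0 ltxx.
have d0 : 0 < (u - t) ^+ 2 by rewrite exprn_even_gt0//= subr_eq0.
pose e := (H + (u - t) ^+ 2 - U) / (u - t) ^+ 2 / 2.
have eE : 2 * e * (u - t) ^+ 2 = H + (u - t) ^+ 2 - U.
  have -> : 2 * e * (u - t) ^+ 2 =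
    (H + (u - t) ^+ 2 - U) / (u - t) ^+ 2 * (u - t) ^+ 2.
    by rewrite /e; set q := (H + _ - U) / _; field.
  by rewrite divfK// lt0r_neq0.
have e0 : 0 < e by rewrite !divr_gt0// subr_gt0.
have e1 : e <= 1 / 2.
  have := sqle u; rewrite -/U => HU.
  rewrite -(ler_pM2r d0); lra.
(* the point at fraction [e] from [t] to [u] would be strictly closer *)
pose v := t + e * (u - t).
have hv := sqle v.
case: (ltgtP u t) neq => // ut _.
  have := @line_stewart x u v t _ _; rewrite -/U -/H.
  have -> : u <= v by rewrite /v -subr_ge0; nra.
  have -> : v <= t by rewrite /v; nra.
  move=> /(_ isT isT); rewrite /v in hv *; nra.
have := @line_stewart x t v u _ _; rewrite -/U -/H.
have -> : v <= u by rewrite /v -subr_ge0; nra.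
have -> : t <= v by rewrite /v; nra.
move=> /(_ isT isT); rewrite /v in hv *; nra.
Qed.

Lemma foot_unique x t u : is_foot x t -> is_foot x u -> t = u.
Proof.
move=> ft fu; have h := foot_le_sqr u ft; have h' := foot_le_sqr t fu.
have : (u - t) ^+ 2 = 0.
  by have := sqr_ge0 (u - t); have := sqr_ge0 (t - u); lra.
by move/eqP; rewrite sqrf_eq0 subr_eq0 => /eqP.
Qed.

(** Reshetnyak's quadrilateral inequality. [stewart] is applied from [x] and from [b] to one point
    [m] of the diagonal from [a] to [y], and the other diagonal is compared with the path through
    [m]. *)
Lemma quadrilateral x y a b :
  mdist x b ^+ 2 + mdist a y ^+ 2 <=
  mdist x a ^+ 2 + mdist y b ^+ 2 + 2 * mdist x y * mdist a b.
Proof.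
have [e0|ep] := leP (mdist x y) 0.
  have -> : x = y.
    by apply/mdist_positivity; apply/eqP; rewrite eq_le e0 mdist_ge0.
  by rewrite mdistxx (metric_sym y a); lra.
have [c0|cp] := leP (mdist a b) 0.
  have -> : a = b.
    by apply/mdist_positivity; apply/eqP; rewrite eq_le c0 mdist_ge0.
  by rewrite mdistxx (metric_sym b y); lra.
have [s [seg s0 sl]] := geo a y.
set e := mdist x y in ep *; set c := mdist a b in cp *.
set f := mdist a y in seg sl *.
have f0 : 0 <= f by exact: mdist_ge0.
have ec0 : 0 < e + c by lra.
(* the weights are chosen so that the cross terms below balance: mu / nu = c / e *)
pose mu := c / (e + c); pose nu := e / (e + c).
have munu : mu + nu = 1 by rewrite /mu /nu -mulrDl addrC divff// lt0r_neq0.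
have muE : mu * e = nu * c by rewrite /mu /nu; field; rewrite lt0r_neq0.
have mu0 : 0 < mu by rewrite divr_gt0.
have nu0 : 0 < nu by rewrite divr_gt0.
set m := s (mu * f).
have st z : mdist z m ^+ 2 <= nu * mdist z a ^+ 2 + mu * mdist z y ^+ 2
    - mu * nu * f ^+ 2.
  have [fle|fp] := leP f 0.
    have fE : f = 0 by lra.
    have -> : m = a by rewrite /m fE mulr0.
    rewrite -sl fE s0 expr0n/= mulr0 subr0 -mulrDl addrC munu mul1r//.
  have := @hS f (mu * f) s z; rewrite s0 sl -/m.
  have -> : 0 <= mu * f <= f.
    by rewrite mulr_ge0 ?(ltW mu0)//= ler_piMl//; lra.
  move=> /(_ isT seg) h.
  have {}h : f * mdist z m ^+ 2 <= f * (nu * mdist z a ^+ 2 +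
    mu * mdist z y ^+ 2 - mu * nu * f ^+ 2).
    apply: (le_trans h).
    have -> : nu = 1 - mu by lra.
    by rewrite le_eqVlt; apply/orP; left; apply/eqP; ring.
  by rewrite -(ler_pM2l fp).
have h1 := st x; have h2 := st b.
have tri := metric_triangle x m b.
rewrite -/e in h1; rewrite (metric_sym b a) -/c (metric_sym b y) (metric_sym b m) in h2.
set U := mdist x m in h1 tri; set V := mdist m b in h2 tri.
have U0 : 0 <= U by exact: mdist_ge0.
have V0 : 0 <= V by exact: mdist_ge0.
set A := mdist x a in h1 *; set B := mdist y b in h2 *.
(* (U + V)^2 <= U^2 / nu + V^2 / mu *)
have h3 : mu * nu * (U + V) ^+ 2 <= mu * U ^+ 2 + nu * V ^+ 2.
  have -> : mu * U ^+ 2 + nu * V ^+ 2 =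
    mu * nu * (U + V) ^+ 2 + (mu * U - nu * V) ^+ 2
    + (1 - mu - nu) * (mu * U ^+ 2 + nu * V ^+ 2) by ring.
  have -> : 1 - mu - nu = 0 by lra.
  by rewrite mul0r addr0 lerDl sqr_ge0.
have h4 : mu * nu * mdist x b ^+ 2 <= mu * nu * (U + V) ^+ 2.
  by rewrite (ler_pM2l (mulr_gt0 mu0 nu0)) ler_pXn2r ?nnegrE ?mdist_ge0 ?addr_ge0.
have h5 : mu * U ^+ 2 <= mu * (nu * A ^+ 2 + mu * e ^+ 2 - mu * nu * f ^+ 2).
  by rewrite ler_pM2l.
have h6 : nu * V ^+ 2 <= nu * (nu * c ^+ 2 + mu * B ^+ 2 - mu * nu * f ^+ 2).
  by rewrite ler_pM2l.
have h7 : mu * nu * mdist x b ^+ 2 <= mu * nu * (A ^+ 2 + B ^+ 2 + 2 * e * c - f ^+ 2).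
  apply: (le_trans h4); apply: (le_trans h3).
  apply: (le_trans (lerD h5 h6)).
  have -> : mu * (nu * A ^+ 2 + mu * e ^+ 2 - mu * nu * f ^+ 2) +
    nu * (nu * c ^+ 2 + mu * B ^+ 2 - mu * nu * f ^+ 2) =
    mu * nu * (A ^+ 2 + B ^+ 2 - (mu + nu) * f ^+ 2) +
    (mu * e) * (mu * e) + (nu * c) * (nu * c) by ring.
  rewrite munu mul1r {2}muE -{2}muE.
  by rewrite le_eqVlt; apply/orP; left; apply/eqP; ring.
have {}h7 : mdist x b ^+ 2 <= A ^+ 2 + B ^+ 2 + 2 * e * c - f ^+ 2.
  by rewrite -(ler_pM2l (mulr_gt0 mu0 nu0)).
lra.
Qed.

(** The Pythagorean inequalities at the two feet add up to the left side of [quadrilateral]; what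
    remains is [|t - u|^2 <= d(x, y) * |t - u|]. *)
Lemma foot_lip x y t u : is_foot x t -> is_foot y u -> `|t - u| <= mdist x y.
Proof.
move=> fx fy; have h1 := foot_le_sqr u fx; have h2 := foot_le_sqr t fy.
have h3 := quadrilateral x y (sigma t) (sigma u).
rewrite (metric_sym (sigma t) y) lin in h3.
have [tu|tu] := leP `|t - u| 0; first exact: le_trans tu (mdist_ge0 _ _).
have e : (u - t) ^+ 2 = `|t - u| * `|t - u|.
  by rewrite -expr2 real_normK ?num_real//; ring.
have e' : (t - u) ^+ 2 = `|t - u| * `|t - u|.
  by rewrite -expr2 real_normK ?num_real.
rewrite -(ler_pM2r tu); rewrite e in h1; rewrite e' in h2; lra.
Qed.

(* Feet along a geodesic vary continuously, hence take all intermediate values. *)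
Lemma foot_ivt x y s t u v : segment_between x y s -> is_foot x t ->
  is_foot y u -> t <= v <= u \/ u <= v <= t ->
  exists c, 0 <= c <= mdist x y /\ is_foot (s c) v.
Proof.
move=> [seg s0 sl] ft fu tvu; set l := mdist x y in seg sl *.
have l0 : 0 <= l by exact: mdist_ge0.
have /choice[p hp] := foot_exists.
pose clamp c := Num.min l (Num.max 0 c).
have clampP c : 0 <= clamp c <= l.
  by rewrite /clamp le_min l0 le_max lexx/= ge_min lexx.
have clampE c : 0 <= c <= l -> clamp c = c.
  by move=> /andP[c0 cl]; rewrite /clamp (max_idPr c0) (min_idPr cl).
have clamp_lip a b : `|clamp a - clamp b| <= `|a - b|.
  have n1 := ler_norm (a - b); have n2 := ler_norm (b - a).
  rewrite distrC in n2; rewrite /clamp.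
  have m1 : `|Num.max 0 a - Num.max 0 b| <= `|a - b|.
    by rewrite ler_norml; case: (leP 0 a) => ?; case: (leP 0 b) => ?;
      apply/andP; split; lra.
  apply: le_trans m1; move: (Num.max 0 a) (Num.max 0 b) => {n1 n2}a {}b.
  have n1 := ler_norm (a - b); have n2 := ler_norm (b - a).
  by rewrite distrC in n2; rewrite ler_norml; case: (leP l a) => ?;
    case: (leP l b) => ?; apply/andP; split; lra.
pose f c := p (s (clamp c)).
have cont : continuous f.
  apply: lip1_continuous => a b; apply: (le_trans (foot_lip (hp _) (hp _))).
  by rewrite seg.
have f0 : f 0 = t.
  by rewrite /f clampE ?lexx// s0; apply: foot_unique.
have fl : f l = u.
  by rewrite /f clampE ?lexx ?l0// sl; apply: foot_unique.
have [|c] := @IVT R f 0 l v l0 (continuous_subspaceT cont).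
  rewrite f0 fl /Num.min /Num.max.
  by case: tvu => /andP[h1 h2]; case: ifPn; rewrite -?leNgt => h3; lra.
rewrite in_itv/= => cl fc.
by exists c; split=> //; rewrite -(clampE _ cl) -fc /f; exact: hp.
Qed.

End Line.

Lemma nat_ge {R : realType} (r : R) :
  exists N, forall n, (N <= n)%N -> r <= n%:R.
Proof.
exists (Num.bound `|r|) => n Nn; apply: (@le_trans _ _ (Num.bound `|r|)%:R).
  by apply: ltW; exact: (le_lt_trans (ler_norm r) (archi_boundP (normr_ge0 r))).
by rewrite ler_nat.
Qed.

Lemma ultra_infty : exists2 U : set_system nat, UltraFilter U & \oo `<=` U.
Proof. by have [U [? ?]] := ultraFilterLemma eventually_filter; exists U. Qed.

Section HalfPlane.
Context {R : realType} {X : metricType R}.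
Hypotheses (hS : stewart X) (geo : geodesic_space X) (prop : proper_space X).
Variable sigma : R -> X.
Hypothesis lin : is_line sigma.

(* The half-plane is swept out by the rays issuing from the line towards the
   limit of [x]; all of them make the same angle [acos (- s)] with the line. *)
Lemma flat_half_plane_limit T (U : set_system T) (x : T -> X) (s : R) :
  UltraFilter U -> `|s| < 1 ->
  (forall t, (fun m => mdist (x m) (sigma t) - mdist (x m) (sigma 0)) @ U
     --> s * t) ->
  bounds_flat_half_plane sigma.
Proof.
move=> UF s1 hb.
(* The limits at [K] and [- K] cancel in the sum of the two distances, so the triangle inequality
   through [x m] bounds [K - 1] by the distance of [x m] to [sigma 0]. *)
have far t M : \forall m \near U, M <= mdist (sigma t) (x m).
  pose K : R := `|M| + `|t| + 1.
  have K0 : 0 <= K by rewrite /K; have := normr_ge0 M; have := normr_ge0 t; lra.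
  have /cvgrPdist_lt/(_ 1 ltr01) h1 := hb K.
  have /cvgrPdist_lt/(_ 1 ltr01) h2 := hb (- K).
  apply: filterS (filterI h2 h1) => m [].
  rewrite !ltr_norml => /andP[a1 a2] /andP[b1 b2].
  have := metric_triangle (sigma K) (x m) (sigma (- K)).
  rewrite lin opprK -mulr2n ger0_norm ?mulrn_wge0// (metric_sym (sigma K)).
  have := dist_diff (x m) (sigma 0) (sigma t); rewrite lin sub0r normrN ler_norml.
  rewrite (metric_sym (sigma t)) => /andP[c1 c2]; rewrite mulr2n /K in a1 a2 b1 b2 *.
  have := ler_norm M; lra.
have /choice[S hSg] : forall m, exists S : R -> R -> X,
    forall t, segment_between (sigma t) (x m) (S t).
  by move=> m; have /choice[S hSm] := fun t => geo (sigma t) (x m); exists S.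
have distP t r : 0 <= r -> \forall m \near U, mdist (sigma t) (S m t r) = r.
  move=> r0; apply: filterS (far t r) => m rm.
  by case: (hSg m t) => seg s0 _; rewrite -{1}s0 (segment_dist seg) ?subr0.
have /choice[p0 hp0] : forall q : R * R, exists y : X,
    0 <= q.2 -> (fun m => S m q.1 q.2) @ U --> y.
  move=> [t r] /=; have [r0|r0] := leP 0 r; last first.
    by exists (sigma 0) => r0'; exfalso; lra.
  have [|y hy] := @prop _ U (fun m => S m t r) (sigma t) r UF.
    by apply: filterS (distP t r r0) => m ->.
  by exists y.
pose p t r := p0 (t, r).
have hp t r : 0 <= r -> (fun m => S m t r) @ U --> p t r by exact: (hp0 (t, r)).
(* A limiting law of cosines: [stewart] on the segment from [sigma t] to [x m], whose length [l]
   tends to infinity. The difference [b] of distances to [x m] tends to [- gam], and the error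
   [r * b^2 / l] disappears. *)
have key (Y : T -> X) y t r gam : 0 <= r -> Y @ U --> y ->
    (fun m => mdist (Y m) (x m) - mdist (sigma t) (x m)) @ U --> - gam ->
    mdist y (p t r) ^+ 2 <= mdist y (sigma t) ^+ 2 - 2 * r * gam + r ^+ 2.
  move=> r0 hY hgam; apply/ler_addgt0Pr => e e0.
  have c1 : (fun m => mdist (Y m) (S m t r)) @ U --> mdist y (p t r).
    by apply: cvg_mdist => //; exact: hp.
  have c2 : (fun m => mdist (Y m) (sigma t)) @ U --> mdist y (sigma t).
    by apply: cvg_mdist => //; exact: cvg_cst.
  have c : (fun m => mdist (Y m) (S m t r) ^+ 2 - mdist (Y m) (sigma t) ^+ 2
      - 2 * r * (mdist (Y m) (x m) - mdist (sigma t) (x m))) @ U -->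
      mdist y (p t r) ^+ 2 - mdist y (sigma t) ^+ 2 - 2 * r * (- gam).
    apply: cvgB; last by apply: cvgM => //; exact: cvg_cst.
    by rewrite !expr2; apply: cvgB; exact: cvgM.
  suff : mdist y (p t r) ^+ 2 - mdist y (sigma t) ^+ 2 - 2 * r * (- gam) <=
    r ^+ 2 + e by lra.
  apply: (cvgr_to_le c).
  have /cvgrPdist_lt/(_ 1 ltr01) hg1 := hgam.
  pose B := `|gam| + 1.
  have B0 : 0 <= B by rewrite addr_ge0.
  have q0 : 0 <= r * B ^+ 2 / e by rewrite divr_ge0 ?mulr_ge0 ?sqr_ge0// ltW.
  near=> m.
  have lbig : r + 1 + r * B ^+ 2 / e <= mdist (sigma t) (x m).
    by near: m; exact: far.
  have : `|- gam - (mdist (Y m) (x m) - mdist (sigma t) (x m))| < 1.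
    by near: m; exact: hg1.
  set l := mdist (sigma t) (x m) in lbig *; set b := _ - l => hb1.
  have lp : 0 < l by lra.
  have bB : b ^+ 2 <= B ^+ 2.
    rewrite -[b ^+ 2]real_normK ?num_real// ler_pXn2r ?nnegrE//.
    have -> : b = - (- gam - b) - gam by ring.
    by rewrite (le_trans (ler_normB _ _))// normrN /B addrC lerD2l ltW.
  case: (hSg m t) => seg S0 Sl; rewrite -/l in seg Sl.
  have := @hS l r (S m t) (Y m) _ seg; rewrite r0 S0 Sl.
  have -> : r <= l by lra.
  move=> /(_ isT).
  have -> : mdist (Y m) (x m) = l + b by rewrite /b; ring.
  set A := mdist (Y m) (sigma t); set Z := mdist (Y m) (S m t r) => st.
  have h1 : r * b ^+ 2 <= l * e.
    have : r * b ^+ 2 <= r * B ^+ 2 by rewrite ler_wpM2l.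
    have : (r + 1 + r * B ^+ 2 / e) * e <= l * e by rewrite ler_pM2r.
    have -> : (r + 1 + r * B ^+ 2 / e) * e = (r + 1) * e + r * B ^+ 2 / e * e by ring.
    rewrite divfK ?lt0r_neq0//.
    have : 0 <= (r + 1) * e by rewrite mulr_ge0 ?ltW//; lra.
    lra.
  have h2 : 0 <= r * A ^+ 2 by rewrite mulr_ge0 ?sqr_ge0.
  by rewrite -(ler_pM2l lp); lra.
have hbx t t' : (fun m => mdist (sigma t') (x m) - mdist (sigma t) (x m)) @ U -->
    s * t' - s * t.
  have -> : (fun m => mdist (sigma t') (x m) - mdist (sigma t) (x m)) =
    (fun m => (mdist (x m) (sigma t') - mdist (x m) (sigma 0)) -
              (mdist (x m) (sigma t) - mdist (x m) (sigma 0))).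
    by apply/funext => m; rewrite !(metric_sym (x m)); ring.
  by apply: cvgB; exact: hb.
have upz t r z : 0 <= r -> mdist (p t r) (sigma z) ^+ 2 <=
    (z - t) ^+ 2 + 2 * r * s * (z - t) + r ^+ 2.
  move=> r0; have c0 : (fun=> sigma z) @ U --> sigma z by exact: cvg_cst.
  have := @key (fun=> sigma z) (sigma z) t r (s * (t - z)) r0 c0.
  have -> : - (s * (t - z)) = s * z - s * t by ring.
  move=> /(_ (hbx t z)); rewrite (metric_sym _ (p t r)) lin real_normK ?num_real//.
  by move=> h; apply: (le_trans h); rewrite le_eqVlt; apply/orP; left; apply/eqP; ring.
have dp t r : 0 <= r -> mdist (p t r) (sigma t) = r.
  move=> r0; rewrite metric_sym.
  exact: (mdist_lim_eq (cvg_cst (sigma t)) (hp t r r0) (distP t r r0)).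
(* both sides of the upper bound balance around the foot of the ray *)
have eqz t r z : 0 <= r -> mdist (p t r) (sigma z) ^+ 2 =
    (z - t) ^+ 2 + 2 * r * s * (z - t) + r ^+ 2.
  move=> r0; apply/eqP; rewrite eq_le upz//=.
  have u1 := upz t r z r0; have u2 := upz t r (2 * t - z) r0.
  have dt := dp t r r0.
  have [zt|zt|->] := ltgtP z t.
  - have := @line_stewart _ _ hS sigma lin (p t r) z t (2 * t - z) (ltW zt).
    rewrite dt => /(_ ltac:(lra)).
    have -> : 2 * t - z - z = 2 * (t - z) by ring.
    have -> : 2 * t - z - t = t - z by ring.
    have w0 : 0 < t - z by rewrite subr_gt0.
    move=> st.
    have {}st : 2 * r ^+ 2 <= mdist (p t r) (sigma z) ^+ 2 +
      mdist (p t r) (sigma (2 * t - z)) ^+ 2 - 2 * (t - z) ^+ 2.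
      by rewrite -(ler_pM2l w0); lra.
    lra.
  - have := @line_stewart _ _ hS sigma lin (p t r) (2 * t - z) t z.
    rewrite dt => /(_ ltac:(lra) (ltW zt)).
    have -> : z - (2 * t - z) = 2 * (z - t) by ring.
    have -> : t - (2 * t - z) = z - t by ring.
    have w0 : 0 < z - t by rewrite subr_gt0.
    move=> st.
    have {}st : 2 * r ^+ 2 <= mdist (p t r) (sigma z) ^+ 2 +
      mdist (p t r) (sigma (2 * t - z)) ^+ 2 - 2 * (t - z) ^+ 2.
      by rewrite -(ler_pM2l w0); lra.
    lra.
  - by rewrite dt subrr expr0n/= mulr0 !add0r.
(* Squared distance in oblique planar coordinates, [t] along the axis and [r] along a direction
   whose angle with it has cosine [- s]. *)
pose N t r t' r' := (t - t') ^+ 2 - 2 * s * (r - r') * (t - t') + (r - r') ^+ 2.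
have up t r t' r' : 0 <= r -> 0 <= r' ->
    mdist (p t r) (p t' r') ^+ 2 <= N t r t' r'.
  move=> r0 r'0; rewrite metric_sym.
  have := @key (fun m => S m t' r') (p t' r') t r (s * (t - t') + r') r0 (hp _ _ r'0).
  have cv : (fun m => mdist (S m t' r') (x m) - mdist (sigma t) (x m)) @ U -->
      - (s * (t - t') + r').
    have -> : - (s * (t - t') + r') = s * t' - s * t - r' by ring.
    apply: cvg_trans (cvgB (hbx t t') (cvg_cst r')).
    apply: near_eq_cvg; apply: filterS (far t' r') => m rm /=.
    case: (hSg m t') => seg S0 Sl.
    rewrite -[in mdist _ (x m)]Sl [mdist (S m t' r') _](segment_dist seg) ?Sl//.
    rewrite -[LHS]/(mdist (sigma t') (x m) - mdist (sigma t) (x m) - r'); ring.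
  move=> /(_ cv); rewrite eqz// => h; apply: (le_trans h).
  by rewrite /N le_eqVlt; apply/orP; left; apply/eqP; ring.
have s2 : s ^+ 2 < 1.
  by rewrite -[s ^+ 2]real_normK ?num_real// expr_lt1.
have N0 t r t' r' : 0 <= N t r t' r'.
  rewrite /N.
  have -> : (t - t') ^+ 2 - 2 * s * (r - r') * (t - t') + (r - r') ^+ 2 =
    ((t - t') - s * (r - r')) ^+ 2 + (1 - s ^+ 2) * (r - r') ^+ 2 by ring.
  by rewrite addr_ge0 ?sqr_ge0// mulr_ge0 ?sqr_ge0//; lra.
have low t r t' r' : 0 <= r' -> r' < r -> Num.sqrt (N t r t' r') <=
    mdist (p t r) (p t' r').
  move=> r'0 rr'; have dr0 : 0 < r - r' by rewrite subr_gt0.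
  pose lam := r' / (r - r').
  have lam0 : 0 <= lam by rewrite divr_ge0// ltW.
  have lamE : lam * (r - r') = r' by rewrite divfK// lt0r_neq0.
  (* [z] is where the line through the two points meets the axis *)
  pose z := t' + lam * (t' - t).
  have e1 : mdist (p t r) (sigma z) = (1 + lam) * Num.sqrt (N t r t' r').
    apply/eqP; rewrite -(eqrXn2 (n := 2))// ?mdist_ge0//; last first.
      by rewrite mulr_ge0 ?sqrtr_ge0//; lra.
    rewrite eqz; last lra.
    rewrite exprMn sqr_sqrtr//; apply/eqP.
    have hr : (1 + lam) * (r - r') = r by rewrite mulrDl mul1r lamE; ring.
    have -> : z - t = (1 + lam) * (t' - t) by rewrite /z; ring.
    by rewrite -{1 2}hr /N; ring.
  have e2 : mdist (p t' r') (sigma z) = lam * Num.sqrt (N t r t' r').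
    apply/eqP; rewrite -(eqrXn2 (n := 2))// ?mdist_ge0//; last first.
      by rewrite mulr_ge0 ?sqrtr_ge0.
    rewrite eqz// exprMn sqr_sqrtr//; apply/eqP.
    have -> : z - t' = lam * (t' - t) by rewrite /z; ring.
    rewrite -{1 2}lamE /N; ring.
  have := dist_diff (sigma z) (p t r) (p t' r').
  rewrite !(metric_sym (sigma z)) e1 e2 => h; apply: le_trans h.
  rewrite (le_trans _ (ler_norm _))//; lra.
have exact t r t' r' : 0 <= r -> 0 <= r' ->
    mdist (p t r) (p t' r') = Num.sqrt (N t r t' r').
  move=> r0 r'0; apply/eqP; rewrite eq_le; apply/andP; split.
    by rewrite -(ger0_norm (mdist_ge0 _ _)) -sqrtr_sqr ler_sqrt ?up.
  have [rr'|rr'|rr'] := ltgtP r r'; last 2 first.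
  - exact: low.
  (* At equal heights the line through the two points is parallel to the axis, so one point is first
     raised by [e / 2]. *)
  - rewrite -rr'; apply/ler_addgt0Pr => e e0.
    have e20 : 0 < e / 2 by rewrite divr_gt0.
    have h1 := @low t (r + e / 2) t' r r0 ltac:(lra).
    have h2 := @up t (r + e / 2) t r ltac:(lra) r0.
    have {}h2 : mdist (p t (r + e / 2)) (p t r) <= e / 2.
      rewrite -(ler_pXn2r (n := 2)) ?nnegrE ?mdist_ge0 ?(ltW e20)//.
      apply: (le_trans h2); rewrite /N le_eqVlt; apply/orP; left; apply/eqP; ring.
    have -> : N t r t' r = (t - t') ^+ 2 by rewrite /N; ring.
    rewrite sqrtr_sqr.
    have h3 : `|t - t'| - e / 2 <= Num.sqrt (N t (r + e / 2) t' r).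
      have [le0|ge0] := leP (`|t - t'| - e / 2) 0.
        by rewrite (le_trans le0)// sqrtr_ge0.
      rewrite -(ger0_norm (ltW ge0)) -sqrtr_sqr ler_sqrt// /N.
      have -> : r + e / 2 - r = e / 2 by ring.
      have : 2 * s * (e / 2) * (t - t') <= e * `|t - t'|.
        have -> : 2 * s * (e / 2) * (t - t') = e * (s * (t - t')) by lra.
        rewrite ler_pM2l// (le_trans (ler_norm _))// normrM ler_piMl//.
        exact: ltW.
      have : (t - t') ^+ 2 = `|t - t'| ^+ 2 by rewrite real_normK ?num_real.
      lra.
    have := metric_triangle (p t (r + e / 2)) (p t r) (p t' r); lra.
  - rewrite metric_sym; have -> : N t r t' r' = N t' r' t r by rewrite /N; ring.
    exact: low.
(* The sine of the angle between rays and axis; it turns the oblique coordinates into Cartesian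
   ones. *)
pose k := Num.sqrt (1 - s ^+ 2).
have k0 : 0 < k by rewrite sqrtr_gt0 subr_gt0.
have kk : k ^+ 2 = 1 - s ^+ 2 by rewrite sqr_sqrtr// subr_ge0 ltW.
exists (fun q => p (q.1 + s * (q.2 / k)) (q.2 / k)); split.
  move=> [u v] [u' v'] /= v0 v'0.
  have vk : 0 <= v / k by rewrite divr_ge0// ltW.
  have v'k : 0 <= v' / k by rewrite divr_ge0// ltW.
  rewrite exact// plane_mdist/=; congr Num.sqrt.
  have -> : v = v / k * k by rewrite divfK// lt0r_neq0.
  have -> : v' = v' / k * k by rewrite divfK// lt0r_neq0.
  rewrite !mulfK ?lt0r_neq0//.
  have -> : forall a b : R, (u - u') ^+ 2 + (a * k - b * k) ^+ 2 =
    (u - u') ^+ 2 + (a - b) ^+ 2 * k ^+ 2 by move=> a b; ring.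
  by rewrite kk /N; ring.
move=> t /=; rewrite mul0r mulr0 addr0.
by apply/mdist_positivity; rewrite dp.
Unshelve. all: by end_near. Qed.

End HalfPlane.

(** * Contraction of rank one axes *)

Section ConvexSlope.
Context {R : realType}.
Variables (phi : R -> R) (m : nat).
Hypothesis conv : forall a b c, a <= b -> b <= c ->
  (c - a) * phi b <= (c - b) * phi a + (b - a) * phi c.
Hypothesis lip : forall a b, `|phi a - phi b| <= `|a - b|.

Lemma slope_mono a b c d : a <= b -> b <= c -> b < d -> c <= d ->
  (phi b - phi a) * (d - c) <= (phi d - phi c) * (b - a).
Proof.
move=> ab bc bd cd.
have h1 : (phi b - phi a) * (d - b) <= (phi d - phi b) * (b - a).
  by have := conv ab (ltW bd); lra.
have h2 : (phi d - phi b) * (d - c) <= (phi d - phi c) * (d - b).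
  by have := conv bc cd; lra.
have h3 : (phi b - phi a) * (d - b) * (d - c) <= (phi d - phi b) * (b - a) * (d - c).
  by rewrite ler_wpM2r// subr_ge0.
have h4 : (phi d - phi b) * (d - c) * (b - a) <= (phi d - phi c) * (d - b) * (b - a).
  by rewrite ler_wpM2r// subr_ge0.
have db : 0 < d - b by rewrite subr_gt0.
by rewrite -(ler_pM2r db); lra.
Qed.

Hypothesis bent : forall t0 s, `|s| <= 99 / 100 ->
  ~ (forall u, `|u| <= m%:R -> `|phi (t0 + u) - phi t0 - s * u| <= m.+1%:R^-1).

Let W : R := (2 * m.+1)%:R.
Let N := (2 * m.+1 * m.+1).+1.

(* While the slope stays below 99/100, it increases by a definite amount over
   any two consecutive windows of length [W]. *)
Lemma convex_slope p t : (forall u, phi p <= phi u) -> p <= t ->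
  phi p + 99 / 100 * (t - p - (2 * N + 1)%:R * W) <= phi t.
Proof.
move=> pmin pt.
have W0 : 0 < W by rewrite ltr0n.
have WE : W = 2 * m%:R + 2 by rewrite /W natrM -natr1; lra.
pose A k := p + k%:R * W.
have AS k : A k.+1 = A k + W by rewrite /A -natr1; ring.
pose a k := phi (A k.+1) - phi (A k).
have a_mono k : a k <= a k.+1.
  have := @slope_mono (A k) (A k.+1) (A k.+1) (A k.+2).
  rewrite !AS -/(A k).
  have -> : A k + W + W - (A k + W) = W by ring.
  have -> : A k + W - A k = W by ring.
  move=> /(_ ltac:(lra) ltac:(lra) ltac:(lra) ltac:(lra)).
  by rewrite -!AS ler_pM2r.
have a_ge0 k : 0 <= a k.
  elim: k => [|k IH]; last exact: le_trans (a_mono k).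
  by rewrite /a /A mul0r addr0 subr_ge0.
have a_leW k : a k <= W.
  apply: (le_trans (ler_norm _)); apply: (le_trans (lip _ _)).
  by rewrite AS addrC addKr ger0_norm// ltW.
pose c : R := m.+1%:R^-1.
have c0 : 0 < c by rewrite invr_gt0 ltr0n.
(* Otherwise all secant slopes over the middle window lie between [a k / W] and [a k.+2 / W], which
   makes [phi] affine there up to the error forbidden by [bent]. The half-width [W / 2 = m + 1]
   leaves room for [|u| <= m]. *)
have step k : a k.+1 <= 99 / 100 * W -> a k + c <= a k.+2.
  move=> small; rewrite leNgt; apply/negP => close.
  have sW : `|a k.+1 / W| <= 99 / 100.
    by rewrite ger0_norm ?divr_ge0 ?(ltW W0)// ler_pdivrMr.
  apply: (@bent (A k.+1 + W / 2) _ sW) => u um.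
  have [u1 u2] : - (W / 2) < u /\ u < W / 2.
    by move: um; rewrite ler_norml => /andP[? ?]; split; lra.
  have mono1 v w : A k.+1 <= v -> v <= w -> w <= A k.+2 ->
      a k * (w - v) <= (phi w - phi v) * W /\
      (phi w - phi v) * W <= a k.+2 * (w - v).
    rewrite !AS => Av vw wB.
    have [wv|wv] := leP w v.
      have -> : w = v by lra.
      by split; rewrite !subrr mulr0 mul0r.
    split.
      have := @slope_mono (A k) (A k.+1) v w.
      rewrite -/(a k) !AS; have -> : A k + W - A k = W by ring.
      by apply; lra.
    have := @slope_mono v w (A k.+2) (A k.+3).
    rewrite -/(a k.+2) !AS; have -> : A k + W + W + W - (A k + W + W) = W by ring.
    by apply; lra.
  have sE : a k.+1 / W * W = a k.+1 by rewrite divfK// lt0r_neq0.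
  have m1 := a_mono k; have m2 := a_mono k.+1.
  rewrite -(ler_pM2r W0) -[X in _ * X <= _](gtr0_norm W0) -normrM.
  have -> : (phi (A k.+1 + W / 2 + u) - phi (A k.+1 + W / 2) - a k.+1 / W * u) * W
    = (phi (A k.+1 + W / 2 + u) - phi (A k.+1 + W / 2)) * W - a k.+1 / W * W * u
    by ring.
  rewrite sE; have [u0|u0] := leP 0 u.
    have := @mono1 (A k.+1 + W / 2) (A k.+1 + W / 2 + u).
    rewrite [A k.+2]AS => /(_ ltac:(lra) ltac:(lra) ltac:(lra)).
    rewrite addrAC subrr add0r => -[h1 h2].
    have h3 : a k * u <= a k.+1 * u by rewrite ler_wpM2r.
    have h4 : a k.+1 * u <= a k.+2 * u by rewrite ler_wpM2r.
    have h5 : (a k.+2 - a k) * u <= c * W.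
      by apply: ler_pM => //; lra.
    by rewrite ler_norml -/c; apply/andP; split; lra.
  have := @mono1 (A k.+1 + W / 2 + u) (A k.+1 + W / 2).
  rewrite [A k.+2]AS => /(_ ltac:(lra) ltac:(lra) ltac:(lra)).
  have -> : A k.+1 + W / 2 - (A k.+1 + W / 2 + u) = - u by ring.
  move=> -[h1 h2].
  have h3 : a k * - u <= a k.+1 * - u by rewrite ler_wpM2r// ltW// oppr_gt0.
  have h4 : a k.+1 * - u <= a k.+2 * - u by rewrite ler_wpM2r// ltW// oppr_gt0.
  have h5 : (a k.+2 - a k) * - u <= c * W.
    by apply: ler_pM => //; lra.
  by rewrite ler_norml -/c; apply/andP; split; lra.
(* A gain of [c] over any two windows would give [N * c = W + c] after [2 * N] of them, above the
   Lipschitz bound [W]; so the slope has passed 99/100 by then. *)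
have steep j : j%:R * c <= a (2 * j)%N \/ 99 / 100 * W < a (2 * j)%N.
  elim: j => [|j IH]; first by left; rewrite mul0r.
  have -> : (2 * j.+1 = (2 * j).+2)%N by rewrite mulnS.
  have m1 := a_mono (2 * j)%N; have m2 := a_mono (2 * j).+1.
  case: IH => [h|h]; last by right; lra.
  have [s1|s1] := leP (a (2 * j).+1) (99 / 100 * W); last by right; lra.
  by left; have := step _ s1; rewrite -natr1; lra.
have {steep} steep : 99 / 100 * W < a (2 * N)%N.
  case: (steep N) => // h; have := a_leW (2 * N)%N.
  have : N%:R * c = W + c.
    by rewrite /N -natr1 mulrDl mul1r natrM -/W /c mulfK// pnatr_eq0.
  lra.
have [tD|tD] := leP t (p + (2 * N + 1)%:R * W).
  apply: (le_trans _ (pmin t)); rewrite gerDl.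
  by rewrite pmulr_rle0; lra.
pose q := A (2 * N)%N.
have qE : p + (2 * N + 1)%:R * W = q + W by rewrite /q /A natrD; ring.
have := conv (_ : q <= q + W) (_ : q + W <= t).
rewrite -qE (ltW tD) qE lerDl (ltW W0) => /(_ isT isT) h.
have h1 : a (2 * N)%N = phi (q + W) - phi q by rewrite /a AS.
rewrite h1 in steep.
have h2 : 0 <= t - q by lra.
have h3 : 99 / 100 * W * (t - q) <= (phi (q + W) - phi q) * (t - q).
  by rewrite ler_wpM2r// ltW.
have h4 : 99 / 100 * (t - q) <= phi t - phi q by rewrite -(ler_pM2r W0); lra.
have := pmin q.
have -> : t - p - (2 * N + 1)%:R * W = t - q - W by lra.
lra.
Qed.

End ConvexSlope.

Section Contraction.
Context {R : realType} {X : metricType R}.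
Hypotheses (hS : stewart X) (geo : geodesic_space X) (prop : proper_space X).
Variables (sigma : R -> X) (g : X -> X) (L : R).
Hypotheses (lin : is_line sigma) (g_iso : is_isometry g) (L0 : 0 < L).
Hypothesis gsigma : forall t, g (sigma t) = sigma (t + L).
Hypothesis noflat : ~ bounds_flat_half_plane sigma.
Implicit Types x y z : X.

(** Powers of [g] carry any base time into [[- L, L]], which keeps the data bounded when a limit is
    taken. *)
Lemma axis_translate x t0 : exists y tau, `|tau| <= L /\
  forall u, mdist y (sigma (tau + u)) = mdist x (sigma (t0 + u)).
Proof.
have [n hn] := nat_ge (`|t0| / L).
have {hn} : `|t0| <= n.+1%:R * L by rewrite -ler_pdivrMr// hn.
elim: n x t0 => [|n IH] x t0; first by rewrite mul1r => h; exists x, t0.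
rewrite -natr1 mulrDl mul1r => h.
have [t0L|t0L] := leP t0 L; last first.
  have [y gy] := (proj2 g_iso) x.
  have [|z [tau [h1 h2]]] := IH y (t0 - L).
    have t00 : 0 < t0 by exact: lt_trans L0 t0L.
    by rewrite (gtr0_norm t00) in h; rewrite gtr0_norm ?subr_gt0//; lra.
  exists z, tau; split=> // u; rewrite h2 -gy -(proj1 g_iso) gsigma.
  by congr (mdist _ (sigma _)); ring.
have [t0L'|t0L'] := leP (- L) t0.
  by exists x, t0; split=> //; rewrite ler_norml t0L t0L'.
have [|z [tau [h1 h2]]] := IH (g x) (t0 + L).
  rewrite ler0_norm; last lra.
  move: h; rewrite ler0_norm; lra.
exists z, tau; split=> // u; rewrite h2 -[RHS](proj1 g_iso) gsigma.
by congr (mdist _ (sigma _)); ring.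
Qed.

(** If it fails for every [m], distance functions that are almost affine on windows of radius [m],
    with centres translated to bounded times, have slopes converging along an ultrafilter, and
    [flat_half_plane_limit] applies. The bound 99/100 keeps the limit slope inside [(-1, 1)]. *)
Lemma axis_bent : exists m : nat, forall x t0 s, `|s| <= 99 / 100 ->
  ~ (forall u, `|u| <= m%:R ->
       `|mdist x (sigma (t0 + u)) - mdist x (sigma t0) - s * u| <= m.+1%:R^-1).
Proof.
apply: contrapT => /forallNP H; apply: noflat.
have /choice[d hd] : forall m : nat, exists d : X * R * R,
    [/\ `|d.2| <= 99 / 100, `|d.1.2| <= L & forall u, `|u| <= m%:R ->
    `|mdist d.1.1 (sigma (d.1.2 + u)) - mdist d.1.1 (sigma d.1.2) - d.2 * u|
      <= m.+1%:R^-1].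
  move=> m; have /existsNP[x /existsNP[t0 /existsNP[s /not_implyP[s1 /contrapT h]]]] := H m.
  have [y [tau [tauL htau]]] := axis_translate x t0.
  exists (y, tau, s); split=> //= u um.
  have htau0 := htau 0; rewrite !addr0 in htau0.
  by rewrite htau htau0; exact: h.
have [U UF Uinf] := ultra_infty.
have [|s s1 hs] := @ultra_bounded_cvg R nat U (fun m => (d m).2) (99 / 100) UF.
  by apply: nearW => m; case: (hd m).
apply: (@flat_half_plane_limit _ _ hS geo prop sigma lin nat U (fun m => (d m).1.1) s).
  by apply: (le_lt_trans s1); lra.
move=> t.
have cst : (fun m => (d m).2 * t) @ U --> s * t by apply: cvgM => //; exact: cvg_cst.
have err : (fun m => mdist (d m).1.1 (sigma t) - mdist (d m).1.1 (sigma 0)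
    - (d m).2 * t) @ U --> (0 : R).
  apply/cvgrPdist_le => e e0; apply: Uinf.
  have [n1 h1] := nat_ge (`|t| + L); have [n2 h2] := nat_ge (2 / e).
  exists (maxn n1 n2) => // m /=; rewrite geq_max => /andP[/h1 k1 /h2 k2].
  case: (hd m) => _ tauL hm; set x := (d m).1.1 in hm *; set tau := (d m).1.2 in hm tauL *.
  have := hm (t - tau) _; have := hm (- tau) _.
  rewrite addrN (addrC tau) subrK normrN.
  have -> : `|tau| <= m%:R by apply: le_trans k1; apply: (le_trans tauL); rewrite lerDr.
  have -> : `|t - tau| <= m%:R.
    by apply: le_trans k1; apply: (le_trans (ler_normB _ _)); rewrite lerD2l.
  move=> /(_ isT) a1 /(_ isT) a2; rewrite sub0r normrN.
  have -> : mdist x (sigma t) - mdist x (sigma 0) - (d m).2 * t =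
    (mdist x (sigma t) - mdist x (sigma tau) - (d m).2 * (t - tau)) -
    (mdist x (sigma 0) - mdist x (sigma tau) - (d m).2 * (- tau)) by ring.
  apply: (le_trans (ler_normB _ _)); apply: (le_trans (lerD a2 a1)).
  have m0 : 0 < m.+1%:R :> R by rewrite ltr0n.
  rewrite -(ler_pM2r m0) mulrDl mulVf ?lt0r_neq0//.
  move: k2; rewrite ler_pdivrMr// -natr1; lra.
have cv : (fun m => (d m).2 * t + (mdist (d m).1.1 (sigma t)
    - mdist (d m).1.1 (sigma 0) - (d m).2 * t)) @ U --> s * t + 0 by exact: cvgD.
rewrite addr0 in cv; apply: cvg_trans cv.
by apply: near_eq_cvg; apply: nearW => m; ring.
Qed.

(** [convex_slope] for the distance from [x] to the axis, and for its reflection when [t] is before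
    the foot. [D0] is uniform in [x] because the [m] of [axis_bent] is. *)
Lemma axis_far : exists2 D0, 0 <= D0 & forall x p, is_foot sigma x p ->
  forall t, mdist x (sigma p) + 99 / 100 * (`|t - p| - D0) <= mdist x (sigma t).
Proof.
have [m bent] := axis_bent.
exists ((2 * (2 * m.+1 * m.+1).+1 + 1)%:R * (2 * m.+1)%:R); first by rewrite mulr_ge0.
move=> x p foot t; set D0 := (2 * _ + 1)%:R * _.
have [pt|pt] := leP p t.
  rewrite ger0_norm ?subr_ge0//.
  apply: (@convex_slope R (fun u => mdist x (sigma u)) m) => //.
  - by move=> a b c; exact: line_convex.
  - by move=> a b; exact: line_lip.
  - by move=> t0 s; exact: bent.
rewrite ltr0_norm ?subr_lt0// opprB.
have := @convex_slope R (fun u => mdist x (sigma (- u))) m _ _ _ (- p) (- t).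
rewrite !opprK lerN2 (ltW pt) -/D0 (addrC (- t)); apply=> //.
- move=> a b c ab bc.
  have := @line_convex _ _ hS geo sigma lin x (- c) (- b) (- a).
  by rewrite !lerN2 => /(_ bc ab); lra.
- move=> a b; rewrite (le_trans (line_lip _ _ _ _))//.
  by rewrite -opprD normrN.
- move=> t0 s s1 h; apply: (@bent x (- t0) (- s)); first by rewrite normrN.
  move=> u um; have := h (- u); rewrite normrN => /(_ um).
  by rewrite opprB (addrC u) mulrN mulNr.
Qed.

(* If [d(x,y) < d(x,B)], then at [B] the directions of [x] and [y] make an
   angle at most pi/2, while [x] lies almost in the direction of the axis. *)
Lemma axis_leg : exists R2 D, [/\ 0 < R2, 0 <= D & forall x y p B,
  is_foot sigma x p -> is_foot sigma y B -> R2 <= mdist y (sigma B) ->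
  D <= `|p - B| -> mdist x (sigma B) <= mdist x y].
Proof.
have [D0 D00 far] := axis_far.
pose r := 10 * D0 + 1; have r0 : 0 < r by rewrite /r; lra.
exists r, (100 * D0 + 2 * r); split=> //; first lra.
move=> x y p B fx fy ry; set l := `|p - B| => lD.
rewrite leNgt; apply/negP => xy.
have l0 : 0 < l by lra.
pose e : R := Num.sg (p - B).
have eE : B + e * l = p by rewrite /e /l mulr_sg_norm addrC subrK.
have e1 : e * e = 1.
  rewrite /e -expr2 sqr_sg.
  have -> : p - B != 0 by rewrite -normr_gt0.
  by [].
have aseg k : is_segment k (fun t => sigma (B + e * t)).
  move=> a b _ _; rewrite lin.
  have -> : B + e * a - (B + e * b) = e * (a - b) by ring.
  by rewrite normrM /e normr_sg -normr_gt0 l0 mul1r.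
pose Bx := mdist x (sigma B).
have hx := far x p fx B; rewrite -/Bx distrC -/l in hx.
have hx0 := mdist_ge0 x (sigma p).
have Bx0 : r <= Bx by lra.
have By0 : 0 < mdist y (sigma B) by lra.
(* reduction to a point at height exactly [r] *)
have [s [segs s0 sy]] := geo (sigma B) y.
set b := mdist (sigma B) y in segs sy.
have bE : b = mdist y (sigma B) by rewrite /b metric_sym.
pose y' := s r.
have xy' : mdist x y' <= Bx.
  have := point_convex hS geo x segs (a := r); rewrite s0 sy (ltW r0) bE ry => /(_ isT).
  rewrite -bE -/y' -/Bx => h.
  have : r * mdist x y <= r * Bx by rewrite ler_pM2l// ltW.
  have b0 : 0 < b by rewrite bE.
  by move=> h2; rewrite -(ler_pM2l b0); lra.
have yy' : mdist y' y = b - r.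
  by rewrite -[in LHS]sy /y' (segment_dist segs) ?(ltW r0) ?bE.
have By' : mdist (sigma B) y' = r by rewrite -s0 (segment_dist segs) ?subr0 ?(ltW r0) ?bE.
have fy' : is_foot sigma y' B.
  move=> u; have := metric_triangle y y' (sigma u); have := fy u.
  rewrite (metric_sym y y') yy' (metric_sym y' (sigma B)) By' -bE; lra.
have [w [segw w0 wx]] := geo (sigma B) x.
rewrite (metric_sym (sigma B)) -/Bx in segw wx.
pose x' := w r.
have Bxp : 0 < Bx by lra.
have segy' : is_segment r s by apply: segment_sub segs; rewrite bE.
have h1 : mdist x' y' <= 71 / 50 * r.
  have := cat0_hinge hS segw segy' _ (a := r) (b := r).
  rewrite w0 s0 wx (ltW r0) Bx0 lexx -/x' -/y' => /(_ erefl isT isT) h.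
  have xy2 : mdist x y' ^+ 2 <= Bx ^+ 2 by rewrite ler_pXn2r ?nnegrE ?mdist_ge0 ?(ltW Bxp).
  have h2 : r * r * (mdist x y' ^+ 2) <= r * r * Bx ^+ 2.
    by rewrite ler_pM2l// mulr_gt0.
  have rr : 0 < r * r * r * r by rewrite !mulr_gt0.
  have h3 : mdist x' y' ^+ 2 <= 2 * r ^+ 2.
    by rewrite -(ler_pM2l (mulr_gt0 Bxp r0)); lra.
  rewrite -(ler_pXn2r (n := 2)) ?nnegrE ?mdist_ge0 ?mulr_ge0 ?(ltW r0)//.
  rewrite exprMn; have := sqr_ge0 r; lra.
pose c := sigma (B + e * r).
have h2 : mdist x' c <= 1 / 5 * r.
  have Y : mdist x c <= Bx - 49 / 50 * r.
    have := point_convex hS geo x (aseg l) (a := r).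
    rewrite mulr0 addr0 eE -/c -/Bx (ltW r0) => /(_ ltac:(lra)) h.
    have : r * mdist x (sigma p) <= r * (Bx - 99 / 100 * (l - D0)).
      by rewrite ler_pM2l//; lra.
    have : r * (100 * D0) <= r * l by rewrite ler_pM2l//; lra.
    have rl := mulr_gt0 r0 l0.
    by move=> h2 h3; rewrite -(ler_pM2l l0); lra.
  have := cat0_hinge hS segw (aseg r) _ (a := r) (b := r).
  rewrite w0 mulr0 addr0 wx (ltW r0) Bx0 lexx -/x' -/c => /(_ erefl isT isT) h.
  have Y2 : mdist x c ^+ 2 <= (Bx - 49 / 50 * r) ^+ 2.
    by rewrite ler_pXn2r ?nnegrE ?mdist_ge0//; lra.
  have h3 : r * r * mdist x c ^+ 2 <= r * r * (Bx - 49 / 50 * r) ^+ 2.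
    by rewrite ler_pM2l// mulr_gt0.
  have h4 : r * r * r * r <= Bx * r * r * r by rewrite !ler_pM2r.
  have h5 : mdist x' c ^+ 2 <= 1 / 25 * r ^+ 2.
    rewrite -(ler_pM2l (mulr_gt0 Bxp r0)).
    have rr : 0 < r * r * r * r by rewrite !mulr_gt0.
    lra.
  rewrite -(ler_pXn2r (n := 2)) ?nnegrE ?mdist_ge0 ?mulr_ge0 ?(ltW r0)//.
  rewrite exprMn; lra.
(* By [h1] and [h2] the distance from [y'] to [c] is at most [71/50 * r + 1/5 * r], where 71/50
   bounds the square root of 2. But [axis_far] at the foot [B] of [y'] demands
   [r + 99/100 * (r - D0)], which is larger since [r > 10 * D0]. *)
have := far y' B fy' (B + e * r); rewrite -/c.
have -> : `|B + e * r - B| = r.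
  rewrite addrC addKr normrM /e normr_sg -normr_gt0 l0 mul1r ger0_norm//.
  exact: ltW.
rewrite (metric_sym y') By'.
have := metric_triangle y' x' c; rewrite (metric_sym y' x').
by rewrite /r in h1 h2 *; lra.
Qed.

(** For a point [z] of the segment with foot [v], [long] on both sides of [z] counts its distance to
    the axis twice; comparison with the detour along the axis bounds this distance. *)
Lemma axis_near : exists2 C, 0 <= C & forall x y p q v,
  is_foot sigma x p -> is_foot sigma y q ->
  C <= `|p - v| -> C <= `|q - v| -> p <= v <= q \/ q <= v <= p ->
  passes x y (sigma v) C.
Proof.
have [r [D [r0 D0 leg]]] := axis_leg.
(* A point [z] of the segment with foot [v] is either low, and then the segment passes near
   [sigma v], or high, and then [axis_leg] applies to both halves. *)
have height x y p q : is_foot sigma x p -> is_foot sigma y q -> 2 * D <= `|p - q| ->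
    mdist x (sigma p) + mdist y (sigma q) - 2 * r <= mdist x y.
  move=> fx fy pqD.
  have [s sxy] := geo x y.
  pose v := if p <= q then p + D else p - D.
  have [pv qv vb] : [/\ D = `|p - v|, D <= `|q - v| & p <= v <= q \/ q <= v <= p].
    rewrite /v; case: (leP p q) pqD => pq.
    - rewrite (ler0_norm (_ : p - q <= 0)) => [pqD|]; last lra.
      rewrite opprD addrA subrr sub0r normrN ger0_norm// ger0_norm; last lra.
      by split; lra.
    - rewrite (gtr0_norm (_ : 0 < p - q)) => [pqD|]; last lra.
      rewrite opprB addrCA subrr addr0 ger0_norm// ler0_norm; last lra.
      by split; lra.
  have [c [/andP[c0 cl] fc]] := foot_ivt hS geo lin sxy fx fy vb.
  case: sxy => seg s0 sl; set z := s c in fc.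
  have xz : mdist x z = c by rewrite -s0 /z (segment_dist seg) ?subr0.
  have zy : mdist z y = mdist x y - c by rewrite -[in LHS]sl /z (segment_dist seg).
  have hx := fx v; have hy := fy v.
  have [big|small] := leP r (mdist z (sigma v)).
    have := leg x z p v fx fc big; rewrite -pv => /(_ (lexx _)).
    have := leg y z q v fy fc big qv; rewrite (metric_sym y z); lra.
  have := metric_triangle x z (sigma v); have := metric_triangle y z (sigma v).
  rewrite (metric_sym y z); lra.
pose C := 4 * D + 4 * r.
(* The points with feet [2 * D] inside the two ends cut off pieces to which [height] applies.
   Projection being 1-Lipschitz, the middle piece contributes [|p - q| - 4 * D]. *)
have long x y p q : is_foot sigma x p -> is_foot sigma y q -> 4 * D <= `|p - q| ->
    mdist x (sigma p) + mdist y (sigma q) + `|p - q| - C <= mdist x y.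
  move=> fx fy pqD.
  have [s sxy] := geo x y.
  pose v := if p <= q then p + 2 * D else p - 2 * D.
  pose w := if p <= q then q - 2 * D else q + 2 * D.
  have [pv qw vwE vb wb] : [/\ 2 * D = `|p - v|, 2 * D = `|q - w|,
     `|v - w| = `|p - q| - 4 * D, p <= v <= q \/ q <= v <= p
     & v <= w <= q \/ q <= w <= v].
    have D20 : 0 <= 2 * D by lra.
    rewrite /v /w; case: (leP p q) pqD => pq.
    - rewrite (ler0_norm (_ : p - q <= 0)) => [pqD|]; last lra.
      rewrite opprD addrA subrr sub0r normrN ger0_norm//.
      rewrite (_ : q - (q - 2 * D) = 2 * D); last ring.
      by rewrite (ger0_norm D20) ler0_norm; last lra; split; lra.
    - rewrite (gtr0_norm (_ : 0 < p - q)) => [pqD|]; last lra.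
      rewrite opprB addrCA subrr addr0 ger0_norm//.
      rewrite (_ : q - (q + 2 * D) = - (2 * D)); last ring.
      by rewrite normrN (ger0_norm D20) ger0_norm; last lra; split; lra.
  have [c [/andP[c0 cl] fc]] := foot_ivt hS geo lin sxy fx fy vb.
  case: sxy => seg s0 sl; set z := s c in fc.
  have xz : mdist x z = c by rewrite -s0 /z (segment_dist seg) ?subr0.
  have zy : mdist z y = mdist x y - c by rewrite -[in LHS]sl /z (segment_dist seg).
  have [t szy] := geo z y.
  have [d [/andP[d0 dl] fd]] := foot_ivt hS geo lin szy fc fy wb.
  case: szy => segt t0 tl; set z' := t d in fd.
  have zz' : mdist z z' = d by rewrite -t0 /z' (segment_dist segt) ?subr0.
  have z'y : mdist z' y = mdist z y - d by rewrite -[in LHS]tl /z' (segment_dist segt).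
  have := height x z p v fx fc; rewrite -pv => /(_ (lexx _)).
  have := height y z' q w fy fd; rewrite -qw (metric_sym y z') => /(_ (lexx _)).
  have := foot_lip hS geo lin fc fd; rewrite vwE.
  have := mdist_ge0 z (sigma v); have := mdist_ge0 z' (sigma w).
  by rewrite /C; lra.
have C0 : 0 <= C by rewrite /C; lra.
exists (2 * C); first lra.
move=> x y p q v fx fy pv qv vb s sxy.
have [c [/andP[c0 cl] fc]] := foot_ivt hS geo lin sxy fx fy vb.
exists c; split; first by rewrite c0.
case: sxy => seg s0 sl; set z := s c in fc *.
have xz : mdist x z = c by rewrite -s0 /z (segment_dist seg) ?subr0.
have zy : mdist z y = mdist x y - c by rewrite -[in LHS]sl /z (segment_dist seg).
have h1 := long x z p v fx fc; have h2 := long y z q v fy fc.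
have h3 : 4 * D <= `|p - v| by apply: le_trans pv; rewrite /C; lra.
have h4 : 4 * D <= `|q - v| by apply: le_trans qv; rewrite /C; lra.
have {}h1 := h1 h3; have {}h2 := h2 h4.
have h5 : mdist x y <= mdist x (sigma p) + `|p - q| + mdist y (sigma q).
  have := metric_triangle x (sigma p) y; have := metric_triangle (sigma p) (sigma q) y.
  by rewrite lin (metric_sym (sigma q)); lra.
have h6 : `|p - q| = `|p - v| + `|q - v|.
  case: vb => /andP[a1 a2].
    by rewrite ler0_norm ?subr_le0 ?(le_trans a1)// ler0_norm ?subr_le0// ger0_norm ?subr_ge0//; lra.
  by rewrite ger0_norm ?subr_ge0 ?(le_trans a1)// ger0_norm ?subr_ge0// ler0_norm ?subr_le0//; lra.
rewrite (metric_sym y z) in h2; lra.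
Qed.

End Contraction.

(** * Rays in the product *)

Section HopfRinow.
Context {R : realType} {X : metricType R}.
Hypotheses (comp : complete_space X) (geo : geodesic_space X)
  (lc : locally_compact [set: X]).

Let good (x0 : X) (r : R) := forall T (U : set_system T) (u : T -> X) (r' : R),
  UltraFilter U -> (fun t => mdist x0 (u t)) @ U --> r' -> r' <= r ->
  exists y : X, u @ U --> y.

(* Retraction of a bounded family onto the ball of radius [r] around [x0]. *)
Let retract (x0 : X) r T (U : set_system T) (u : T -> X) r' :
  UltraFilter U -> 0 <= r -> good x0 r -> (fun t => mdist x0 (u t)) @ U --> r' ->
  exists2 y, mdist x0 y <= r & forall e, 0 < e -> r' - r < e ->
    \forall t \near U, mdist y (u t) < 2 * e.
Proof.
move=> UF r0 gr ur'.
have /choice[S hS] := fun t => geo x0 (u t).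
pose v t := S t (Num.min (mdist x0 (u t)) r).
have dv t : mdist x0 (v t) = Num.min (mdist x0 (u t)) r.
  case: (hS t) => seg s0 sl; rewrite -{1}s0 /v (segment_dist seg) ?subr0//.
    by rewrite le_min mdist_ge0.
  by rewrite ge_min lexx.
have duv t : mdist (v t) (u t) = mdist x0 (u t) - Num.min (mdist x0 (u t)) r.
  case: (hS t) => seg s0 sl; rewrite -[X in mdist _ X]sl /v (segment_dist seg)//.
    by rewrite le_min mdist_ge0.
  by rewrite ge_min lexx.
have [|l lr vl] := @ultra_bounded_cvg R T U (fun t => mdist x0 (v t)) r UF.
  by apply: nearW => t; rewrite ger0_norm ?mdist_ge0// dv ge_min lexx orbT.
have lr' : l <= r by apply: le_trans lr; exact: ler_norm.
have [y vy] := gr T U v l UF vl lr'.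
exists y.
  apply: (mdist_lim_le (F := U) (cvg_cst x0) vy).
  by apply: nearW => t; rewrite dv ge_min lexx orbT.
move=> e e0 re.
have /metricType_numDomainType.cvgr_dist_lt/(_ _ e0) h1 := vy.
have e1 : 0 < e - (r' - r) by lra.
have /cvgrPdist_lt/(_ _ e1) h2 := ur'.
apply: filterS (filterI h1 h2) => t [h3]; rewrite ltr_norml => /andP[h4 h5].
apply: (le_lt_trans (metric_triangle _ (v t) _)); rewrite duv.
by case: (leP (mdist x0 (u t)) r) => h; lra.
Qed.

(** If the good radii had a finite supremum [rho], completeness would make [rho] itself good, and
    local compactness at a limit of points of the ball of radius [rho] would make a larger radius
    good. *)
Lemma locally_compact_proper : proper_space X.
Proof.
suff all_good (x0 : X) r : good x0 r.
  move=> T U u x r UF hb.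
  have [|l lr ul] := @ultra_bounded_cvg R T U (fun t => mdist x (u t)) r UF.
    by apply: filterS hb => t; rewrite ger0_norm ?mdist_ge0.
  by apply: (all_good x r T U u l UF ul); apply: le_trans lr; exact: ler_norm.
apply: contrapT => bad.
pose A := [set r | 0 <= r /\ good x0 r].
have A0 : A 0.
  split=> // T U u r' UF ur' r'0; exists x0.
  apply/metricType_numDomainType.cvgrPdist_lt => e e0.
  have /cvgrPdist_lt/(_ _ e0) := ur'; apply: filterS => t.
  by rewrite ltr_norml => /andP[h1 h2]; lra.
have goodW r1 r2 : r1 <= r2 -> good x0 r2 -> good x0 r1.
  move=> r12 g2 T U u r' UF ur' r'1; apply: (g2 T U u r') => //.
  exact: le_trans r12.
have Aub : has_sup A.
  split; first by exists 0.
  exists r => r1 [_ g1]; rewrite leNgt; apply/negP => rr1.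
  by apply: bad; apply: goodW g1; exact: ltW.
pose rho := sup A.
have rho0 : 0 <= rho by exact: (ub_le_sup (proj2 Aub) A0).
(* Retraction to balls of radius [r1] slightly below [rho] gives, for every [e], a point within [e]
   of which the family eventually stays; so the family is Cauchy. *)
have grho : good x0 rho.
  move=> T U u r' UF ur' r'rho.
  have : cauchy (u @ U).
    apply: cauchy_exP => e e0.
    have e2 : 0 < e / 2 by rewrite divr_gt0.
    have [r1 [r10 g1] r1rho] := sup_adherent e2 Aub.
    have [y _ hy] := retract UF r10 g1 ur'.
    exists y; have := hy _ e2; rewrite -metricType_numDomainType.ball_mdistE.
    have -> : 2 * (e / 2) = e by field.
    apply; rewrite -/rho in r1rho; lra.
  by move=> /comp[y hy]; exists y.
suff [d d0 gd] : exists2 d, 0 < d & good x0 (rho + d).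
  have : rho + d <= rho.
    by apply: (ub_le_sup (proj2 Aub)); split=> //; lra.
  lra.
apply: contrapT => nod.
(* Non-convergent families reaching only [1 / n.+1] beyond [rho] are retracted to points [z n];
   compactness near a limit of the [z n] will contradict their non-convergence. *)
have /choice[z hz] : forall n : nat, exists z, mdist x0 z <= rho /\
    exists T (U : set_system T) (u : T -> X), [/\ UltraFilter U,
      \forall t \near U, mdist z (u t) < 4 * n.+1%:R^-1 &
      ~ exists y : X, u @ U --> y].
  move=> n; pose e : R := n.+1%:R^-1; have e0 : 0 < e by rewrite invr_gt0.
  have : ~ good x0 (rho + e) by move=> g; apply: nod; exists e.
  move=> /existsNP[T /existsNP[U /existsNP[u /existsNP[r' ]]]].
  move=> /not_implyP[UF /not_implyP[ur' /not_implyP[r'rho nc]]].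
  have [y yrho hy] := retract UF rho0 grho ur'.
  exists y; split=> //; exists T, U, u; split=> //.
  have := hy (2 * e); rewrite (_ : 2 * (2 * e) = 4 * e); last by ring.
  by apply; lra.
have [W WF Winf] := ultra_infty.
have [|l lr zl] := @ultra_bounded_cvg R nat W (fun n => mdist x0 (z n)) rho WF.
  by apply: nearW => n; rewrite ger0_norm ?mdist_ge0//; case: (hz n).
have lr' : l <= rho by apply: le_trans lr; exact: ler_norm.
have [y zy] := grho nat W z l WF zl lr'.
have := lc (x := y) I.
rewrite /precompact /compact_near => -[K].
move=> wK [cK _].
have /nbhs_ballP[d /= d0 yK] : nbhs y K.
  by apply: (filterS _ (wK : nbhs y (fun t => [set: X] t -> K t))) => t; exact.
have d20 : 0 < d / 2 by rewrite divr_gt0.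
have [n [zn dn]] : exists n, mdist y (z n) < d / 2 /\ 4 * n.+1%:R^-1 < d / 2.
  have /metricType_numDomainType.cvgr_dist_lt/(_ _ d20) h1 := zy.
  have [N hN] := nat_ge (8 / d).
  have h2 : W [set n | (N <= n)%N] by apply: Winf; exists N.
  have [n [n1 n2]] := filter_ex (filterI h1 h2).
  exists n; split=> //; have := hN n n2; rewrite ler_pdivrMr// => h.
  have n0 : 0 < n.+1%:R :> R by rewrite ltr0n.
  rewrite -(ltr_pM2r n0) mulfVK ?lt0r_neq0// -natr1; lra.
have [_ [T [U [u [UF hu nc]]]]] := hz n.
apply: nc; move: cK; rewrite compact_ultra => /(_ _ (fmap_ultra u UF)) [].
  apply: filterS hu => t ht /=; apply: yK.
  rewrite -metricType_numDomainType.ball_mdistE/=.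
  apply: (le_lt_trans (metric_triangle _ (z n) _)); have := lt_trans ht dn; lra.
by move=> y' [_ hy']; exists y'.
Qed.

End HopfRinow.

(** * Geodesics of the product and their slopes *)

Section Product.
Context {R : realType} {X1 X2 : metricType R}.
Hypotheses (hS1 : stewart X1) (hS2 : stewart X2)
  (geo1 : geodesic_space X1) (geo2 : geodesic_space X2).
Local Notation X := (l2prod X1 X2).

Lemma l2_sqr (p q : X) :
  mdist p q ^+ 2 = mdist p.1 q.1 ^+ 2 + mdist p.2 q.2 ^+ 2.
Proof. by rewrite l2prod_mdistE sqr_sqrtr// addr_ge0 ?sqr_ge0. Qed.

Lemma l2_ge1 (p q : X) : mdist p.1 q.1 <= mdist p q.
Proof.
rewrite -(ler_pXn2r (n := 2)) ?nnegrE ?mdist_ge0// l2_sqr lerDl; exact: sqr_ge0.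
Qed.

Lemma l2_ge2 (p q : X) : mdist p.2 q.2 <= mdist p q.
Proof.
rewrite -(ler_pXn2r (n := 2)) ?nnegrE ?mdist_ge0// l2_sqr lerDr; exact: sqr_ge0.
Qed.

Lemma l2_le (p q : X) : mdist p q <= mdist p.1 q.1 + mdist p.2 q.2.
Proof.
rewrite -(ler_pXn2r (n := 2)) ?nnegrE ?addr_ge0 ?mdist_ge0// l2_sqr sqrrD.
have : 0 <= mdist p.1 q.1 * mdist p.2 q.2 by rewrite mulr_ge0 ?mdist_ge0.
by rewrite mulr2n; lra.
Qed.

(** The components of a product geodesic run at constant speed [l' / l]. The last term carries the
    squared speed, so two components whose squared speeds sum to 1 add up to [stewart] in the
    product. *)
Lemma stewart_proportional (Y : metricType R) (hY : stewart Y) (s : R -> Y)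
    (l l' a : R) (z : Y) : 0 < l -> 0 <= a <= l -> 0 <= l' -> is_segment l' s ->
  l * mdist z (s (a * (l' / l))) ^+ 2 <=
  (l - a) * mdist z (s 0) ^+ 2 + a * mdist z (s l') ^+ 2
  - a * (l - a) * l * (l' / l) ^+ 2.
Proof.
move=> l0 /andP[a0 al] l'0 seg; set k := l' / l.
have kE : l' = k * l by rewrite divfK// lt0r_neq0.
have k0 : 0 <= k by rewrite divr_ge0// ltW.
have [kle|kp] := leP k 0.
  have k_eq : k = 0 by lra.
  have -> : l' = 0 by rewrite kE k_eq mul0r.
  by rewrite k_eq mulr0; lra.
have := hY l' (a * k) s z _ seg; rewrite kE mulr_ge0// (mulrC a k) ler_pM2l// al.
move=> /(_ isT) h; rewrite -(ler_pM2l kp); lra.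
Qed.

Lemma l2_segment_components (l : R) (s : R -> X) (a : R) : 0 < l ->
  is_segment l s -> 0 <= a <= l -> forall s1 s2,
  segment_between (s 0).1 (s l).1 s1 -> segment_between (s 0).2 (s l).2 s2 ->
  forall z : X,
  l * mdist z (s1 (a * (mdist (s 0).1 (s l).1 / l)), s2 (a * (mdist (s 0).2 (s l).2 / l))) ^+ 2
    <= (l - a) * mdist z (s 0) ^+ 2 + a * mdist z (s l) ^+ 2 - a * (l - a) * l.
Proof.
move=> l0 seg al s1 s2 [seg1 s10 s1l] [seg2 s20 s2l] z.
have h1 := stewart_proportional hS1 z.1 l0 al (mdist_ge0 _ _) seg1.
have h2 := stewart_proportional hS2 z.2 l0 al (mdist_ge0 _ _) seg2.
rewrite s10 s1l in h1; rewrite s20 s2l in h2; rewrite !l2_sqr/=.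
set k1 := _ / l in h1 *; set k2 := mdist (s 0).2 _ / l in h2 *.
have k12 : k1 ^+ 2 + k2 ^+ 2 = 1.
  have : mdist (s 0) (s l) = l by rewrite (segment_dist seg) ?subr0// ltW.
  move=> /(congr1 (fun x => x ^+ 2)); rewrite l2_sqr /k1 /k2 !expr_div_n -mulrDl => ->.
  by rewrite divff// expf_neq0// lt0r_neq0.
have h3 : a * (l - a) * l * (k1 ^+ 2 + k2 ^+ 2) = a * (l - a) * l by rewrite k12 mulr1.
lra.
Qed.

(** At [z = s a] the right side of [l2_segment_components] vanishes, so every product segment is a
    pair of proportionally traversed segments. *)
Lemma l2_segment_eq (l : R) (s : R -> X) (a : R) : 0 < l ->
  is_segment l s -> 0 <= a <= l -> forall s1 s2,
  segment_between (s 0).1 (s l).1 s1 -> segment_between (s 0).2 (s l).2 s2 ->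
  s a = (s1 (a * (mdist (s 0).1 (s l).1 / l)), s2 (a * (mdist (s 0).2 (s l).2 / l))).
Proof.
move=> l0 seg al s1 s2 b1 b2; apply/mdist_positivity.
have := l2_segment_components l0 seg al b1 b2 (s a).
set m := mdist (s a) (_ : X).
case/andP: al => a0 al.
rewrite (metric_sym (s a)) (segment_dist seg)// (segment_dist seg)// subr0 => h.
have : l * m ^+ 2 <= 0 by lra.
rewrite pmulr_rle0// => m0; apply/eqP; rewrite -sqrf_eq0 eq_le m0; exact: sqr_ge0.
Qed.

Lemma l2_stewart : stewart X.
Proof.
move=> l a s z /andP[a0 al] seg.
have [l_le0|l0] := leP l 0.
  have -> : a = 0 by lra.
  by lra.
have [s1 b1] := geo1 (s 0).1 (s l).1; have [s2 b2] := geo2 (s 0).2 (s l).2.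
have ab : 0 <= a <= l by rewrite a0.
rewrite (l2_segment_eq l0 seg ab b1 b2).
exact: (l2_segment_components l0 seg ab b1 b2).
Qed.

Lemma l2_geodesic : geodesic_space X.
Proof.
move=> x y; have [s1 [seg1 s10 s1l]] := geo1 x.1 y.1.
have [s2 [seg2 s20 s2l]] := geo2 x.2 y.2.
set d := mdist x y.
have [d0|d0] := leP d 0.
  have xy : x = y by apply/mdist_positivity/eqP; rewrite eq_le d0 mdist_ge0.
  have dE : d = 0 by apply/eqP; rewrite eq_le d0 mdist_ge0.
  exists (fun=> x); split=> //.
  move=> a b; rewrite -/d dE -!eq_le => /eqP <- /eqP <-.
  by rewrite mdistxx subrr normr0.
exists (fun t => (s1 (t * (mdist x.1 y.1 / d)), s2 (t * (mdist x.2 y.2 / d)))).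
have k12 : (mdist x.1 y.1 / d) ^+ 2 + (mdist x.2 y.2 / d) ^+ 2 = 1.
  by rewrite !expr_div_n -mulrDl -l2_sqr divff// expf_neq0// lt0r_neq0.
have bnd (k t : R) : 0 <= k -> 0 <= t <= d -> 0 <= t * (k / d) <= k.
  move=> k0 /andP[t0 td]; rewrite mulr_ge0 ?divr_ge0 ?(ltW d0)//=.
  by rewrite mulrA ler_pdivrMr// mulrC ler_wpM2l.
split; last 2 first.
- by rewrite !mul0r s10 s20 -surjective_pairing.
- by rewrite -/d !mulrA ![d * _]mulrC !mulfK ?lt0r_neq0// s1l s2l -surjective_pairing.
move=> a b ad bd; rewrite -/d in ad bd *.
apply/eqP; rewrite -(eqrXn2 (n := 2))// ?mdist_ge0// l2_sqr/=.
rewrite seg1 ?bnd ?mdist_ge0// seg2 ?bnd ?mdist_ge0//.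
by rewrite !real_normK ?num_real// -!mulrBl ![((a - b) * _) ^+ 2]exprMn -mulrDr k12 mulr1.
Qed.

(** The component speeds on [[0, l]] do not depend on [l >= 1], since all of them agree with those
    on [[0, 1]]. *)
Lemma l2_ray_components (s : R -> X) : is_ray s -> exists c1 c2 : R,
  [/\ 0 <= c1, 0 <= c2, c1 ^+ 2 + c2 ^+ 2 = 1 &
   forall a b, 0 <= a -> 0 <= b ->
     mdist (s a).1 (s b).1 = c1 * `|a - b| /\
     mdist (s a).2 (s b).2 = c2 * `|a - b|].
Proof.
move=> ray.
pose k1 l := mdist (s 0).1 (s l).1 / l; pose k2 l := mdist (s 0).2 (s l).2 / l.
have comp l a b : 0 < l -> 0 <= a <= l -> 0 <= b <= l ->
    mdist (s a).1 (s b).1 = k1 l * `|a - b| /\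
    mdist (s a).2 (s b).2 = k2 l * `|a - b|.
  move=> l0 al bl; have seg := @ray_segment _ _ s l ray.
  have [s1 b1] := geo1 (s 0).1 (s l).1; have [s2 b2] := geo2 (s 0).2 (s l).2.
  rewrite (l2_segment_eq l0 seg al b1 b2) (l2_segment_eq l0 seg bl b1 b2)/=.
  have bnd (k t : R) : 0 <= k -> 0 <= t <= l -> 0 <= t * (k / l) <= k.
    move=> k0 /andP[t0 td]; rewrite mulr_ge0 ?divr_ge0 ?(ltW l0)//=.
    by rewrite mulrA ler_pdivrMr// mulrC ler_wpM2l.
  case: b1 => seg1 _ _; case: b2 => seg2 _ _.
  rewrite seg1 ?bnd ?mdist_ge0// seg2 ?bnd ?mdist_ge0// -!mulrBl ![`|(a - b) * _|]normrM.
  rewrite (ger0_norm (divr_ge0 (mdist_ge0 (s 0).1 (s l).1) (ltW l0))).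
  rewrite (ger0_norm (divr_ge0 (mdist_ge0 (s 0).2 (s l).2) (ltW l0))).
  by rewrite !(mulrC `|_|).
have kc l : 1 <= l -> k1 l = k1 1 /\ k2 l = k2 1.
  move=> l1; have [|||] := @comp l 0 1; rewrite ?lexx ?ler01 ?l1//=; try lra.
  by rewrite sub0r normrN normr1 !mulr1 => e1 e2; rewrite -e1 -e2 /k1 /k2 !divr1.
exists (k1 1), (k2 1); split.
- by rewrite /k1 divr1 mdist_ge0.
- by rewrite /k2 divr1 mdist_ge0.
- by rewrite /k1 /k2 !divr1 -l2_sqr (ray_dist ray)// subr0 expr1n.
move=> a b a0 b0; pose l := 1 + a + b.
have [e1 e2] := @kc l ltac:(rewrite /l; lra).
rewrite -e1 -e2; apply: comp; rewrite /l ?a0 ?b0/=; lra.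
Qed.

Definition join_ray (theta : R) (s1 : R -> X1) (s2 : R -> X2) : R -> X :=
  fun t => (s1 (t * cos theta), s2 (t * sin theta)).

Definition ray_class (Y : metricType R) (s : R -> Y) : set (R -> Y) :=
  [set s' | is_ray s' /\ asymptotic s s'].

Lemma ray_class_boundary (Y : metricType R) (s : R -> Y) :
  is_ray s -> boundary (ray_class s).
Proof. by move=> ray; exists s. Qed.

Lemma asymptotic_refl (Y : metricType R) (s : R -> Y) : asymptotic s s.
Proof. by exists 0 => t _; rewrite mdistxx. Qed.

Lemma ray_class_eq (Y : metricType R) (s s' : R -> Y) :
  asymptotic s s' -> ray_class s = ray_class s'.
Proof.
move=> as_; apply/seteqP; split=> [t [rt at_]|t [rt at_]]; split=> //.
  by apply: asymptotic_trans at_; exact: asymptotic_sym.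
exact: asymptotic_trans at_.
Qed.

Section Slope.
Variable theta : R.
Hypotheses (ct : 0 < cos theta) (st : 0 < sin theta).

Lemma join_ray_is_ray s1 s2 : is_ray s1 -> is_ray s2 -> is_ray (join_ray theta s1 s2).
Proof.
move=> ray1 ray2 a b a0 b0; apply/eqP.
rewrite -(eqrXn2 (n := 2))// ?mdist_ge0// l2_sqr/= ray1 ?mulr_ge0 ?(ltW ct)//.
rewrite ray2 ?mulr_ge0 ?(ltW st)// -!mulrBl !normrM.
by rewrite (gtr0_norm ct) (gtr0_norm st) !exprMn -mulrDr cos2Dsin2 mulr1.
Qed.

Lemma join_ray_asymptotic s1 s2 s1' s2' : asymptotic s1 s1' -> asymptotic s2 s2' ->
  asymptotic (join_ray theta s1 s2) (join_ray theta s1' s2').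
Proof.
move=> [C1 h1] [C2 h2]; exists (C1 + C2) => t t0.
by apply: (le_trans (l2_le _ _)); rewrite lerD ?h1 ?h2// mulr_ge0 ?(ltW ct) ?(ltW st).
Qed.

Lemma join_ray_asymptotic_inv s1 s2 s1' s2' :
  asymptotic (join_ray theta s1 s2) (join_ray theta s1' s2') ->
  asymptotic s1 s1' /\ asymptotic s2 s2'.
Proof.
move=> [C h]; split; exists C => t t0.
  have := h (t / cos theta) (divr_ge0 t0 (ltW ct)).
  move/(le_trans (l2_ge1 _ _)); rewrite /= divfK// lt0r_neq0//.
have := h (t / sin theta) (divr_ge0 t0 (ltW st)).
by move/(le_trans (l2_ge2 _ _)); rewrite /= divfK// lt0r_neq0//.
Qed.

(** Component speeds other than [cos theta] and [sin theta] would make the distance to the join ray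
    grow linearly; rescaling the components by these speeds gives the factor rays. *)
Lemma ray_asymptotic_join s s1 s2 : is_ray s -> is_ray s1 -> is_ray s2 ->
  asymptotic (join_ray theta s1 s2) s ->
  exists s1' s2', [/\ is_ray s1', is_ray s2' &
    forall t, 0 <= t -> s t = join_ray theta s1' s2' t].
Proof.
move=> ray ray1 ray2 [C hC].
have [c1 [c2 [c10 c20 c12 hc]]] := l2_ray_components ray.
have speed (c k M : R) : 0 <= c -> 0 < k ->
    (forall t, 0 <= t -> `|t * k - c * t| <= M) -> c = k.
  move=> c0 k0 h; apply/eqP; rewrite -subr_eq0; apply/negP => /negP ck.
  have ck0 : 0 < `|k - c| by rewrite normr_gt0 subr_eq0 eq_sym -subr_eq0.
  have M0 : 0 <= M by have := h 0 (lexx _); rewrite mul0r mulr0 subrr normr0.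
  have M1 : 0 <= M + 1 by lra.
  have := h ((M + 1) / `|k - c|) (divr_ge0 M1 (ltW ck0)).
  have -> : forall t : R, t * k - c * t = t * (k - c) by move=> t; ring.
  rewrite normrM ger0_norm ?divr_ge0 ?(ltW ck0)//.
  by rewrite divfK ?lt0r_neq0//; lra.
have e1 : c1 = cos theta.
  apply: (speed c1 _ (C + mdist (s1 0) (s 0).1)) => // t t0.
  have [hc1 _] := hc 0 t (lexx _) t0; rewrite sub0r normrN (ger0_norm t0) in hc1.
  have d1 : mdist (s1 0) (s1 (t * cos theta)) = t * cos theta.
    by rewrite (ray_dist ray1) ?subr0// mulr_ge0// ltW.
  have d2 := le_trans (l2_ge1 _ _) (hC t t0); rewrite /= in d2.
  rewrite -hc1 -d1 ler_norml.
  have := metric_triangle (s1 0) (s 0).1 (s1 (t * cos theta)).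
  have := metric_triangle (s 0).1 (s t).1 (s1 (t * cos theta)).
  have := metric_triangle (s 0).1 (s1 0) (s t).1.
  have := metric_triangle (s1 0) (s1 (t * cos theta)) (s t).1.
  rewrite (metric_sym (s 0).1 (s1 0)) (metric_sym (s t).1 (s1 _)).
  by move=> *; apply/andP; split; lra.
have e2 : c2 = sin theta.
  apply: (speed c2 _ (C + mdist (s2 0) (s 0).2)) => // t t0.
  have [_ hc1] := hc 0 t (lexx _) t0; rewrite sub0r normrN (ger0_norm t0) in hc1.
  have d1 : mdist (s2 0) (s2 (t * sin theta)) = t * sin theta.
    by rewrite (ray_dist ray2) ?subr0// mulr_ge0// ltW.
  have d2 := le_trans (l2_ge2 _ _) (hC t t0); rewrite /= in d2.
  rewrite -hc1 -d1 ler_norml.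
  have := metric_triangle (s2 0) (s 0).2 (s2 (t * sin theta)).
  have := metric_triangle (s 0).2 (s t).2 (s2 (t * sin theta)).
  have := metric_triangle (s 0).2 (s2 0) (s t).2.
  have := metric_triangle (s2 0) (s2 (t * sin theta)) (s t).2.
  rewrite (metric_sym (s 0).2 (s2 0)) (metric_sym (s t).2 (s2 _)).
  by move=> *; apply/andP; split; lra.
exists (fun t => (s (t / cos theta)).1), (fun t => (s (t / sin theta)).2); split.
- move=> a b a0 b0; have [-> _] := hc _ _ (divr_ge0 a0 (ltW ct)) (divr_ge0 b0 (ltW ct)).
  rewrite e1 -mulrBl normrM (gtr0_norm (_ : 0 < (cos theta)^-1)) ?invr_gt0//.
  by rewrite mulrCA divff ?mulr1// lt0r_neq0.
- move=> a b a0 b0; have [_ ->] := hc _ _ (divr_ge0 a0 (ltW st)) (divr_ge0 b0 (ltW st)).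
  rewrite e2 -mulrBl normrM (gtr0_norm (_ : 0 < (sin theta)^-1)) ?invr_gt0//.
  by rewrite mulrCA divff ?mulr1// lt0r_neq0.
move=> t t0; rewrite /join_ray !mulfK ?lt0r_neq0//.
exact: surjective_pairing.
Qed.

Lemma boundary_join_class s1 s2 : is_ray s1 -> is_ray s2 ->
  ray_class (join_ray theta s1 s2) =
  boundary_join (ray_class s1) (ray_class s2) theta.
Proof.
move=> ray1 ray2; apply/seteqP; split=> s.
  move=> [ray as_].
  have [s1' [s2' [ray1' ray2' sE]]] := ray_asymptotic_join ray ray1 ray2 as_.
  have as' : asymptotic (join_ray theta s1 s2) (join_ray theta s1' s2').
    by case: as_ => C hC; exists C => t t0; rewrite -sE// hC.
  have [a1 a2] := join_ray_asymptotic_inv as'.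
  by exists s1', s2'.
move=> [s1' [s2' [[ray1' a1] [ray2' a2] sE]]].
split.
  by move=> a b a0 b0; rewrite !sE//; exact: (join_ray_is_ray ray1' ray2').
have [C hC] := join_ray_asymptotic a1 a2.
by exists C => t t0; rewrite sE//; exact: hC.
Qed.

Lemma join_ray_slope s1 s2 : 0 < theta < pi / 2 -> is_ray s1 -> is_ray s2 ->
  boundary_slope theta (ray_class (join_ray theta s1 s2)).
Proof.
move=> /andP[t0 t1] ray1 ray2; have ray := join_ray_is_ray ray1 ray2.
split; first exact: ray_class_boundary.
exists (join_ray theta s1 s2); first by split=> //; exact: asymptotic_refl.
by split; [rewrite !ltW|exists s1, s2].
Qed.

Lemma ray_from_eq (o : X) eta s t : boundary eta -> eta s -> s 0 = o -> 0 <= t ->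
  ray_from o eta t = s t.
Proof.
move=> [s0 ray0 ->] [ray as_] so t0.
have [/= [ray' as'] rf0] : [set s' | ray_class s0 s' /\ s' 0 = o] (ray_from o (ray_class s0)).
  by apply: (@xgetPex _ (fun=> o)); exists s.
apply: (ray_unique l2_stewart l2_geodesic) => //; last by rewrite so.
by apply: asymptotic_trans as_; exact: asymptotic_sym.
Qed.

Lemma slope_ray (o : X) eta : complete_space X1 -> complete_space X2 ->
  boundary eta -> boundary_slope theta eta ->
  exists s1 s2, [/\ is_ray s1, is_ray s2, s1 0 = o.1, s2 0 = o.2 &
    eta = ray_class (join_ray theta s1 s2) /\
    forall t, 0 <= t -> ray_from o eta t = join_ray theta s1 s2 t].
Proof.
move=> comp1 comp2 beta [_ [s etas [_ [r1 [r2 [/(_ ct) ray1 /(_ st) ray2 sE]]]]]].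
have [s1 [ray1' s10 a1]] := ray_exists hS1 geo1 o.1 comp1 ray1.
have [s2 [ray2' s20 a2]] := ray_exists hS2 geo2 o.2 comp2 ray2.
have ray := join_ray_is_ray ray1' ray2'.
exists s1, s2.
have as_ : asymptotic s (join_ray theta s1 s2).
  have [C hC] := join_ray_asymptotic a1 a2.
  by exists C => t t0; rewrite sE//; exact: hC.
have etaE : eta = ray_class (join_ray theta s1 s2).
  case: beta etas => s0 ray0 -> [_ as0]; apply: ray_class_eq.
  exact: asymptotic_trans as_.
split=> //; split=> // t t0; apply: ray_from_eq => //.
- by rewrite etaE; split=> //; exact: asymptotic_refl.
- by rewrite /join_ray !mul0r s10 s20 -surjective_pairing.
Qed.

End Slope.
End Product.

(** * Ping-pong in one factor *)

Section Axes.
Context {R : realType} {Y : metricType R}.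
Hypotheses (hS : stewart Y) (geo : geodesic_space Y) (prop : proper_space Y).
Implicit Types (sigma tau : R -> Y) (x y z : Y).

Definition contracting sigma (C : R) := forall x y p q v,
  is_foot sigma x p -> is_foot sigma y q ->
  C <= `|p - v| -> C <= `|q - v| -> p <= v <= q \/ q <= v <= p ->
  passes x y (sigma v) C.

Lemma contractingW sigma C C' : C <= C' -> contracting sigma C -> contracting sigma C'.
Proof.
move=> CC' h x y p q v fx fy pv qv vb; apply: (passesW CC').
by apply: (h x y p q v) => //; exact: le_trans CC' _.
Qed.

(** An orientation of the line, so that one argument serves both ends of an axis. *)
Definition flip (e : bool) (t : R) : R := if e then t else - t.

Lemma flipK e : involutive (flip e).
Proof. by case: e => t //=; rewrite opprK. Qed.

Lemma flip_norm e t u : `|flip e t - flip e u| = `|t - u|.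
Proof. by case: e => //=; rewrite -opprD normrN. Qed.

Lemma flip_le_norm e t : flip e t <= `|t|.
Proof. by case: e; rewrite /= ?ler_norm// -normrN ler_norm. Qed.

Lemma line_flip sigma e : is_line sigma -> is_line (sigma \o flip e).
Proof. by move=> lin a b; rewrite /= lin flip_norm. Qed.

Lemma foot_flip sigma e x t : is_foot sigma x (flip e t) <-> is_foot (sigma \o flip e) x t.
Proof.
split=> h u; first exact: h.
by have := h (flip e u); rewrite /= flipK.
Qed.

Lemma contracting_flip sigma e C : contracting sigma C -> contracting (sigma \o flip e) C.
Proof.
move=> h x y p q v /foot_flip fx /foot_flip fy pv qv vb.
apply: (h x y (flip e p) (flip e q)) => //; rewrite ?flip_norm//.
by case: e {fx fy} => //=; rewrite !lerN2; case: vb => /andP[-> ->]; [right|left].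
Qed.

Lemma line_ray sigma : is_line sigma -> is_ray sigma.
Proof. by move=> lin a b _ _; exact: lin. Qed.

(** When feet of points of [tau] go to infinity along [sigma], contraction forces [tau] to pass
    within [C] of every far [sigma v]; comparing arrival times then bounds the distance at equal
    times. *)
Lemma contracting_asymptotic sigma tau C : is_line sigma -> is_line tau ->
  0 <= C -> contracting sigma C ->
  (forall M, exists u t, [/\ 0 <= u, is_foot sigma (tau u) t & M <= t]) ->
  asymptotic sigma tau.
Proof.
move=> lins lint C0 con unb.
have [t0 ft0] := foot_exists lins (tau 0).
set d := mdist (tau 0) (sigma 0); have d0 : 0 <= d by exact: mdist_ge0.
exists (2 * C + 2 * `|t0| + d) => v v0.
have tauv : mdist (tau 0) (tau v) = v by rewrite lint sub0r normrN ger0_norm.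
have sigv : mdist (sigma 0) (sigma v) = v by rewrite lins sub0r normrN ger0_norm.
have tn := ler_norm t0; have tn0 := normr_ge0 t0.
have [vs|vl] := leP v (`|t0| + C).
  have := metric_triangle (sigma v) (sigma 0) (tau v).
  have := metric_triangle (sigma 0) (tau 0) (tau v).
  rewrite (metric_sym (sigma v) (sigma 0)) sigv tauv (metric_sym (sigma 0) (tau 0)) -/d.
  lra.
have [u [t [u0 ft Mt]]] := unb (v + C).
have pass : passes (tau 0) (tau u) (sigma v) C.
  apply: (con _ _ t0 t v) => //.
  - by rewrite distrC (le_trans _ (ler_norm _))//; lra.
  - by rewrite (le_trans _ (ler_norm _))//; lra.
  - by left; apply/andP; split; lra.
have uE : mdist (tau 0) (tau u) = u by rewrite lint sub0r normrN ger0_norm.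
have [|s [/andP[s0 su] hs]] := pass tau.
  by split; [move=> a b _ _; exact: lint| |rewrite uE].
have d1 := dist_diff (tau 0) (tau s) (sigma v).
have d2 := dist_diff (sigma v) (tau 0) (sigma 0).
rewrite -/d !(metric_sym (sigma v)) sigv in d2.
rewrite [X in `|X - _|]lint sub0r normrN (ger0_norm s0) in d1.
move: d1 d2; rewrite !ler_norml => /andP[d1 d1'] /andP[d2 d2'].
have sv : mdist (tau s) (tau v) <= C + d.
  by rewrite lint ler_norml; apply/andP; split; lra.
have := metric_triangle (sigma v) (tau s) (tau v); rewrite (metric_sym (sigma v) (tau s)).
lra.
Qed.

Lemma axis_class_fixed (g : Y -> Y) sigma L e : is_isometry g -> is_line sigma ->
  (forall t, g (sigma t) = sigma (t + L)) ->
  boundary_fix g (ray_class (sigma \o flip e)).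
Proof.
move=> [giso gsurj] lin gs; have line := line_flip e lin.
split; first exact: ray_class_boundary (line_ray line).
have shift t : mdist (sigma (flip e t)) (g (sigma (flip e t))) = `|L|.
  by rewrite gs lin opprD addrA subrr sub0r normrN.
apply/seteqP; split=> s.
  move=> [s' [ray [C hC]] <-]; split.
    by move=> a b a0 b0; rewrite /= giso ray.
  exists (`|L| + C) => t t0.
  apply: (le_trans (metric_triangle _ (g (sigma (flip e t))) _)).
  by rewrite /= shift lerD2l giso; exact: hC.
move=> [ray [C hC]]; have /choice[k hk] := gsurj.
exists (k \o s); last by apply/funext => t /=; rewrite hk.
split; first by move=> a b a0 b0; rewrite -[LHS]giso /= !hk ray.
exists (`|L| + C) => t t0; rewrite -[mdist _ _]giso /= hk.
apply: (le_trans (metric_triangle _ (sigma (flip e t)) _)).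
by rewrite metric_sym shift lerD2l; exact: hC.
Qed.

(** If the projection were unbounded for one of the four pairs of ends, these ends would be
    asymptotic, hence a common boundary fixed point of [g] and [h]. *)
Lemma independent_projection (g h : Y -> Y) sigma tau L L' C :
  is_isometry g -> is_isometry h -> is_line sigma -> is_line tau ->
  (forall t, g (sigma t) = sigma (t + L)) ->
  (forall t, h (tau t) = tau (t + L')) ->
  0 <= C -> contracting sigma C ->
  boundary_fix g `&` boundary_fix h = set0 ->
  exists B, forall u t, is_foot sigma (tau u) t -> `|t| <= B.
Proof.
move=> gi hi lins lint gs ht C0 con indep.
have bnd e e' : exists M : R, forall u t, 0 <= u ->
    is_foot (sigma \o flip e) ((tau \o flip e') u) t -> t <= M.
  apply: contrapT => /forallNP unb.
  have as_ : asymptotic (sigma \o flip e) (tau \o flip e').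
    apply: (@contracting_asymptotic _ _ C (line_flip e lins) (line_flip e' lint)) => //.
      exact: contracting_flip.
    move=> M; have /existsNP[u /existsNP[t /not_implyP[u0 /not_implyP[ft /negP]]]] := unb M.
    by rewrite -ltNge => /ltW Mt; exists u, t.
  have f1 := axis_class_fixed e gi lins gs.
  have f2 := axis_class_fixed e' hi lint ht.
  rewrite -(ray_class_eq as_) in f2.
  have : (boundary_fix g `&` boundary_fix h) (ray_class (sigma \o flip e)) by [].
  by rewrite indep.
have /choice[M hM] := fun q : bool * bool => bnd q.1 q.2.
exists (`|M (true, true)| + `|M (true, false)| + `|M (false, true)| + `|M (false, false)|).
move=> u t ft.
have sgn : exists e', 0 <= flip e' u.
  by have [u0|u0] := leP 0 u; [exists true|exists false; rewrite /= oppr_ge0 ltW].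
case: sgn => e' u0.
have key e : flip e t <= M (e, e').
  apply: (hM (e, e') (flip e' u) (flip e t)) => //=.
  rewrite flipK; apply: (proj1 (foot_flip sigma e (tau u) (flip e t))).
  by rewrite flipK.
have k1 := key true; have k2 := key false; rewrite /= in k1 k2.
have n1 := ler_norm (M (true, true)); have n2 := ler_norm (M (true, false)).
have n3 := ler_norm (M (false, true)); have n4 := ler_norm (M (false, false)).
have n1' := normr_ge0 (M (true, true)); have n2' := normr_ge0 (M (true, false)).
have n3' := normr_ge0 (M (false, true)); have n4' := normr_ge0 (M (false, false)).
by rewrite ler_norml; case: e' k1 k2 {key u0} => k1 k2; apply/andP; split; lra.
Qed.

(** If [z] projects far out on [sigma], the geodesic from its foot [tau u] to [z] passes near
    [sigma (flip e (B + C))], which lies at a fixed distance from [tau 0]. As [tau u] is the point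
    of [tau] nearest to [z], this bounds [|u|]. *)
Lemma halfspace_disjoint sigma tau C B : is_line sigma -> is_line tau ->
  0 <= C -> contracting sigma C ->
  (forall u t, is_foot sigma (tau u) t -> `|t| <= B) ->
  exists M, forall z t u, is_foot sigma z t -> is_foot tau z u ->
    M <= `|t| -> M <= `|u| -> False.
Proof.
move=> lins lint C0 con bnd.
have B0 : 0 <= B.
  have [t ft] := foot_exists lins (tau 0).
  exact: le_trans (normr_ge0 t) (bnd _ _ ft).
pose P e := mdist (sigma (flip e (B + C))) (tau 0).
exists (B + 2 * C + 2 * P true + 2 * P false + 1) => z t u ft fu tM uM.
have P1 : 0 <= P true by exact: mdist_ge0.
have P2 : 0 <= P false by exact: mdist_ge0.
have [tw ftw] := foot_exists lins (tau u).
have twB := bnd _ _ ftw.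
have [e te] : exists e, flip e t = `|t|.
  have [t0|t0] := leP 0 t; first by exists true; rewrite ger0_norm.
  by exists false; rewrite ltr0_norm.
have Pe : P e <= P true + P false by case: (e); lra.
set v := flip e (B + C).
have fte : forall b, flip e b - flip e t = flip e (b - t).
  by case: (e) => b //=; ring.
have pass : passes (tau u) z (sigma v) C.
  have et : t = flip e `|t| by rewrite -te flipK.
  have tw1 : - B <= flip e tw <= B.
    by rewrite -ler_norml; case: (e) => //=; rewrite normrN.
  have etw : tw = flip e (flip e tw) by rewrite flipK.
  case/andP: tw1 => tw1 tw2.
  apply: (con _ _ tw t v) => //.
  - rewrite etw /v flip_norm distrC (le_trans _ (ler_norm _))//; lra.
  - rewrite et /v flip_norm (le_trans _ (ler_norm _))//; lra.
  - rewrite et etw /v.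
    by case: (e) tw1 tw2 => /= tw1 tw2; [left|right]; apply/andP; split; lra.
have := passes_dist geo pass.
have := fu 0.
have := metric_triangle z (sigma v) (tau 0).
have := metric_triangle (tau u) (sigma v) (tau 0).
rewrite lint subr0 (metric_sym z (sigma v)) (metric_sym z (tau u)) -/(P e).
lra.
Qed.

Lemma foot_iter (g : Y -> Y) sigma L N z t : is_isometry g ->
  (forall u, g (sigma u) = sigma (u + L)) ->
  is_foot sigma z t -> is_foot sigma (iter N g z) (t + N%:R * L).
Proof.
move=> [gi gsurj] gs ft; elim: N => [|N IH]; first by rewrite mul0r addr0.
move=> u; rewrite iterS -natr1 mulrDl mul1r addrA -gs gi.
by rewrite -[u](subrK L) -gs gi; exact: IH.
Qed.

Lemma cancel_isometry (g k : Y -> Y) : cancel g k -> cancel k g ->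
  is_isometry g -> is_isometry k.
Proof.
move=> gk kg [gi gs]; split; first by move=> x y; rewrite -gi !kg.
by move=> y; exists (g y); rewrite gk.
Qed.

(* For each letter [e], the sets [U0 e], [U e] and [V e] are nested half-spaces
   at the end of the axis to which [gen e] moves points. *)
Lemma pingpong (o : Y) (gen : bool * bool -> Y -> Y) :
  (forall b, cancel (gen (b, true)) (gen (b, false)) /\
             cancel (gen (b, false)) (gen (b, true))) ->
  independent_rank_one (gen (false, true)) (gen (true, true)) ->
  exists (U0 U V : bool * bool -> set Y) (K : R) (N0 : nat),
  [/\ forall e e' z, U0 e z -> U0 e' z -> e = e',
      (forall e, V e `<=` U e) /\ (forall e, U e `<=` U0 e),
      forall e x y, ~ U0 e x -> U e y -> passes x y o K,
      forall e x y, ~ U e x -> V e y -> passes x y o K &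
      forall N e z, (N0 <= N)%N -> ~ U (e.1, ~~ e.2) z -> V e (iter N (gen e) z)].
Proof.
move=> gK [rk1 rk2 indep].
have rk b : rank_one (gen (b, true)) by case: b.
have ax b : exists q : (R -> Y) * R * R, [/\ is_line q.1.1, 0 < q.1.2, 0 <= q.2,
    contracting q.1.1 q.2 &
    forall t, gen (b, true) (q.1.1 t) = q.1.1 (t + q.1.2)].
  have [gi [sigma [lin [L L0 gs]] nf]] := rk b.
  have [C C0 con] := axis_near hS geo prop lin gi L0 gs nf.
  by exists (sigma, L, C).
have /choice[q hq] := ax.
pose sig b := (q b).1.1; pose L b := (q b).1.2.
pose C := (q true).2 + (q false).2.
have lin b : is_line (sig b) by case: (hq b).
have L0 b : 0 < L b by case: (hq b).
have gs b t : gen (b, true) (sig b t) = sig b (t + L b).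
  by case: (hq b) => _ _ _ _; apply.
have C0 : 0 <= C by rewrite addr_ge0//; case: (hq true); case: (hq false).
have con b : contracting (sig b) C.
  case: (hq b) => _ _ _ h _; apply: contractingW h.
  by rewrite /C; case: (b); rewrite ?lerDl ?lerDr; case: (hq true); case: (hq false).
have [B hB] := independent_projection (proj1 (rk false)) (proj1 (rk true))
  (lin false) (lin true) (gs false) (gs true) C0 (con false) indep.
clear indep.
have [M0 hM0] := halfspace_disjoint (lin false) (lin true) C0 (con false) hB.
pose M := `|M0| + 1; have M1 : 0 < M by rewrite /M; have := normr_ge0 M0; lra.
have M0M : M0 <= M by rewrite /M; have := ler_norm M0; lra.
pose H (m : R) (e : bool * bool) : set Y :=
  [set z | exists2 t, is_foot (sig e.1) z t & m <= flip e.2 t].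
have HW m m' e : m <= m' -> H m' e `<=` H m e.
  by move=> mm' z [t ft tm]; exists t => //; exact: le_trans tm.
pose K0 e i : R := mdist (sig e.1 (flip e.2 (M + i * C))) o.
pose Kb i := K0 (true, true) i + K0 (true, false) i + K0 (false, true) i + K0 (false, false) i.
have K0b e i : K0 e i <= Kb i.
  have k1 : 0 <= K0 (true, true) i by exact: mdist_ge0.
  have k2 : 0 <= K0 (true, false) i by exact: mdist_ge0.
  have k3 : 0 <= K0 (false, true) i by exact: mdist_ge0.
  have k4 : 0 <= K0 (false, false) i by exact: mdist_ge0.
  by rewrite /Kb; case: e => [[] []]; lra.
have Kb0 i : 0 <= Kb i by rewrite !addr_ge0// mdist_ge0.
(* The marker at [M + i * C] has room [C] on either side, as [contracting] requires. *)
have pass i e x y : ~ H (M + (i - 1) * C) e x -> H (M + (i + 1) * C) e y ->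
    passes x y o (C + Kb i).
  move=> nx [t ft tm].
  have [p fp] := foot_exists (lin e.1) x.
  have pm : flip e.2 p < M + (i - 1) * C.
    by rewrite ltNge; apply/negP => h; apply: nx; exists p.
  set v := flip e.2 (M + i * C).
  have ps : passes x y (sig e.1 v) C.
    have ep : p = flip e.2 (flip e.2 p) by rewrite flipK.
    have et : t = flip e.2 (flip e.2 t) by rewrite flipK.
    apply: (con e.1 _ _ p t v) => //.
    - rewrite ep /v flip_norm distrC (le_trans _ (ler_norm _))//; lra.
    - rewrite et /v flip_norm (le_trans _ (ler_norm _))//; lra.
    - rewrite ep et /v; move: pm tm.
      by case: (e.2) => /= pm tm; [left|right]; apply/andP; split; lra.
  move=> s /ps[c [cb hc]]; exists c; split=> //.
  apply: (le_trans (metric_triangle _ (sig e.1 v) _)); apply: lerD => //.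
  exact: K0b.
pose Lmin := Num.min (L true) (L false).
have Lmin0 : 0 < Lmin by rewrite lt_min !L0.
have LminL b : Lmin <= L b by rewrite /Lmin ge_min; case: b; rewrite lexx ?orbT.
(* A foot outside the opposite half-space lies beyond [- (M + 2 * C)] in the direction of motion; a
   shift by [2 * M + 6 * C] brings it past [M + 4 * C]. *)
have [N0 hN0] := nat_ge ((2 * M + 6 * C) / Lmin).
(* Consecutive levels differ by [2 * C], with markers at [M + C] and [M + 3 * C] between them. *)
exists (H M), (H (M + 2 * C)), (H (M + 4 * C)), (C + Kb 1 + Kb 3), N0; split.
- move=> [b s] [b' s'] z [t ft tm] [t' ft' tm']; rewrite /= in ft tm ft' tm'.
  have tM : M <= `|t|.
    exact: le_trans tm (flip_le_norm _ _).
  have tM' : M <= `|t'|.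
    exact: le_trans tm' (flip_le_norm _ _).
  have [bb|bb] := eqVneq b b'.
    move: ft'; rewrite -bb => ft'; have tt := foot_unique hS (lin b) ft ft'.
    by case: (s) (s') tm tm' => [] [] //=; rewrite -tt => ? ?; exfalso; lra.
  case: (b) (b') bb ft ft' => [] [] //= _ ft ft'; exfalso.
    by apply: (hM0 z t' t) => //; apply: le_trans M0M _.
  by apply: (hM0 z t t') => //; apply: le_trans M0M _.
- by split=> e; apply: HW; lra.
- move=> e x y nx hy; apply: (passesW (K := C + Kb 1)); first by have := Kb0 3; lra.
  apply: (pass 1 e).
    by rewrite subrr mul0r addr0.
  by rewrite (_ : 1 + 1 = 2 :> R)//; ring.
- move=> e x y nx hy; apply: (passesW (K := C + Kb 3)); first by have := Kb0 1; lra.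
  apply: (pass 3 e).
    by rewrite (_ : 3 - 1 = 2 :> R)//; ring.
  by rewrite (_ : 3 + 1 = 4 :> R)//; ring.
move=> N [b s] z N0N nz; rewrite /= in nz *.
have NL : 2 * M + 6 * C <= N%:R * L b.
  have := hN0 N N0N; rewrite ler_pdivrMr// => h; apply: (le_trans h).
  by rewrite ler_wpM2l.
have [p fp] := foot_exists (lin b) z.
have pm : flip (~~ s) p < M + 2 * C.
  by rewrite ltNge; apply/negP => h; apply: nz; exists p.
have [gk kg] := gK b.
case: s nz pm => /= nz pm.
  exists (p + N%:R * L b) => /=; last lra.
  exact: (foot_iter _ (proj1 (rk b)) (gs b) fp).
exists (p + N%:R * - L b) => /=; last by rewrite mulrN; lra.
apply: foot_iter fp => //; first exact: cancel_isometry gk kg (proj1 (rk b)).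
by move=> u; rewrite -{1}(subrK (L b) u) -gs gk.
Qed.

End Axes.

(** * Shadowing orbit points by limit rays *)

(* The letter [(b, s)] stands for one of two generators, chosen by [b], or for
   its inverse if [s] is [false]. *)
Definition linv (e : bool * bool) : bool * bool := (e.1, ~~ e.2).

Lemma linvK : involutive linv.
Proof. by case=> b s; rewrite /linv /= negbK. Qed.

Lemma two_letters (e1 e2 : bool * bool) : exists a a',
  [&& a != a', a != e1, a != e2, a' != e1 & a' != e2].
Proof.
by case: e1 => [[] []]; case: e2 => [[] []];
  first [exists (true, true), (true, false); done
        |exists (true, true), (false, true); done
        |exists (true, true), (false, false); done
        |exists (true, false), (false, true); done
        |exists (true, false), (false, false); done
        |exists (false, true), (false, false); done].
Qed.

(** The two factors exclude [e1], [e2] for the first letter and [e3], [e4] for the second; four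
    letters always leave two distinct admissible ones. *)
Lemma choose_letters (e1 e2 e3 e4 : bool * bool) : exists a b,
  [&& a != b, a != e1, a != e2, b != e3 & b != e4].
Proof.
have [a [a' /and5P[aa h1 h2 h3 h4]]] := two_letters e1 e2.
have [b [_ /and5P[_ k1 k2 _ _]]] := two_letters e3 e4.
have [ab|ab] := eqVneq a b.
  by exists a', b; rewrite -ab eq_sym aa h3 h4/= ab k1 k2.
by exists a, b; rewrite ab h1 h2 k1 k2.
Qed.

Section Chain.
Context {R : realType} {Y : metricType R}.
Hypotheses (hS : stewart Y) (geo : geodesic_space Y).

Lemma passes_isometry (f : Y -> Y) x y z K : is_isometry f ->
  passes (f x) (f y) (f z) K -> passes x y z K.
Proof.
move=> [fi _] h s [seg s0 sl].
have [|t [tb ht]] := h (f \o s).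
  split; rewrite ?fi /= ?s0 ?sl//.
  by move=> a b ab bb; rewrite /= fi seg.
by move: tb ht; rewrite /= !fi => tb ht; exists t.
Qed.

Lemma translate_dist (x y : Y) (f g k : Y -> Y) :
  (forall x y, mdist (f x) (f y) = mdist x y) ->
  (forall x y, mdist (g x) (g y) = mdist x y) ->
  (forall x y, mdist (k x) (k y) = mdist x y) ->
  `|mdist x (f (g (k y))) - mdist x y| <=
    mdist x (f x) + (mdist x (g x) + mdist x (k x)).
Proof.
move=> fi gi ki; set z := f (g (k x)); set z' := f (g (k y)).
have -> : mdist x y = mdist z z' by rewrite /z /z' fi gi ki.
rewrite (metric_sym x z') (metric_sym z z').
apply: (le_trans (dist_diff _ _ _)).
apply: (le_trans (metric_triangle _ (f x) _)); apply: lerD => //.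
by rewrite fi; apply: (le_trans (metric_triangle _ (g x) _)); rewrite gi.
Qed.

Variables (o : Y) (U0 U V : bool * bool -> set Y) (K : R) (act : bool * bool -> Y -> Y).
Hypotheses (actK : forall e, cancel (act e) (act (linv e)))
  (disj : forall e e' z, U0 e z -> U0 e' z -> e = e')
  (VU : forall e, V e `<=` U e) (UU0 : forall e, U e `<=` U0 e)
  (pass0 : forall e x y, ~ U0 e x -> U e y -> passes x y o K)
  (pass1 : forall e x y, ~ U e x -> V e y -> passes x y o K)
  (push : forall e z, ~ U (linv e) z -> V e (act e z)).
Variables (w winv c : nat -> Y -> Y) (A B : nat -> bool * bool).
Hypotheses (wiso : forall k, is_isometry (w k))
  (wK : forall k, cancel (w k) (winv k)) (winvK : forall k, cancel (winv k) (w k))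
  (ciso : forall k, is_isometry (c k))
  (wS : forall k x, w k.+1 x = w k (act (A k) (act (B k) (c k x))))
  (Agood : forall k, ~ U (A k) (winv k o))
  (AB : forall k, A k != linv (B k))
  (Bgood : forall k, ~ U0 (linv (B k)) (c k o))
  (clong : forall k, 3 * K < mdist o (c k o)).

(* A translate entering [U (linv (B j))] would force the geodesic joining the
   past to the future to backtrack along [c j]. *)
Lemma chain_forward n j : V (A j) (winv j (w (j + n).+1 o)).
Proof.
have fwd k z : ~ U (linv (B k)) z -> V (A k) (act (A k) (act (B k) z)).
  move=> hz; apply: push => hA; move/negP: (AB k); apply.
  apply/eqP; rewrite -[LHS]linvK; congr linv.
  by apply: (disj (UU0 hA)); apply/UU0/VU/push.
elim: n j => [|n IH] j.
  by rewrite addn0 wS wK; apply: fwd => /UU0; exact: Bgood.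
rewrite addnS -addSn.
set q := winv j.+1 (w (j.+1 + n).+1 o).
have qV : V (A j.+1) q by exact: IH.
have -> : winv j (w (j.+1 + n).+1 o) = act (A j) (act (B j) (c j q)).
  by rewrite -[X in winv j X](winvK j.+1) wS wK.
apply: fwd => hU.
set y := winv j.+1 o; set y' := c j y.
have yE : y' = act (linv (B j)) (act (linv (A j)) (winv j o)).
  have h : act (A j) (act (B j) y') = winv j o.
    by rewrite -(wK j (act _ _)) -wS /y winvK.
  by rewrite -h !actK.
(* Seen from the frame just before [c j], the starting point [o] has been pushed by the inverse of
   [A j] and then by that of [B j]. *)
have y'U : U (linv (B j)) y'.
  apply: VU; rewrite yE; apply: push; rewrite linvK => hB.
  have hA : V (linv (A j)) (act (linv (A j)) (winv j o)).
    by apply: push; rewrite linvK; exact: Agood.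
  have := disj (UU0 hB) (UU0 (VU hA)); move/negP: (AB j) => + e.
  by apply; apply/eqP; rewrite e linvK.
(* The past [y'] and the future [c j q] both lie behind [o] as seen from [c j o], while the geodesic
   between them passes near [c j o]. The three inequalities sum to [d(o, c j o) <= 3 * K], against
   [clong]. *)
have p1 := passes_dist geo (pass1 (@Agood j.+1) qV).
have p2 := passes_dist geo (pass0 (@Bgood j) y'U).
have p3 := passes_dist geo (pass0 (@Bgood j) hU).
have e1 : mdist y o = mdist y' (c j o) by rewrite (proj1 (ciso j)).
have e2 : mdist o q = mdist (c j o) (c j q) by rewrite (proj1 (ciso j)).
have e3 : mdist y q = mdist y' (c j q) by rewrite (proj1 (ciso j)).
rewrite -/y e1 e2 e3 in p1.
have := clong j; have := metric_triangle y' o (c j q).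
rewrite (metric_sym (c j o) o) in p2 p3.
rewrite (metric_sym y' (c j o)) in p1; rewrite (metric_sym y' o).
lra.
Qed.

Lemma chain_passes j k : (j <= k)%N -> 0 <= K -> passes o (w k o) (w j o) K.
Proof.
rewrite leq_eqVlt => /orP[/eqP -> K0|jk _].
  move=> s [seg s0 sl]; exists (mdist o (w k o)).
  by rewrite mdist_ge0 lexx sl mdistxx.
have wi : is_isometry (winv j) by exact: cancel_isometry (wK j) (winvK j) (wiso j).
apply: (passes_isometry wi); rewrite wK.
apply: pass1 (@Agood j) _.
by rewrite -(subnKC jk) addSn; exact: chain_forward.
Qed.

End Chain.

Section Shadow.
Context {R : realType} {X1 X2 : metricType R}.
Local Notation X := (l2prod X1 X2).
Local Notation G := ({compact-open, X1 -> X1} * {compact-open, X2 -> X2})%type.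
Hypotheses (hX1 : hadamard X1) (hX2 : hadamard X2).
Let geo1 : geodesic_space X1 := let: And3 _ h _ := hX1 in h.
Let geo2 : geodesic_space X2 := let: And3 _ h _ := hX2 in h.
Let comp1 : complete_space X1 := let: And3 h _ _ := hX1 in h.
Let comp2 : complete_space X2 := let: And3 h _ _ := hX2 in h.
Let hS1 : stewart X1 := let: And3 _ g h := hX1 in cat0_stewart g h.
Let hS2 : stewart X2 := let: And3 _ g h := hX2 in cat0_stewart g h.
Let hS : stewart X := l2_stewart hS1 hS2 geo1 geo2.
Let geo : geodesic_space X := l2_geodesic geo1 geo2.

Variables (theta : R) (o : X) (Gamma : set G).
Hypothesis theta_itv : 0 < theta < pi / 2.
Hypothesis grp : is_isometry_group Gamma.

Lemma slope_cos_gt0 : 0 < cos theta.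
Proof. by apply: cos_gt0_pihalf; case/andP: theta_itv => a b; rewrite b andbT; lra. Qed.

Lemma slope_sin_gt0 : 0 < sin theta.
Proof.
by apply: sin_gt0_pi; case/andP: theta_itv => a b; rewrite a/=; have := pi_gt0 R; lra.
Qed.

Let ct := slope_cos_gt0.
Let st := slope_sin_gt0.

(** Bounded distance is required only in each factor separately, at unrelated times [t1] and [t2];
    convergence in the cone topology follows already from sublinear distance to the join ray at time
    [r n]. *)
Lemma radial_ray (s1 : R -> X1) (s2 : R -> X2) (gam : nat -> G) (r t1 t2 : nat -> R) (C : R) :
  is_ray s1 -> is_ray s2 -> s1 0 = o.1 -> s2 0 = o.2 ->
  (forall n, Gamma (gam n)) ->
  (forall n, 0 <= t1 n /\ mdist ((gam n).1 o.1) (s1 (t1 n)) <= C) ->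
  (forall n, 0 <= t2 n /\ mdist ((gam n).2 o.2) (s2 (t2 n)) <= C) ->
  (forall M, exists N, forall n, (N <= n)%N -> M <= r n) ->
  (forall e, 0 < e -> exists N, forall n, (N <= n)%N ->
    mdist (pair_action (gam n) o) (join_ray theta s1 s2 (r n)) <= e * r n) ->
  radial_limit_set Gamma o (ray_class (join_ray theta s1 s2)).
Proof.
move=> ray1 ray2 s10 s20 gamG h1 h2 rdiv rclose.
have ray := join_ray_is_ray ct st ray1 ray2; set s := join_ray theta s1 s2 in ray rclose *.
have s0 : s 0 = o by rewrite /s /join_ray !mul0r s10 s20 -surjective_pairing.
have bd : boundary (ray_class s) by exact: ray_class_boundary.
split=> //; exists gam; split=> //; last first.
  apply: Or31; exists (ray_class s1), (ray_class s2), theta; split=> //.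
  - exact: ray_class_boundary.
  - exact: ray_class_boundary.
  - exact: (boundary_join_class hS1 hS2 geo1 geo2 ct st).
  split.
    exists s1; first by split=> //; exact: asymptotic_refl.
    by exists C => n; have [? ?] := h1 n; exists (t1 n).
  exists s2; first by split=> //; exact: asymptotic_refl.
  by exists C => n; have [? ?] := h2 n; exists (t2 n).
move=> S [[p1 p2] /= [p10 p20] sub].
have rfE : ray_from o (ray_class s) p1 = s p1.
  apply: (ray_from_eq hS1 hS2 geo1 geo2) => //; last exact: ltW.
  by split=> //; exact: asymptotic_refl.
(* The first entry keeps the orbit distance above [r n / 2]; the second makes [2 * p1 * e <= p2], so
   that the hinge bound [2 * (p1 * e)^2] on the squared distance at time [p1] is below [p2^2]. *)
pose e := Num.min (1 / 2) (p2 / (2 * p1)).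
have e0 : 0 < e by rewrite lt_min divr_gt0//= divr_gt0// mulr_gt0.
have e12 : e <= 1 / 2 by rewrite ge_min lexx.
have ep : e * (2 * p1) <= p2 by rewrite -ler_pdivlMr ?mulr_gt0// ge_min lexx orbT.
have [N1 hN1] := rdiv (2 * p1 + 1); have [N2 hN2] := rclose e e0.
exists (maxn N1 N2) => // n /=; rewrite geq_max => /andP[/hN1 rn /hN2 dn].
apply: sub => /=; set z := pair_action (gam n) o in dn *.
have r0 : 0 < r n by lra.
have or : mdist o (s (r n)) = r n by rewrite -s0 (ray_dist ray) ?subr0// ltW.
have := dist_diff o z (s (r n)); rewrite or.
set l := mdist o z => lr.
have lrn : `|l - r n| <= e * r n by apply: le_trans dn.
have er : e * r n <= 1 / 2 * r n by rewrite ler_pM2r.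
have lr2 : 1 / 2 * r n <= l by move: lrn; rewrite ler_norml => /andP[? ?]; lra.
split; first lra.
have [t tb] := geo o z; exists t => //; rewrite rfE.
case: tb => segt t0 tl.
have l0 : 0 < l by lra.
have := cat0_hinge hS segt (@ray_segment _ _ s (r n) ray) _ (a := p1) (b := p1).
rewrite t0 s0 tl -/l (ltW p10) /=.
have -> : p1 <= l by lra.
have -> : p1 <= r n by lra.
move=> /(_ erefl isT isT); set D := mdist (t p1) (s p1) => hD.
set E := mdist z (s (r n)) in dn hD.
have E2 : E ^+ 2 <= (e * r n) ^+ 2.
  by rewrite ler_pXn2r ?nnegrE ?mdist_ge0// mulr_ge0// ltW.
have hD1 : l * r n * D ^+ 2 <= p1 ^+ 2 * (e * r n) ^+ 2.
  have a1 : p1 ^+ 2 * E ^+ 2 <= p1 ^+ 2 * (e * r n) ^+ 2 by rewrite ler_wpM2l ?sqr_ge0.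
  have a2 : 0 <= p1 ^+ 2 * (l - r n) ^+ 2 by rewrite mulr_ge0 ?sqr_ge0.
  lra.
have hD2 : 1 / 2 * r n * (r n * D ^+ 2) <= l * (r n * D ^+ 2).
  by rewrite ler_wpM2r// mulr_ge0 ?sqr_ge0// ltW.
have hD3 : D ^+ 2 <= 2 * (p1 * e) ^+ 2.
  have rr : 0 < r n * r n by rewrite mulr_gt0.
  rewrite -(ler_pM2l rr); lra.
have hD4 : (2 * (p1 * e)) ^+ 2 <= p2 ^+ 2.
  rewrite ler_pXn2r ?nnegrE ?(ltW p20)//; first by lra.
  by rewrite !mulr_ge0// ltW.
have hD5 : D ^+ 2 < p2 ^+ 2.
  have : 0 < (p1 * e) ^+ 2 by rewrite exprn_gt0// mulr_gt0.
  lra.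
by rewrite -(ltr_pXn2r (n := 2)) ?nnegrE ?mdist_ge0 ?(ltW p20).
Qed.

Definition gmul (f g : G) : G := (f.1 \o g.1, f.2 \o g.2).
Definition giter (n : nat) (f : G) : G := (iter n f.1, iter n f.2).

Lemma gmul_mem f g : Gamma f -> Gamma g -> Gamma (gmul f g).
Proof. by case: grp => _ _ m _; exact: m. Qed.

Lemma giter_mem n f : Gamma f -> Gamma (giter n f).
Proof.
move=> Gf; elim: n => [|n IH]; first by case: grp.
exact: (gmul_mem Gf IH).
Qed.

Lemma iter_cancel T n (f g : T -> T) : cancel f g -> cancel (iter n f) (iter n g).
Proof. by move=> fg; elim: n => [//|n IH] x; rewrite (iterSr n g) /= fg IH. Qed.

Lemma unique_letter (P : bool * bool -> Prop) :
  (forall e e', P e -> P e' -> e = e') -> exists e1, forall e, P e -> e = e1.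
Proof.
move=> uniq; have [[e1 Pe1]|no] := pselect (exists e, P e).
  by exists e1 => e Pe; exact: uniq.
by exists (true, true) => e Pe; exfalso; apply: no; exists e.
Qed.

Hypotheses (prop1 : proper_space X1) (prop2 : proper_space X2).
Hypothesis rk1 : exists g h, [/\ Gamma g, Gamma h,
  independent_rank_one g.1 h.1 & independent_rank_one g.2 h.2].
Hypothesis approx : forall k M : R, 0 < k -> exists gamma, [/\ Gamma gamma,
  M <= mdist o (pair_action gamma o),
  `|mdist o.1 (gamma.1 o.1) - mdist o (pair_action gamma o) * cos theta|
     <= k * mdist o (pair_action gamma o) &
  `|mdist o.2 (gamma.2 o.2) - mdist o (pair_action gamma o) * sin theta|
     <= k * mdist o (pair_action gamma o)].

(* The ray follows the orbit points [W j o] of a chain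
   [W (j+1) = W j * a_j * b_j * c_j]: the letters [a_j], [b_j] are powers of the
   two rank one elements preventing backtracking, and [c_j] is so long, with
   direction so close to [theta], that it dominates the direction of [W (j+1) o]. *)
Lemma shadow_ray : exists2 K, 0 <= K & forall gamma k, Gamma gamma ->
  `|mdist o.1 (gamma.1 o.1) - mdist o (pair_action gamma o) * cos theta|
     <= k * mdist o (pair_action gamma o) ->
  `|mdist o.2 (gamma.2 o.2) - mdist o (pair_action gamma o) * sin theta|
     <= k * mdist o (pair_action gamma o) ->
  exists s1 s2, [/\ is_ray s1, is_ray s2, s1 0 = o.1, s2 0 = o.2 &
    radial_limit_set Gamma o (ray_class (join_ray theta s1 s2)) /\
    mdist (pair_action gamma o)
      (join_ray theta s1 s2 (mdist o (pair_action gamma o)))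
    <= K + 2 * k * mdist o (pair_action gamma o)].
Proof.
have [iso _ _ invex] := grp.
have /choice[inv hinv] : forall f : G, exists g : G, Gamma f -> [/\ Gamma g,
    cancel f.1 g.1, cancel g.1 f.1, cancel f.2 g.2 & cancel g.2 f.2].
  move=> f; have [Gf|nGf] := pselect (Gamma f); last by exists f.
  by have [g hg] := invex f Gf; exists g.
have [g [h [Gg Gh ind1 ind2]]] := rk1.
pose gen (e : bool * bool) : G :=
  let f := if e.1 then h else g in if e.2 then f else inv f.
have genG e : Gamma (gen e).
  have Gf : Gamma (if e.1 then h else g) by case: e.1.
  by rewrite /gen; case: e.2 => //; case: (hinv _ Gf).
have gen1 b : cancel (gen (b, true)).1 (gen (b, false)).1 /\
    cancel (gen (b, false)).1 (gen (b, true)).1.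
  by rewrite /gen /=; case: b; [case: (hinv h Gh)|case: (hinv g Gg)].
have gen2 b : cancel (gen (b, true)).2 (gen (b, false)).2 /\
    cancel (gen (b, false)).2 (gen (b, true)).2.
  by rewrite /gen /=; case: b; [case: (hinv h Gh)|case: (hinv g Gg)].
have [U01 [U1 [V1 [K1 [N1 [disj1 [VU1 UU1] p01 p11 push1]]]]]] :=
  @pingpong _ _ hS1 geo1 prop1 o.1 (fun e => (gen e).1) gen1 ind1.
have [U02 [U2 [V2 [K2 [N2 [disj2 [VU2 UU2] p02 p12 push2]]]]]] :=
  @pingpong _ _ hS2 geo2 prop2 o.2 (fun e => (gen e).2) gen2 ind2.
pose N := maxn N1 N2; pose act e := giter N (gen e).
have actG e : Gamma (act e) by exact: giter_mem.
have {}push1 e z : ~ U1 (linv e) z -> V1 e ((act e).1 z).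
  exact: (push1 N e z (leq_maxl _ _)).
have {}push2 e z : ~ U2 (linv e) z -> V2 e ((act e).2 z).
  exact: (push2 N e z (leq_maxr _ _)).
have actK1 e : cancel (act e).1 (act (linv e)).1.
  by apply: iter_cancel; case: e => b [] /=; case: (gen1 b).
have actK2 e : cancel (act e).2 (act (linv e)).2.
  by apply: iter_cancel; case: e => b [] /=; case: (gen2 b).
pose K := `|K1| + `|K2|.
have K0 : 0 <= K by rewrite addr_ge0.
have K1K : K1 <= K by rewrite (le_trans (ler_norm _))// lerDl.
have K2K : K2 <= K by rewrite (le_trans (ler_norm _))// lerDr.
have {}p01 e x y : ~ U01 e x -> U1 e y -> passes x y o.1 K.
  by move=> a b; apply: passesW K1K _; exact: (p01 e).
have {}p11 e x y : ~ U1 e x -> V1 e y -> passes x y o.1 K.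
  by move=> a b; apply: passesW K1K _; exact: (p11 e).
have {}p02 e x y : ~ U02 e x -> U2 e y -> passes x y o.2 K.
  by move=> a b; apply: passesW K2K _; exact: (p02 e).
have {}p12 e x y : ~ U2 e x -> V2 e y -> passes x y o.2 K.
  by move=> a b; apply: passesW K2K _; exact: (p12 e).
pose len (f : G) := mdist o (pair_action f o).
have len0 f : 0 <= len f by exact: mdist_ge0.
have len1 f : mdist o.1 (f.1 o.1) <= len f by exact: (l2_ge1 o (pair_action f o)).
have len2 f : mdist o.2 (f.2 o.2) <= len f by exact: (l2_ge2 o (pair_action f o)).
pose S := len (act (true, true)) + len (act (true, false)) +
          len (act (false, true)) + len (act (false, false)).
have lenS e : len (act e) <= S.
  have a1 := len0 (act (true, true)); have a2 := len0 (act (true, false)).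
  have a3 := len0 (act (false, true)); have a4 := len0 (act (false, false)).
  by rewrite /S; case: e => [[] []]; lra.
(* The most by which left multiplication by [f] and two letters can change a displacement. *)
pose P f := len f + 2 * S.
have S0 : 0 <= S := le_trans (len0 _) (lenS (true, true)).
have P0 f : 0 <= P f by rewrite /P; have := len0 f; lra.
(* A syllable of slope error at most [mu / 2] is displaced by at least [mu / 2] times its length in
   both factors. *)
pose mu := Num.min (cos theta) (sin theta).
have mu0 : 0 < mu by rewrite lt_min ct st.
have mucos : mu <= cos theta by rewrite ge_min lexx.
have musin : mu <= sin theta by rewrite ge_min lexx orbT.
have mu1 : mu <= 1 by apply: le_trans mucos (cos_le1 _).
(* The first length condition makes the past negligible against the new syllable, the second gives
   [clong] and divergence in both factors, and the slope errors tend to zero with [n]. *)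
have /choice[stepf hstep] : forall q : nat * G,
    exists r : (bool * bool) * (bool * bool) * G, Gamma q.2 ->
    [/\ Gamma r.2, r.1.1 != linv r.1.2,
      ~ U1 r.1.1 ((inv q.2).1 o.1) /\ ~ U2 r.1.1 ((inv q.2).2 o.2),
      ~ U01 (linv r.1.2) (r.2.1 o.1) /\ ~ U02 (linv r.1.2) (r.2.2 o.2) &
      [/\ q.1.+1%:R * P q.2 <= len r.2,
        3 * K + 1 + q.1%:R + P q.2 <= mu / 2 * len r.2,
        `|mdist o.1 (r.2.1 o.1) - len r.2 * cos theta| <= mu / 2 / q.1.+1%:R * len r.2 &
        `|mdist o.2 (r.2.2 o.2) - len r.2 * sin theta| <= mu / 2 / q.1.+1%:R * len r.2]].
  move=> [n w] /=; have [Gw|nGw] := pselect (Gamma w); last first.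
    by exists (true, true, (true, true), w).
  have n0 : 0 < n.+1%:R :> R by rewrite ltr0n.
  have k0 : 0 < mu / 2 / n.+1%:R by rewrite !divr_gt0.
  pose M := n.+1%:R * P w + (3 * K + 1 + n%:R + P w) / (mu / 2).
  have [c [Gc cM c1 c2]] := approx M k0.
  have q0 : 0 <= (3 * K + 1 + n%:R + P w).
    by have := P0 w; have := ler0n R n; lra.
  have m20 : 0 < mu / 2 by rewrite divr_gt0.
  have cM1 : n.+1%:R * P w <= len c.
    by apply: le_trans cM; rewrite lerDl divr_ge0// ltW.
  have cM2 : 3 * K + 1 + n%:R + P w <= mu / 2 * len c.
    rewrite [leRHS]mulrC -ler_pdivrMr//; apply: le_trans cM; rewrite lerDr.
    by rewrite mulr_ge0// ltW.
  have [e1 he1] := unique_letter (fun e e' => @disj1 e e' ((inv w).1 o.1)).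
  have [e2 he2] := unique_letter (fun e e' => @disj2 e e' ((inv w).2 o.2)).
  have [e3 he3] := unique_letter (fun e e' => @disj1 e e' (c.1 o.1)).
  have [e4 he4] := unique_letter (fun e e' => @disj2 e e' (c.2 o.2)).
  have [A [B /and5P[AB A1 A2 B3 B4]]] := choose_letters e1 e2 e3 e4.
  (* The condition on the second letter concerns its inverse, so [B] is chosen as that inverse. *)
  exists (A, linv B, c) => _ /=; rewrite !linvK; split=> //.
    by split=> [/UU1/he1|/UU2/he2] /eqP; apply/negP.
  by split=> [/he3|/he4] /eqP; apply/negP.
(* A contribution [2 * K] of [ray_limit] from each factor. *)
exists (4 * K); first by rewrite mulr_ge0.
move=> gamma k Ggamma hg1 hg2.
pose W := fix W (n : nat) : G := if n is m.+1 then
  let q := stepf (m, W m) in gmul (W m) (gmul (act q.1.1) (gmul (act q.1.2) q.2))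
  else gamma.
pose q n := stepf (n, W n).
have WS n : W n.+1 = gmul (W n) (gmul (act (q n).1.1) (gmul (act (q n).1.2) (q n).2)).
  by [].
have WG n : Gamma (W n).
  elim: n => [//|n IH]; rewrite WS; have [Gc _ _ _ _] := hstep (n, W n) IH.
  by do 3!(apply: gmul_mem => //).
have hq n := hstep (n, W n) (WG n).
have isoW n := iso _ (WG n).
have invW n := hinv _ (WG n).
have Gc n : Gamma (q n).2 by case: (hq n).
pose c n := (q n).2.
have Wlen n : `|mdist o.1 ((W n.+1).1 o.1) - mdist o.1 ((c n).1 o.1)| <= P (W n) /\
    `|mdist o.2 ((W n.+1).2 o.2) - mdist o.2 ((c n).2 o.2)| <= P (W n).
  set a := act (q n).1.1; set b := act (q n).1.2.
  have [[i1 _] [i2 _]] := isoW n.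
  have [[a1 _] [a2 _]] := iso _ (actG (q n).1.1).
  have [[b1 _] [b2 _]] := iso _ (actG (q n).1.2).
  have la := lenS (q n).1.1; have lb := lenS (q n).1.2; rewrite -/a in la; rewrite -/b in lb.
  split; rewrite WS.
    apply: (le_trans (translate_dist _ _ i1 a1 b1)); rewrite /P.
    by have := len1 (W n); have := len1 a; have := len1 b; lra.
  apply: (le_trans (translate_dist _ _ i2 a2 b2)); rewrite /P.
  by have := len2 (W n); have := len2 a; have := len2 b; lra.
have kap n : mu / 2 / n.+1%:R <= mu / 2.
  rewrite ler_pdivrMr ?ltr0n// ler_peMr ?divr_ge0 ?(ltW mu0)//.
  by rewrite -[1](mulr1n) ler_nat.
have clen n : mu / 2 * len (c n) <= mdist o.1 ((c n).1 o.1) /\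
    mu / 2 * len (c n) <= mdist o.2 ((c n).2 o.2).
  have [_ _ _ _ [_ _ /= c1 c2]] := hq n; rewrite -/(q n) -/(c n) in c1 c2.
  have k1 : mu / 2 / n.+1%:R * len (c n) <= mu / 2 * len (c n) by rewrite ler_wpM2r.
  have k2 : mu * len (c n) <= len (c n) * cos theta by rewrite mulrC ler_wpM2l.
  have k3 : mu * len (c n) <= len (c n) * sin theta by rewrite mulrC ler_wpM2l.
  move: c1 c2; rewrite !ler_norml => /andP[a1 _] /andP[b1 _].
  move: k1 k2 k3 a1 b1; set L := len (c n); set D1 := mdist o.1 _; set D2 := mdist o.2 _.
  set x1 := _ * L; set x2 := mu / 2 * L; set y1 := L * cos _; set y2 := L * sin _.
  have -> : mu * L = x2 + x2 by rewrite /x2; field.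
  by clear; move=> *; split; lra.
have big n : 3 * K + 1 + n%:R + P (W n) <= mu / 2 * len (c n).
  by case: (hq n) => _ _ _ _ [].
have K1' : 0 <= 3 * K + 1 by rewrite addr_ge0// mulr_ge0.
have big1 n := le_trans (big n) (proj1 (clen n)).
have big2 n := le_trans (big n) (proj2 (clen n)).
have pass1 j n : (j <= n)%N -> passes o.1 ((W n).1 o.1) ((W j).1 o.1) K.
  move=> jn; apply: (@chain_passes _ _ geo1 o.1 U01 U1 V1 K (fun e => (act e).1)
    actK1 disj1 VU1 UU1 p01 p11 push1 (fun n => (W n).1) (fun n => (inv (W n)).1)
    (fun n => (c n).1) (fun n => (q n).1.1) (fun n => (q n).1.2)) => //.
  - by move=> i; case: (isoW i).
  - by move=> i; case: (invW i).
  - by move=> i; case: (invW i).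
  - by move=> i; case: (iso _ (Gc i)).
  - by move=> i; case: (hq i) => _ _ [].
  - by move=> i; case: (hq i).
  - by move=> i; case: (hq i) => _ _ _ [].
  - move=> i; apply: lt_le_trans (big1 i).
    by rewrite -!addrA ltrDl ltr_pwDl// addr_ge0.
have pass2 j n : (j <= n)%N -> passes o.2 ((W n).2 o.2) ((W j).2 o.2) K.
  move=> jn; apply: (@chain_passes _ _ geo2 o.2 U02 U2 V2 K (fun e => (act e).2)
    actK2 disj2 VU2 UU2 p02 p12 push2 (fun n => (W n).2) (fun n => (inv (W n)).2)
    (fun n => (c n).2) (fun n => (q n).1.1) (fun n => (q n).1.2)) => //.
  - by move=> i; case: (isoW i).
  - by move=> i; case: (invW i).
  - by move=> i; case: (invW i).
  - by move=> i; case: (iso _ (Gc i)).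
  - by move=> i; case: (hq i) => _ _ [].
  - by move=> i; case: (hq i).
  - by move=> i; case: (hq i) => _ _ _ [].
  - move=> i; apply: lt_le_trans (big2 i).
    by rewrite -!addrA ltrDl ltr_pwDl// addr_ge0.
have div1 n : n%:R <= mdist o.1 ((W n.+1).1 o.1).
  have [] := Wlen n; rewrite ler_norml lerBrDr addrC => /andP[wn _] _; apply: le_trans wn.
  by rewrite lerBrDr; apply: le_trans (big1 n); rewrite -[leRHS]addrA lerDr.
have div2 n : n%:R <= mdist o.2 ((W n.+1).2 o.2).
  have [_] := Wlen n; rewrite ler_norml lerBrDr addrC => /andP[wn _]; apply: le_trans wn.
  by rewrite lerBrDr; apply: le_trans (big2 n); rewrite -[leRHS]addrA lerDr.
have [||s1 [ray1 s10 hs1]] := @ray_limit _ _ hS1 geo1 o.1 (fun n => (W n).1 o.1) K comp1.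
- move=> r; have [n0 hn0] := nat_ge r; exists n0.+1 => -[//|n] nn.
  by apply: le_trans (div1 n); exact: hn0.
- by move=> j n; exact: pass1.
have [||s2 [ray2 s20 hs2]] := @ray_limit _ _ hS2 geo2 o.2 (fun n => (W n).2 o.2) K comp2.
- move=> r; have [n0 hn0] := nat_ge r; exists n0.+1 => -[//|n] nn.
  by apply: le_trans (div2 n); exact: hn0.
- by move=> j n; exact: pass2.
have track n r e1 e2 : 0 <= r ->
    `|mdist o.1 ((W n).1 o.1) - r * cos theta| <= e1 ->
    `|mdist o.2 ((W n).2 o.2) - r * sin theta| <= e2 ->
    mdist (pair_action (W n) o) (join_ray theta s1 s2 r) <= 4 * K + e1 + e2.
  move=> r0 h1 h2; apply: (le_trans (l2_le _ _)) => /=.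
  have a1 : mdist ((W n).1 o.1) (s1 (r * cos theta)) <= 2 * K + e1.
    apply: (le_trans (metric_triangle _ (s1 (mdist o.1 ((W n).1 o.1))) _)).
    by apply: lerD (hs1 n) _; rewrite ray1 ?mdist_ge0// mulr_ge0// ltW.
  have a2 : mdist ((W n).2 o.2) (s2 (r * sin theta)) <= 2 * K + e2.
    apply: (le_trans (metric_triangle _ (s2 (mdist o.2 ((W n).2 o.2))) _)).
    by apply: lerD (hs2 n) _; rewrite ray2 ?mdist_ge0// mulr_ge0// ltW.
  have -> : 4 * K + e1 + e2 = (2 * K + e1) + (2 * K + e2) by ring.
  exact: lerD.
exists s1, s2; split=> //; split; last first.
  apply: (le_trans (track 0%N _ _ _ (mdist_ge0 _ _) hg1 hg2)).
  by rewrite le_eqVlt; apply/orP; left; apply/eqP; ring.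
have lenc n : n%:R <= len (c n).
  apply: le_trans (len1 (c n)); apply: le_trans (big1 n).
  by rewrite addrAC lerDr addr_ge0.
apply: (@radial_ray s1 s2 (fun n => W n.+1) (fun n => len (c n))
  (fun n => mdist o.1 ((W n.+1).1 o.1)) (fun n => mdist o.2 ((W n.+1).2 o.2)) (2 * K)) => //.
- by move=> n; split; [exact: mdist_ge0|exact: hs1].
- by move=> n; split; [exact: mdist_ge0|exact: hs2].
- by move=> M; have [n0 hn0] := nat_ge M; exists n0 => n /hn0 nM; exact: le_trans (lenc n).
move=> e e0.
have [n1 h1] := nat_ge (8 * K / e); have [n2 h2] := nat_ge (8 / e).
exists (maxn n1 n2) => n; rewrite geq_max => /andP[/h1 k1 /h2 k2].
have [_ _ _ _ [P1 _ /= c1 c2]] := hq n; rewrite -/(q n) -/(c n) in P1 c1 c2.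
have [w1 w2] := Wlen n.
have n0 : 0 < n.+1%:R :> R by rewrite ltr0n.
pose d := n.+1%:R^-1 * len (c n).
have Pd : P (W n) <= d by rewrite /d mulrC ler_pdivlMr// mulrC.
have kd : mu / 2 / n.+1%:R * len (c n) <= d.
  rewrite -mulrA -/d ler_piMl//; last by rewrite ler_pdivrMr// mul1r (le_trans mu1)// ler1n.
  by rewrite mulr_ge0// invr_ge0 ltW.
have e1 : `|mdist o.1 ((W n.+1).1 o.1) - len (c n) * cos theta| <= 2 * d.
  rewrite -[X in `|X|](subrKA (mdist o.1 ((c n).1 o.1))) mulr_natl mulr2n.
  apply: (le_trans (ler_normD _ _)); apply: lerD; first exact: le_trans w1 Pd.
  exact: le_trans c1 kd.
have e2 : `|mdist o.2 ((W n.+1).2 o.2) - len (c n) * sin theta| <= 2 * d.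
  rewrite -[X in `|X|](subrKA (mdist o.2 ((c n).2 o.2))) mulr_natl mulr2n.
  apply: (le_trans (ler_normD _ _)); apply: lerD; first exact: le_trans w2 Pd.
  exact: le_trans c2 kd.
apply: (le_trans (track n.+1 _ _ _ (len0 _) e1 e2)).
have a1 : 8 * K <= e * len (c n).
  rewrite [leRHS]mulrC -ler_pdivrMr//; exact: le_trans k1 (lenc n).
have a2 : 8 * d <= e * len (c n).
  rewrite /d mulrA ler_wpM2r// ler_pdivrMr//.
  apply: (@le_trans _ _ (n%:R * e)); first by rewrite -ler_pdivrMr.
  by rewrite [leLHS]mulrC ler_pM2l// ler_nat.
have -> : 4 * K + 2 * d + 2 * d = (8 * K + 8 * d) / 2 by field.
by rewrite ler_pdivrMr// mulr_natr mulr2n lerD.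
Qed.

End Shadow.

(** * Counting and covering *)

Section Counting.
Context {R : realType} {T : choiceType}.
Implicit Types (A B : set T) (s : seq T).

Lemma counting_le A (b : R) :
  (forall s, uniq s -> [set` s] `<=` A -> (size s)%:R <= b) ->
  (counting A <= b%:E)%E.
Proof.
move=> h; rewrite /counting; case: asboolP => [fin|inf].
  rewrite lee_fin; apply: h; first exact: finmap.fset_uniq.
  by move=> x /=; rewrite in_fset_set // inE.
have [n hn] := nat_ge (b + 1); exfalso.
have [F FA nF] := infinite_set_fset n inf.
by have := h _ (finmap.fset_uniq F) FA; have := hn _ nF; lra.
Qed.

Lemma counting_ge A s : uniq s -> [set` s] `<=` A ->
  ((size s)%:R%:E <= counting A :> \bar R)%E.
Proof.
move=> us sA; rewrite /counting; case: asboolP => [fin|inf]; last exact: leey.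
rewrite lee_fin ler_nat; apply: uniq_leq_size => // x xs.
by rewrite in_fset_set// inE; exact: sA.
Qed.

Lemma counting_subset A B : A `<=` B -> (counting A <= counting B :> \bar R)%E.
Proof.
move=> AB; rewrite {2}/counting; case: asboolP => [fin|]; last by move=> _; exact: leey.
apply: counting_le => s us sA; rewrite ler_nat; apply: uniq_leq_size => // x xs.
by rewrite in_fset_set// inE; exact/AB/sA.
Qed.

Lemma counting_seq A (b : R) : (counting A <= b%:E)%E ->
  exists s, [/\ uniq s, A = [set` s] & (size s)%:R <= b].
Proof.
rewrite /counting; case: asboolP => // fin; rewrite lee_fin => h.
exists (finmap.enum_fset (fset_set A)); split; [exact: finmap.fset_uniq| |exact: h].
by apply/seteqP; split=> x /=; rewrite in_fset_set// inE.
Qed.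

Lemma size_fibres (J : eqType) (r : seq J) (f : T -> J) s :
  uniq r -> (forall x, x \in s -> f x \in r) ->
  size s = (\sum_(j <- r) size [seq x <- s | f x == j])%N.
Proof.
move=> ur; elim: s => [|x s IH] h; first by rewrite big1.
rewrite (eq_bigr (fun j => (f x == j) + size [seq y <- s | f y == j])%N); last first.
  by move=> j _ /=; case: ifP.
rewrite big_split /= -IH; last by move=> y ys; apply: h; rewrite inE ys orbT.
have -> : (\sum_(j <- r) (f x == j))%N = count_mem (f x) r.
  by rewrite -sum1_count [RHS]big_mkcond; apply: eq_bigr => j _ /=; rewrite eq_sym; case: eqP.
by rewrite count_uniq_mem// h ?inE ?eqxx.
Qed.

End Counting.

Section Growth.
Context {R : realType}.
Implicit Types (u : nat -> \bar R) (a : \bar R).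

Lemma limn_esup_gt u a : (a < limn_esup u)%E ->
  forall n0, exists2 n, (n0 <= n)%N & (a < u n)%E.
Proof.
move=> h n0; apply: contrapT => no; move: h; apply/negP; rewrite -leNgt.
rewrite /limn_esup limf_esupE.
apply: (@le_trans _ _ (ereal_sup [set u n | n in [set n | (n0 <= n)%N]])).
  by apply: ereal_inf_lbound; exists [set n | (n0 <= n)%N] => //; exact: nbhs_infty_ge.
apply: ub_ereal_sup => _ [n /= n0n <-]; rewrite leNgt; apply/negP => un.
by apply: no; exists n.
Qed.

Lemma limn_esup_lt u a : (limn_esup u < a)%E ->
  exists n0, forall n, (n0 <= n)%N -> (u n < a)%E.
Proof.
rewrite /limn_esup limf_esupE => /ereal_inf_lt[_ [V [n0 _ V0] <-] Va].
exists n0 => n n0n; apply: le_lt_trans Va; apply: ereal_sup_ubound.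
by exists n => //; exact: V0.
Qed.

Lemma growth_gt (x : \bar R) (a : R) n : (0 < n)%N ->
  (a%:E < (n%:R^-1)%:E * lne x)%E -> ((expR (a * n%:R))%:E < x)%E.
Proof.
move=> n0; have n0' : 0 < n%:R :> R by rewrite ltr0n.
have i0 : (0 < (n%:R^-1 : R)%:E)%E by rewrite lte_fin invr_gt0.
case: x => [r| |]; last by rewrite /= gt0_muleNy.
  rewrite /lne; case: ifPn => [_|]; first by rewrite gt0_muleNy.
  rewrite -ltNge => r0; rewrite -EFinM !lte_fin mulrC ltr_pdivlMr// => h.
  by rewrite -[ltRHS]lnK// ltr_expR.
by rewrite ltey.
Qed.

Lemma growth_lt (x : \bar R) (a : R) n : (0 < n)%N ->
  ((n%:R^-1)%:E * lne x < a%:E)%E -> (x <= (expR (a * n%:R))%:E)%E.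
Proof.
move=> n0; have n0' : 0 < n%:R :> R by rewrite ltr0n.
have i0 : (0 < (n%:R^-1 : R)%:E)%E by rewrite lte_fin invr_gt0.
case: x => [r| |] /=; last by rewrite leNye.
  case: ifPn => [r0 _|]; first by rewrite lee_fin (le_trans r0)// expR_ge0.
  rewrite -ltNge => r0; rewrite -EFinM lte_fin lee_fin mulrC ltr_pdivrMr// => h.
  by rewrite -[leLHS]lnK// ler_expR ltW.
by rewrite gt0_muley.
Qed.

End Growth.

(** * Slopes of orbit points and displacements in the factors *)

Section SlopeExponent.
Context {R : realType} {X1 X2 : metricType R}.
Local Notation X := (l2prod X1 X2).
Local Notation G := ({compact-open, X1 -> X1} * {compact-open, X2 -> X2})%type.
Variables (theta : R) (o : X) (Gamma : set G).

Lemma slope_count_gt (a eps : R) n0 :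
  (a%:E < slope_exponent Gamma o theta)%E -> 0 < eps ->
  exists2 n, (n0 <= n)%N & ((expR (a * n%:R))%:E < slope_count Gamma o theta eps n)%E.
Proof.
rewrite /slope_exponent limf_einfE => /ereal_sup_gt[_ [V V0 <-] Va] eps0.
have [e [e0 ee Ve]] : exists e : R, [/\ 0 < e, e <= eps & V e].
  have : \forall e \near 0^'+, [/\ 0 < e, e <= eps & V e].
    near=> e; split; [by near: e; exact: nbhs_right_gt| |by near: e].
    by near: e; exact: nbhs_right_ltW.
  by move=> /filter_ex.
have : (a%:E < limn_esup (fun n => (n%:R^-1)%:E * lne (slope_count Gamma o theta e n)))%E.
  by apply: lt_le_trans Va _; apply: ereal_inf_lbound; exists e.
move=> /limn_esup_gt/(_ n0.+1)[n n0n h]; exists n; first exact: ltnW.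
have := growth_gt (leq_trans (ltn0Sn _) n0n) h => /lt_le_trans; apply.
by apply: counting_subset => g [? ? ?]; split=> //; apply: lt_le_trans ee.
Unshelve. all: by end_near. Qed.

Lemma slope_count_le (a : R) :
  (slope_exponent Gamma o theta < a%:E)%E ->
  exists eps n0, 0 < eps /\ forall n, (n0 <= n)%N ->
    (slope_count Gamma o theta eps n <= (expR (a * n%:R))%:E)%E.
Proof.
rewrite /slope_exponent limf_einfE => h.
set L := (fun eps : R => limn_esup _) in h.
have : (ereal_inf [set L x | x in [set e : R | (0 < e)%R]] < a%:E)%E.
  apply: le_lt_trans h; apply: ereal_sup_ubound.
  by exists [set e : R | 0 < e] => //; exact: nbhs_right_gt.
move=> /ereal_inf_lt[_ [e e0 <-]] /limn_esup_lt[n0 hn0].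
exists e, n0.+1; split=> // n n0n; apply: growth_lt (leq_trans (ltn0Sn _) n0n) _.
exact/hn0/ltnW.
Qed.

Hypothesis theta_itv : 0 < theta < pi / 2.

Lemma orbit_angleE (gamma : G) :
  mdist o.1 (gamma.1 o.1) = mdist o (pair_action gamma o) * cos (orbit_angle o gamma) /\
  mdist o.2 (gamma.2 o.2) = mdist o (pair_action gamma o) * sin (orbit_angle o gamma).
Proof.
rewrite l2prod_mdistE /orbit_angle /=.
set d1 := mdist o.1 _; set d2 := mdist o.2 _.
have d20 : 0 <= d2 by exact: mdist_ge0.
case: eqP => [->|/eqP d1n].
  by rewrite expr0n add0r sqrtr_sqr ger0_norm// cos_pihalf sin_pihalf mulr0 mulr1.
have d10 : 0 < d1 by rewrite lt_neqAle eq_sym d1n mdist_ge0.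
set x := d2 / d1.
have -> : Num.sqrt (d1 ^+ 2 + d2 ^+ 2) = d1 * Num.sqrt (1 + x ^+ 2).
  rewrite -[d1 in RHS]gtr0_norm// -sqrtr_sqr -sqrtrM ?sqr_ge0//.
  by congr Num.sqrt; rewrite /x; field.
have c0 : 0 < cos (atan x) by apply: cos_gt0_pihalf; rewrite atan_gtNpi2 atan_ltpi2.
have -> : sin (atan x) = x * cos (atan x).
  by rewrite -{2}[x]atanK /tan mulfVK// gt_eqF.
rewrite cos_atan.
have s0 : Num.sqrt (1 + x ^+ 2) != 0.
  by rewrite gt_eqF// sqrtr_gt0 ltr_pwDl// sqr_ge0.
rewrite mulfK//; split=> //; rewrite mulrCA mulfK// /x.
by rewrite mulfVK.
Qed.

Lemma angle_dist (k : R) : 0 < k -> exists2 eps, 0 < eps & forall gamma : G,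
  `|orbit_angle o gamma - theta| < eps ->
  `|mdist o.1 (gamma.1 o.1) - mdist o (pair_action gamma o) * cos theta|
     <= k * mdist o (pair_action gamma o) /\
  `|mdist o.2 (gamma.2 o.2) - mdist o (pair_action gamma o) * sin theta|
     <= k * mdist o (pair_action gamma o).
Proof.
move=> k0.
have : \forall a \near theta, `|cos theta - cos a| < k /\ `|sin theta - sin a| < k.
  near=> a; split; near: a.
    by move/cvgrPdist_lt: (@continuous_cos R theta); exact.
  by move/cvgrPdist_lt: (@continuous_sin R theta); exact.
move=> /nbhs_ballP[eps eps0 h]; exists eps => // gamma ha.
have /h[h1 h2] : ball theta eps (orbit_angle o gamma) by rewrite -ball_normE /= distrC.
move=> {h}; set a := orbit_angle o gamma in h1 h2 *.
have [e1 e2] := orbit_angleE gamma; rewrite -/a in e1 e2; rewrite e1 e2.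
set r := mdist o _; have r0 : 0 <= r by exact: mdist_ge0.
by split; rewrite -mulrBr normrM (ger0_norm r0) mulrC ler_wpM2r// distrC ltW.
Unshelve. all: by end_near. Qed.

(** A bounded error in both displacements changes their ratio by [O(1 / t)], and [atan] is
    continuous at [tan theta]. *)
Lemma dist_angle (eps c : R) : 0 < eps -> exists t0, forall (t : R) (gamma : G), t0 <= t ->
  `|mdist o.1 (gamma.1 o.1) - t * cos theta| <= c ->
  `|mdist o.2 (gamma.2 o.2) - t * sin theta| <= c ->
  `|orbit_angle o gamma - theta| < eps.
Proof.
move=> eps0; have [th0 thp] := andP theta_itv.
have c0 : 0 < cos theta by apply: cos_gt0_pihalf; rewrite thp andbT; lra.
have thE : atan (tan theta) = theta by apply: tanK; rewrite in_itv /= thp andbT; lra.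
have /cvgrPdist_lt/(_ _ eps0) := @continuous_atan R (tan theta).
move=> /nbhs_ballP[d d0 h].
pose c' := `|c| + 1; have c'0 : 0 < c' by rewrite ltr_wpDl.
exists ((c' + (2 * c' + 1) / (d * cos theta)) / cos theta) => t gamma.
rewrite ler_pdivrMr// => tl h1 h2; rewrite /orbit_angle.
set d1 := mdist o.1 _ in h1 *; set d2 := mdist o.2 _ in h2 *.
have cc : c <= c' by rewrite /c'; have := ler_norm c; lra.
have dc : 0 < d * cos theta by rewrite mulr_gt0.
have d1l : (2 * c' + 1) / (d * cos theta) <= d1.
  by move: h1; rewrite ler_norml => /andP[h1 _]; lra.
have d10 : 0 < d1 by apply: lt_le_trans d1l; rewrite divr_gt0//; lra.
rewrite gt_eqF// distrC -{1}thE; apply: h.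
rewrite -ball_normE /= /tan.
have -> : sin theta / cos theta - d2 / d1 =
    ((d1 - t * cos theta) * sin theta - (d2 - t * sin theta) * cos theta) / (cos theta * d1).
  by field; rewrite !gt_eqF.
have cd : 0 < cos theta * d1 by rewrite mulr_gt0.
rewrite normrM normfV (gtr0_norm cd) ltr_pdivrMr//.
apply: (le_lt_trans (ler_normB _ _)); rewrite !normrM.
have s1 : `|sin theta| <= 1 by rewrite ler_norml sin_geN1 sin_le1.
have c1 : `|cos theta| <= 1 by rewrite ler_norml cos_geN1 cos_le1.
have a1 : `|d1 - t * cos theta| * `|sin theta| <= c' * 1 by apply: ler_pM => //; lra.
have a2 : `|d2 - t * sin theta| * `|cos theta| <= c' * 1 by apply: ler_pM => //; lra.
move: d1l; rewrite ler_pdivrMr// => d1l.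
have : d * (cos theta * d1) = d1 * (d * cos theta) by ring.
lra.
Qed.

(** A positive exponent makes the count nonempty for arbitrarily large [n], within any angle [eps]
    of [theta]. *)
Lemma orbit_approx : (0 < slope_exponent Gamma o theta)%E ->
  forall k M : R, 0 < k -> exists gamma, [/\ Gamma gamma,
  M <= mdist o (pair_action gamma o),
  `|mdist o.1 (gamma.1 o.1) - mdist o (pair_action gamma o) * cos theta|
     <= k * mdist o (pair_action gamma o) &
  `|mdist o.2 (gamma.2 o.2) - mdist o (pair_action gamma o) * sin theta|
     <= k * mdist o (pair_action gamma o)].
Proof.
move=> pos k M k0; have [eps eps0 h] := angle_dist k0.
have [n0 hn0] := nat_ge (M + 1).
have [n n0n cn] := slope_count_gt n0 pos eps0.
apply: contrapT => no; suff : (slope_count Gamma o theta eps n <= 0%:E)%E.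
  by apply/negP; rewrite -ltNge; apply: lt_trans cn; rewrite lte_fin expR_gt0.
apply: counting_le => -[//|g s] _ sub; exfalso.
have [|Gg /andP[g1 _] ga] := sub g; first by rewrite /= inE eqxx.
apply: no; exists g; have [h1 h2] := h g ga; split=> //.
by have := hn0 n n0n; lra.
Qed.

End SlopeExponent.

Section Covers.
Context {R : realType} {X : metricType R}.
Variables (o : X) (c : R) (E : set (set (R -> X))).

Lemma hd_pre_mono (alpha : R) (e e' : R) : e <= e' ->
  (hd_pre o c alpha e' E <= hd_pre o c alpha e E)%E.
Proof.
move=> ee; apply: ereal_inf_le_tmp => _ [D [r [xi [h sub ->]]]].
exists D, r, xi; split=> // j Dj; have [? ? ? ?] := h j Dj; split=> //.
exact: lt_le_trans ee.
Qed.

Lemma hdE alpha :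
  hd o c alpha E = ereal_sup [set hd_pre o c alpha e E | e in [set e | 0 < e < 1]].
Proof.
rewrite /hd; apply: cvg_lim => //.
have := @nonincreasing_at_right_cvge R (fun e => hd_pre o c alpha e E) 0 (BLeft 1).
rewrite set_itvoo; apply; first by rewrite bnd_simp.
by move=> x y _ _; exact: hd_pre_mono.
Qed.

Lemma hd_pre_le_hd alpha e : 0 < e -> (hd_pre o c alpha e E <= hd o c alpha E)%E.
Proof.
move=> e0; rewrite hdE; apply: (@le_trans _ _ (hd_pre o c alpha (Num.min e (1 / 2)) E)).
  by apply: hd_pre_mono; rewrite ge_min lexx.
apply: ereal_sup_ubound; exists (Num.min e (1 / 2)) => //=.
by rewrite lt_min e0 divr_gt0//= gt_min; apply/orP; right; lra.
Qed.

Lemma finite_cover_hd_pre (alpha e r : R) (xi : seq (set (R -> X))) :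
  0 < r -> r < expR (- c) -> r < e ->
  (forall x, x \in xi -> boundary x) ->
  E `<=` [set eta | exists2 x, x \in xi & cball o c r x eta] ->
  (hd_pre o c alpha e E <= ((size xi)%:R * r `^ alpha)%:E)%E.
Proof.
move=> r0 rc re bd sub; apply: ereal_inf_lbound.
exists `I_(size xi), (fun=> r), (nth set0 xi); split.
- by move=> j jx; split=> //; apply/bd/mem_nth.
- move=> eta /sub[x xxi hx]; exists (index x xi); first by rewrite /= index_mem.
  by rewrite nth_index.
rewrite esum_fset; [|exact: finite_II|by move=> *; rewrite lee_fin powR_ge0].
by rewrite -(fsbig_ord _ _ (fun=> (r `^ alpha)%:E)) sumEFin mulr_natl sumr_const card_ord.
Qed.

End Covers.

(** * The radial limit set *)

Lemma cvg_mdist_lt (R : realType) (Y : metricType R) T (F : set_system T)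
    (FF : Filter F) (f : T -> Y) (y : Y) (e : R) :
  f t @[t --> F] --> y -> 0 < e -> \forall t \near F, mdist (f t) y < e.
Proof.
move=> fy e0; have h : mdist (f t) y @[t --> F] --> (0 : R).
  by rewrite -(mdistxx y); exact: cvg_mdist fy (cvg_cst y).
move/cvgrPdist_lt: h => /(_ _ e0) h; near=> t.
have : `|0 - mdist (f t) y| < e by near: t.
by rewrite sub0r normrN ger0_norm// mdist_ge0.
Unshelve. all: by end_near. Qed.

Section LimitSet.
Context {R : realType} {X1 X2 : metricType R}.
Local Notation X := (l2prod X1 X2).
Local Notation G := ({compact-open, X1 -> X1} * {compact-open, X2 -> X2})%type.
Hypotheses (hX1 : hadamard X1) (hX2 : hadamard X2).
Let geo1 : geodesic_space X1 := let: And3 _ h _ := hX1 in h.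
Let geo2 : geodesic_space X2 := let: And3 _ h _ := hX2 in h.
Let comp1 : complete_space X1 := let: And3 h _ _ := hX1 in h.
Let comp2 : complete_space X2 := let: And3 h _ _ := hX2 in h.
Let hS1 : stewart X1 := let: And3 _ g h := hX1 in cat0_stewart g h.
Let hS2 : stewart X2 := let: And3 _ g h := hX2 in cat0_stewart g h.
Let hS : stewart X := l2_stewart hS1 hS2 geo1 geo2.
Let geo : geodesic_space X := l2_geodesic geo1 geo2.

Variables (theta : R) (o : X) (Gamma : set G).
Hypothesis theta_itv : 0 < theta < pi / 2.
Hypothesis grp : is_isometry_group Gamma.
Let ct := slope_cos_gt0 theta_itv.
Let st := slope_sin_gt0 theta_itv.

Variable cG : R.
Hypothesis coc : forall eta, radial_limit_set Gamma o eta -> forall t, 0 < t ->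
  exists2 gamma, Gamma gamma & mdist (pair_action gamma o) (ray_from o eta t) < cG.

Local Notation limset := (radial_limit_set Gamma o `&` boundary_slope theta).

Lemma pair_action_dist g (p q : X) : Gamma g ->
  mdist (pair_action g p : X) (pair_action g q) = mdist p q.
Proof.
case: grp => iso _ _ _ /iso[[i1 _] [i2 _]].
by rewrite !l2prod_mdistE /= i1 i2.
Qed.

Lemma join_ray_from s1 s2 t : is_ray s1 -> is_ray s2 -> s1 0 = o.1 -> s2 0 = o.2 ->
  0 <= t -> ray_from o (ray_class (join_ray theta s1 s2)) t = join_ray theta s1 s2 t.
Proof.
move=> ray1 ray2 s10 s20 t0; have ray := join_ray_is_ray ct st ray1 ray2.
apply: (ray_from_eq hS1 hS2 geo1 geo2) => //; first exact: ray_class_boundary.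
  by split=> //; exact: asymptotic_refl.
by rewrite /join_ray !mul0r s10 s20 -surjective_pairing.
Qed.

Lemma limit_ray eta : limset eta -> exists s1 s2,
  [/\ is_ray s1, is_ray s2, s1 0 = o.1, s2 0 = o.2 &
      eta = ray_class (join_ray theta s1 s2)].
Proof.
move=> [[bd _] sl].
have [s1 [s2 [? ? ? ? [? _]]]] := slope_ray hS1 hS2 geo1 geo2 ct st o comp1 comp2 bd sl.
by exists s1, s2.
Qed.

Lemma limit_dist eta t : limset eta -> 0 <= t -> mdist o (ray_from o eta t) = t.
Proof.
move=> /limit_ray[s1 [s2 [ray1 ray2 s10 s20 ->]]] t0.
rewrite -{1}(_ : ray_from o (ray_class (join_ray theta s1 s2)) 0 = o); last first.
  by rewrite join_ray_from// /join_ray !mul0r s10 s20 -surjective_pairing.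
rewrite !join_ray_from//.
by rewrite (ray_dist (join_ray_is_ray ct st ray1 ray2))// subr0.
Qed.

(** Orbit points at bounded distance at integer times satisfy [radial_ray] with the projected times,
    the error [C] being sublinear. It is the tool for recognizing limit rays after a translation or
    a passage to the limit. *)
Lemma cocompact_limit s1 s2 (C : R) :
  is_ray s1 -> is_ray s2 -> s1 0 = o.1 -> s2 0 = o.2 ->
  (forall n : nat, exists2 gamma, Gamma gamma &
     mdist (pair_action gamma o) (join_ray theta s1 s2 n.+1%:R) <= C) ->
  limset (ray_class (join_ray theta s1 s2)).
Proof.
move=> ray1 ray2 s10 s20 close; split; last exact: join_ray_slope.
have /choice[gam hgam] : forall n : nat, exists gamma, Gamma gamma /\
    mdist (pair_action gamma o) (join_ray theta s1 s2 n.+1%:R) <= C.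
  by move=> n; have [g ? ?] := close n; exists g.
apply: (@radial_ray _ _ _ hX1 hX2 theta o Gamma theta_itv s1 s2 gam (fun n => n.+1%:R)
  (fun n => n.+1%:R * cos theta) (fun n => n.+1%:R * sin theta) C) => //.
- by move=> n; case: (hgam n).
- move=> n; split; first by rewrite mulr_ge0// ltW.
  exact: le_trans (l2_ge1 _ _) (proj2 (hgam n)).
- move=> n; split; first by rewrite mulr_ge0// ltW.
  exact: le_trans (l2_ge2 _ _) (proj2 (hgam n)).
- move=> M; have [n0 hn0] := nat_ge M; exists n0 => n n0n.
  by apply: hn0; exact: leqW.
move=> e e0; have [n0 hn0] := nat_ge (C / e); exists n0 => n n0n.
apply: le_trans (proj2 (hgam n)) _; rewrite mulrC -ler_pdivrMr//.
by apply: hn0; exact: leqW.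
Qed.

(** The ray from [o] asymptotic to the translated tail stays as close to it as at its start. It is
    again a limit ray because [g] carries orbit points near [eta] to orbit points near the new
    ray. *)
Lemma limit_translate eta g (T : R) : limset eta -> Gamma g -> 0 <= T ->
  exists2 eta', limset eta' & forall u, 0 <= u ->
    mdist (pair_action g (ray_from o eta (T + u)) : X) (ray_from o eta' u)
      <= mdist (pair_action g (ray_from o eta T) : X) o.
Proof.
move=> Eeta Gg T0; have rad := proj1 Eeta.
have [s1 [s2 [ray1 ray2 s10 s20 etaE]]] := limit_ray Eeta.
have [iso _ _ _] := grp; have [[i1 _] [i2 _]] := iso _ Gg.
have shift (Y : metricType R) (s : R -> Y) (f : Y -> Y) (b : R) : is_ray s ->
    (forall x y, mdist (f x) (f y) = mdist x y) -> 0 <= b ->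
    is_ray (fun u => f (s (b + u))).
  move=> rays fi b0 x y x0 y0; rewrite fi rays ?addr_ge0//; congr `|_|; ring.
have r1 := shift _ _ _ _ ray1 i1 (mulr_ge0 T0 (ltW ct)).
have r2 := shift _ _ _ _ ray2 i2 (mulr_ge0 T0 (ltW st)).
have [s1' [ray1' s10' as1]] := ray_exists hS1 geo1 o.1 comp1 r1.
have [s2' [ray2' s20' as2]] := ray_exists hS2 geo2 o.2 comp2 r2.
have bound u : 0 <= u ->
    mdist (pair_action g (ray_from o eta (T + u)) : X) (join_ray theta s1' s2' u)
      <= mdist (pair_action g (ray_from o eta T) : X) o.
  move=> u0; have := ray_asymptotic_le hS geo (join_ray_is_ray ct st r1 r2)
    (join_ray_is_ray ct st ray1' ray2') (join_ray_asymptotic ct st as1 as2) u0.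
  rewrite etaE !join_ray_from ?addr_ge0//.
  by rewrite /join_ray /pair_action /= !mul0r !addr0 !mulrDl s10' s20' -surjective_pairing.
exists (ray_class (join_ray theta s1' s2')); last first.
  by move=> u u0; rewrite join_ray_from//; exact: bound.
apply: (@cocompact_limit _ _ (cG + mdist (pair_action g (ray_from o eta T) : X) o)) => // n.
have n0 : 0 <= n.+1%:R :> R by exact: ler0n.
have [|h Gh hh] := coc rad (t := T + n.+1%:R); first by rewrite ltr_wpDl.
exists (gmul g h); first exact: (gmul_mem grp).
apply: (le_trans (metric_triangle _ (pair_action g (ray_from o eta (T + n.+1%:R))) _)).
apply: lerD; last exact: bound.
by rewrite (pair_action_dist (pair_action h o) _ Gg) ltW.
Qed.

Hypotheses (prop1 : proper_space X1) (prop2 : proper_space X2).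

(** Limit rays escaping every finite subfamily have an ultralimit, which is a limit ray because the
    cocompactness constant survives up to [cG + 1]. It lies in some open ball, which then contains
    nearby rays as well. *)
Lemma limit_set_compact (D : set nat) (u : nat -> R) (y : nat -> X) (c : R) :
  (forall j, D j -> 0 <= u j) ->
  (forall eta, limset eta -> exists2 j, D j & mdist (ray_from o eta (u j)) (y j) < c) ->
  exists N, forall eta, limset eta ->
    exists j, [/\ D j, (j < N)%N & mdist (ray_from o eta (u j)) (y j) < c].
Proof.
move=> u0 cover; apply: contrapT => no.
have /choice[f hf] : forall N, exists p : (R -> X1) * (R -> X2),
    [/\ is_ray p.1, is_ray p.2, p.1 0 = o.1, p.2 0 = o.2 &
      limset (ray_class (join_ray theta p.1 p.2)) /\
      forall j, D j -> (j < N)%N -> ~ mdist (join_ray theta p.1 p.2 (u j)) (y j) < c].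
  move=> N; apply: contrapT => noN; apply: no; exists N => eta Eeta.
  apply: contrapT => nocov; apply: noN.
  have [s1 [s2 [ray1 ray2 s10 s20 etaE]]] := limit_ray Eeta.
  exists (s1, s2); split=> //=; split; first by rewrite -etaE.
  move=> j Dj jN lt; apply: nocov; exists j; split=> //.
  by rewrite etaE join_ray_from//; exact: u0.
have [U UU ooU] := ultra_infty.
have /choice[g1 hg1] : forall t : R, exists z : X1, 0 <= t -> (f N).1 t @[N --> U] --> z.
  move=> t; have [t0|t0] := leP 0 t; last by exists o.1.
  have [|z hz] := @prop1 _ U (fun N => (f N).1 t) o.1 t UU; last by exists z.
  by apply: nearW => N; have [r1 _ s1 _ _] := hf N; rewrite -s1 (ray_dist r1)// subr0.
have /choice[g2 hg2] : forall t : R, exists z : X2, 0 <= t -> (f N).2 t @[N --> U] --> z.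
  move=> t; have [t0|t0] := leP 0 t; last by exists o.2.
  have [|z hz] := @prop2 _ U (fun N => (f N).2 t) o.2 t UU; last by exists z.
  by apply: nearW => N; have [_ r1 _ s1 _] := hf N; rewrite -s1 (ray_dist r1)// subr0.
have ray1 : is_ray g1.
  move=> a b a0 b0; apply: (mdist_lim_eq (hg1 a a0) (hg1 b b0)).
  by apply: nearW => N; have [r1 _ _ _ _] := hf N; exact: r1.
have ray2 : is_ray g2.
  move=> a b a0 b0; apply: (mdist_lim_eq (hg2 a a0) (hg2 b b0)).
  by apply: nearW => N; have [_ r1 _ _ _] := hf N; exact: r1.
have g10 : g1 0 = o.1.
  apply: mdist_positivity; apply: (mdist_lim_eq (hg1 0 (lexx _)) (cvg_cst o.1)).
  by apply: nearW => N; have [_ _ -> _ _] := hf N; rewrite mdistxx.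
have g20 : g2 0 = o.2.
  apply: mdist_positivity; apply: (mdist_lim_eq (hg2 0 (lexx _)) (cvg_cst o.2)).
  by apply: nearW => N; have [_ _ _ -> _] := hf N; rewrite mdistxx.
have near_lim t e : 0 <= t -> 0 < e ->
    \forall N \near U, mdist (join_ray theta (f N).1 (f N).2 t) (join_ray theta g1 g2 t) < e.
  move=> t0 e0; have e2 : 0 < e / 2 by rewrite divr_gt0.
  have n1 := cvg_mdist_lt _ (hg1 _ (mulr_ge0 t0 (ltW ct))) e2.
  have n2 := cvg_mdist_lt _ (hg2 _ (mulr_ge0 t0 (ltW st))) e2.
  near=> N; apply: (le_lt_trans (l2_le _ _)) => /=.
  have h1 : mdist ((f N).1 (t * cos theta)) (g1 (t * cos theta)) < e / 2 by near: N; exact: n1.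
  have h2 : mdist ((f N).2 (t * sin theta)) (g2 (t * sin theta)) < e / 2 by near: N; exact: n2.
  by lra.
have Elim : limset (ray_class (join_ray theta g1 g2)).
  apply: (@cocompact_limit _ _ (cG + 1)) => // n.
  have n0 : 0 <= n.+1%:R :> R by exact: ler0n.
  have /filter_ex[N hN] := near_lim n.+1%:R 1 n0 ltr01.
  have [r1 r2 s1 s2 [EN _]] := hf N.
  have [|h Gh hh] := coc (proj1 EN) (t := n.+1%:R); first by rewrite ltr0n.
  exists h => //; rewrite join_ray_from// in hh.
  apply: (le_trans (metric_triangle _ (join_ray theta (f N).1 (f N).2 n.+1%:R) _)).
  by apply: lerD; exact: ltW.
have [j Dj] := cover _ Elim; rewrite join_ray_from//; last exact: u0.
rewrite -subr_gt0 => /(near_lim _ _ (u0 j Dj)) hN.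
have jN : \forall N \near U, (j < N)%N by apply: ooU; exact: nbhs_infty_gt.
have [N [hN1 hN2]] := @filter_ex _ U _ _ (filterI hN jN).
have [_ _ _ _ [_ bad]] := hf N; apply: (bad j Dj hN2).
apply: (le_lt_trans (metric_triangle _ (join_ray theta g1 g2 (u j)) _)).
by rewrite -ltrBrDr.
Unshelve. all: by end_near. Qed.

End LimitSet.

(** * The dimension estimates *)

Section SmallCovers.
Context {R : realType} {X : metricType R}.
Variables (o : X) (c : R) (E : set (set (R -> X))).

Lemma small_cover (alpha a T : R) : alpha < a -> (hd o c alpha E < +oo)%E ->
  exists (D : set nat) (u : nat -> R) (xi : nat -> set (R -> X)),
  [/\ forall j, D j -> T < u j,
      forall eta, E eta -> exists2 j, D j &
        mdist (ray_from o eta (u j)) (ray_from o (xi j) (u j)) < c &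
      forall N, \sum_(j <- [seq j <- iota 0 N | `[< D j >]]) expR (- a * u j) <= 1].
Proof.
move=> aa fin.
have [M M0 hM] : exists2 M : R, 0 < M & (hd o c alpha E < M%:E)%E.
  case: (hd o c alpha E) fin => [r _| |_]; first 1 last.
  - by [].
  - by exists 1 => //; exact: ltNye.
  by exists (`|r| + 1); rewrite ?ltr_wpDl// lte_fin; have := ler_norm r; lra.
have da : 0 < a - alpha by rewrite subr_gt0.
(* The second entry gives [M * r^(a - alpha) <= 1], so a sum of [r^alpha] below [M] becomes a sum of
   [r^a] at most 1. *)
pose b := Num.max T (ln M / (a - alpha)).
have /ereal_inf_lt[_ [D [r [xi [hD sub ->]]]] lt] :
    (hd_pre o c alpha (expR (- b)) E < M%:E)%E.
  by apply: le_lt_trans hM; apply: hd_pre_le_hd; exact: expR_gt0.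
have rb j : D j -> b < - ln (r j).
  by move=> /hD[r0 _ re _]; rewrite ltrNr -ltr_expR lnK.
exists D, (fun j => - ln (r j)), xi; split=> [j Dj|eta /sub[j Dj [_ h]]|N].
- by apply: le_lt_trans (rb j Dj); rewrite le_max lexx.
- by exists j.
set J := [seq j <- _ | _].
have JD j : j \in J -> D j by rewrite mem_filter => /andP[/asboolP].
have uJ : uniq J by rewrite filter_uniq// iota_uniq.
have le : \sum_(j <- J) r j `^ alpha <= M.
  rewrite -lee_fin; apply: le_trans (ltW lt); apply: esum_ge.
  exists [set` J]; first by split; [exact: finite_seq|exact: JD].
  by rewrite -fsbig_seq// sumEFin.
apply: (@le_trans _ _ (\sum_(j <- J) M^-1 * r j `^ alpha)); last first.
  by rewrite -mulr_sumr mulrC ler_pdivrMr// mul1r.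
rewrite big_seq [leRHS]big_seq; apply: ler_sum => j /JD Dj.
have [r0 _ _ _] := hD j Dj.
rewrite /powR gt_eqF// -{1}[M]lnK// -expRN -expRD ler_expR.
have : ln M / (a - alpha) <= - ln (r j).
  by apply: ltW; apply: le_lt_trans (rb j Dj); rewrite le_max lexx orbT.
by rewrite ler_pdivrMr//; lra.
Qed.

End SmallCovers.

Section Dimension.
Context {R : realType} {X1 X2 : metricType R}.
Local Notation X := (l2prod X1 X2).
Local Notation G := ({compact-open, X1 -> X1} * {compact-open, X2 -> X2})%type.
Hypotheses (hX1 : hadamard X1) (hX2 : hadamard X2).

Variables (theta : R) (o : X) (Gamma : set G).
Hypothesis theta_itv : 0 < theta < pi / 2.
Hypothesis grp : is_isometry_group Gamma.

Variable cG : R.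
Hypothesis cG0 : 0 < cG.
Hypothesis coc : forall eta, radial_limit_set Gamma o eta -> forall t, 0 < t ->
  exists2 gamma, Gamma gamma & mdist (pair_action gamma o) (ray_from o eta t) < cG.

Local Notation limset := (radial_limit_set Gamma o `&` boundary_slope theta).
Local Notation orb gamma := (pair_action gamma o : X).

Section Recursion.
Variables (s0 Z : R).
Hypothesis s00 : 0 < s0.
Hypothesis orbit_sum : forall s : seq G, uniq s -> [set` s] `<=` Gamma ->
  \sum_(gamma <- s) expR (- s0 * mdist o (orb gamma)) <= Z.

(** Each orbit point in the ball contributes at least [exp (- s0 * r)] to the Poincare series. *)
Lemma orbit_ball_size (s : seq G) (r : R) : uniq s ->
  (forall gamma, gamma \in s -> Gamma gamma /\ mdist o (orb gamma) <= r) ->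
  (size s)%:R <= Z * expR (s0 * r).
Proof.
move=> us h; rewrite -ler_pdivrMr ?expR_gt0// -expRN.
apply: le_trans (orbit_sum us _); last by move=> g /= /h[].
rewrite -sum1_size natr_sum mulr_suml big_seq [leRHS]big_seq.
apply: ler_sum => g /h[_ gr]; rewrite mul1r ler_expR.
by rewrite mulNr lerN2 ler_pM2l.
Qed.

Variables (J : seq nat) (u : nat -> R) (g : nat -> G) (T Tmax C a : R).
Hypotheses (uJ : uniq J) (T0 : 0 < T) (a0 : 0 <= a) (C0 : 0 <= C).
Hypothesis gG : forall j, j \in J -> Gamma (g j).
Hypothesis uT : forall j, j \in J -> T <= u j <= Tmax.
Hypothesis usum : \sum_(j <- J) expR (- a * u j) <= 1.
Hypothesis cover : forall eta, limset eta ->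
  exists2 j, j \in J & mdist (orb (g j)) (ray_from o eta (u j)) <= C.

(* Translating by the inverse of [g j] replaces the time [t] by [t - u j] at the
   cost of enlarging the radius [rho] by [C]. *)
Lemma shadow_size m (t rho : R) (s : seq G) :
  0 <= t -> t <= Tmax + m%:R * T -> uniq s ->
  (forall gamma, gamma \in s -> Gamma gamma /\
     exists2 eta, limset eta & mdist (orb gamma) (ray_from o eta t) <= rho) ->
  (size s)%:R <= Z * expR (s0 * (Tmax + rho) + (a + s0 * C / T) * t).
Proof.
have Z0 : 0 <= Z by have := @orbit_sum [::] isT; rewrite big_nil; apply.
have [_ _ _ invex] := grp; have [iso _ _ _] := grp.
pose b := a + s0 * C / T.
have b0 : 0 <= b by rewrite addr_ge0// !mulr_ge0 ?invr_ge0// ltW.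
rewrite -/b; move: t rho s.
have base t rho s : 0 <= t -> t <= Tmax -> uniq s ->
    (forall gamma, gamma \in s -> Gamma gamma /\
      exists2 eta, limset eta & mdist (orb gamma) (ray_from o eta t) <= rho) ->
    (size s)%:R <= Z * expR (s0 * (Tmax + rho) + b * t).
  move=> t0 tT us hs; apply: le_trans (@orbit_ball_size s (t + rho) us _) _.
    move=> h /hs[Gh [eta Eeta d]]; split=> //.
    rewrite (le_trans (metric_triangle _ (ray_from o eta t) _))//.
    by rewrite (limit_dist hX1 hX2 theta_itv Eeta)// lerD2l metric_sym.
  rewrite ler_wpM2l// ler_expR -[leLHS]addr0 lerD ?mulr_ge0//.
  by rewrite ler_pM2l// lerD2r.
elim: m => [|m IH] t rho s t0 tm us hs;
    (have [tT|tT] := leP t Tmax; first exact: base).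
  by exfalso; move: tm; rewrite mul0r addr0; lra.
have /choice[f hf] : forall gamma, exists j, gamma \in s -> j \in J /\
    exists eta, [/\ limset eta, mdist (orb gamma) (ray_from o eta t) <= rho &
      mdist (orb (g j)) (ray_from o eta (u j)) <= C].
  move=> h; have [hins|] := boolP (h \in s); last by exists 0%N.
  have [_ [eta Eeta d]] := hs h hins; have [j jJ dj] := cover Eeta.
  by exists j => _; split=> //; exists eta.
rewrite (size_fibres uJ (fun h hins => proj1 (hf h hins))) natr_sum.
apply: (@le_trans _ _ (\sum_(j <- J)
    Z * expR (s0 * (Tmax + rho) + b * t) * expR (- a * u j))); last first.
  by rewrite -mulr_sumr ler_piMr// mulr_ge0// expR_ge0.
rewrite big_seq [leRHS]big_seq; apply: ler_sum => j jJ.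
have /andP[ujT ujm] := uT jJ; have uj0 : 0 <= u j by apply: le_trans ujT; exact: ltW.
have [k [Gk k1 k1' k2 k2']] := invex _ (gG jJ).
have inj : injective (gmul k).
  move=> x y; rewrite /gmul => -[e1 e2]; rewrite [x]surjective_pairing [y]surjective_pairing.
  congr pair; apply/funext => z.
    by apply: (can_inj k1'); exact: (congr1 (fun q => q z) e1).
  by apply: (can_inj k2'); exact: (congr1 (fun q => q z) e2).
rewrite -(size_map (gmul k)).
have := IH (t - u j) (rho + C) [seq gmul k x | x <- s & f x == j] => /(_ _ _ _ _)/le_trans; apply.
- by rewrite subr_ge0; lra.
- by move: tm; rewrite -natr1 mulrDl mul1r; lra.
- by rewrite map_inj_uniq// filter_uniq.
- move=> h /mapP[x]; rewrite mem_filter => /andP[/eqP fx xs] -> {h}.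
  have [Gx _] := hs x xs; split; first exact: (gmul_mem grp).
  have [_ [eta [Eeta d1 d2]]] := hf x xs; rewrite fx in d2.
  have [eta' Eeta' tr] := limit_translate hX1 hX2 theta_itv grp coc Eeta Gk uj0.
  exists eta' => //; have tu : 0 <= t - u j by rewrite subr_ge0; lra.
  have := tr _ tu; rewrite [u j + _]addrC subrK => h.
  apply: (le_trans (metric_triangle _ (pair_action k (ray_from o eta t)) _)).
  apply: lerD; first by rewrite (pair_action_dist grp (orb x) _ Gk).
  apply: le_trans h _; rewrite metric_sym.
  have e : pair_action k (orb (g j)) = o by rewrite /pair_action /= k1 k2 -surjective_pairing.
  by rewrite -{1}e (pair_action_dist grp (orb (g j)) _ Gk).
(* The enlarged radius costs a factor [exp (s0 * C)], paid by the rate [s0 * C / T] over the elapsed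
   time [u j >= T]. *)
rewrite -mulrA ler_wpM2l// -expRD ler_expR.
have : s0 * C <= s0 * C / T * u j.
  by rewrite -{1}(mulfVK (lt0r_neq0 T0) (s0 * C)) ler_wpM2l// !mulr_ge0 ?invr_ge0// ltW.
rewrite /b; lra.
Qed.

End Recursion.

Lemma exponent_sum : (critical_exponent Gamma o < +oo)%E ->
  exists s0 Z : R, 0 < s0 /\ forall s : seq G, uniq s -> [set` s] `<=` Gamma ->
    \sum_(gamma <- s) expR (- s0 * mdist o (orb gamma)) <= Z.
Proof.
move=> /ereal_inf_lt[_ [s0 [s00 fin] <-] _].
set S := (\esum_(gamma in Gamma) _)%E in fin.
have S0 : (0 <= S)%E by apply: esum_ge0 => *; rewrite lee_fin expR_ge0.
exists s0, (fine S); split=> // s us sub.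
rewrite -lee_fin fineK ?ge0_fin_numE//; apply: esum_ge.
exists [set` s]; first by split=> //; exact: finite_seq.
by rewrite -fsbig_seq// sumEFin.
Qed.

(** If [alpha] were smaller, a single cover with small radii would bound all later counts by
    [shadow_size], against the growth rate [a1 > alpha] attained for arbitrarily large [n]. *)
Lemma exponent_le_dim (c alpha K : R) :
  proper_space X1 -> proper_space X2 ->
  (critical_exponent Gamma o < +oo)%E ->
  (forall gamma k, Gamma gamma ->
    `|mdist o.1 (gamma.1 o.1) - mdist o (orb gamma) * cos theta| <= k * mdist o (orb gamma) ->
    `|mdist o.2 (gamma.2 o.2) - mdist o (orb gamma) * sin theta| <= k * mdist o (orb gamma) ->
    exists s1 s2, [/\ is_ray s1, is_ray s2, s1 0 = o.1, s2 0 = o.2 &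
      radial_limit_set Gamma o (ray_class (join_ray theta s1 s2)) /\
      mdist (orb gamma) (join_ray theta s1 s2 (mdist o (orb gamma)))
        <= K + 2 * k * mdist o (orb gamma)]) ->
  0 < c -> 0 <= alpha -> (hd o c alpha limset < +oo)%E ->
  (slope_exponent Gamma o theta <= alpha%:E)%E.
Proof.
move=> prop1 prop2 crit shadow c0 alpha0 fin.
rewrite leNgt; apply/negP => lt.
have [a1 aa1 a1s] : exists2 a1 : R, alpha < a1 & (a1%:E < slope_exponent Gamma o theta)%E.
  case: (slope_exponent _ _ _) lt => [r| |//]; last by exists (alpha + 1); rewrite ?ltry//; lra.
  by rewrite lte_fin => ar; exists ((alpha + r) / 2); rewrite ?lte_fin; lra.
have [s0 [Z [s00 sumZ]]] := exponent_sum crit.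
pose d := a1 - alpha; have d0 : 0 < d by rewrite subr_gt0.
(* Limit rays in one ball are within [2 * c] of each other at time [u j], and cocompactness adds
   [cG]. The rate exceeds [alpha] by [d / 4] through [a], [d / 4] through [T] and [d / 8] through
   [k]; the remaining [3 * d / 8] absorbs the constants for large [n]. *)
pose C := 2 * c + cG; have C0 : 0 < C by rewrite /C; have := cG0; lra.
pose T := 4 * s0 * C / d.
have T0 : 0 < T by rewrite divr_gt0// !mulr_gt0.
have TC : s0 * C / T = d / 4 by rewrite /T; field; rewrite !gt_eqF.
pose a := alpha + d / 4; have a0 : 0 <= a by rewrite /a; lra.
have aa : alpha < a by rewrite /a; lra.
pose k := d / (16 * s0); have k0 : 0 < k by rewrite divr_gt0// mulr_gt0.
have kd : s0 * (2 * k) = d / 8 by rewrite /k; field; rewrite gt_eqF.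
have [D [u [xi [uT cov usum]]]] := small_cover T aa fin.
have [N hN] := limit_set_compact hX1 hX2 theta_itv coc prop1 prop2
  (y := fun j => ray_from o (xi j) (u j))
  (fun j Dj => le_trans (ltW T0) (ltW (uT j Dj))) cov.
pose J := [seq j <- iota 0 N | `[< D j >]].
have uJ : uniq J by rewrite filter_uniq// iota_uniq.
have JD j : j \in J -> D j by rewrite mem_filter => /andP[/asboolP].
have /choice[g hg] : forall j, exists g, D j -> Gamma g /\ forall eta, limset eta ->
    mdist (ray_from o eta (u j)) (ray_from o (xi j) (u j)) < c ->
    mdist (orb g) (ray_from o eta (u j)) <= C.
  move=> j; have [Dj|nD] := pselect (D j); last by exists (id, id).
  have uj0 := lt_trans T0 (uT j Dj).
  have [[eta [Eeta h]]|no] := pselect (exists eta, limset eta /\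
      mdist (ray_from o eta (u j)) (ray_from o (xi j) (u j)) < c); last first.
    exists (id, id) => _; split; first by case: grp.
    by move=> eta Eeta h; exfalso; apply: no; exists eta.
  have [g Gg gh] := coc (proj1 Eeta) uj0; exists g => _; split=> // eta' Eeta' h'.
  have t1 := metric_triangle (orb g) (ray_from o eta (u j)) (ray_from o eta' (u j)).
  have t2 := metric_triangle (ray_from o eta (u j)) (ray_from o (xi j) (u j)) (ray_from o eta' (u j)).
  rewrite (metric_sym (ray_from o (xi j) (u j))) in t2.
  apply: (le_trans t1); rewrite /C; move: gh h h' t2; lra.
have [Tmax hTmax] : exists Tmax : R, forall j, j \in J -> u j <= Tmax.
  elim: (J) => [|j J' [B hB]]; first by exists 0.
  exists (Num.max (u j) B) => i; rewrite inE => /orP[/eqP ->|/hB h].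
    by rewrite le_max lexx.
  by rewrite le_max h orbT.
have cov' eta : limset eta -> exists2 j, j \in J & mdist (orb (g j)) (ray_from o eta (u j)) <= C.
  move=> Eeta; have [j [Dj jN h]] := hN eta Eeta; exists j; last exact: (proj2 (hg j Dj)).
  by rewrite mem_filter mem_iota jN leq0n !andbT; apply/asboolP.
have := @shadow_size s0 Z s00 sumZ J u g T Tmax C a uJ T0 a0 (ltW C0)
  (fun j jJ => proj1 (hg j (JD j jJ)))
  (fun j jJ => introT andP (conj (ltW (uT j (JD j jJ))) (hTmax j jJ))) (usum N) cov'.
rewrite TC => size_le.
have [eps eps0 heps] := angle_dist theta o k0.
pose Z' := `|Z| + 1; have Z'0 : 0 < Z' by rewrite ltr_wpDl.
pose A := ln Z' + s0 * (Tmax + K + 1).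
have [n0 hn0] := nat_ge (A / (3 * d / 8)).
have [n n0n] := slope_count_gt n0 a1s eps0.
apply/negP; rewrite -leNgt; apply: counting_le => s us sub.
have nR : 0 <= n%:R :> R by exact: ler0n.
have [m hm] := nat_ge ((n%:R - Tmax) / T).
apply: (@le_trans _ _ (Z * expR (s0 * (Tmax + (K + 2 * k * n%:R + 1)) + (a + d / 4) * n%:R))).
  apply: (size_le m) => //.
    by have := hm m (leqnn _); rewrite ler_pdivrMr//; lra.
  move=> gam /sub[Gg /andP[r1 r2] /heps[h1 h2]]; split=> //.
  have [s1 [s2 [ray1 ray2 s10 s20 [rad close]]]] := shadow gam k Gg h1 h2.
  exists (ray_class (join_ray theta s1 s2)).
    by split=> //; apply: join_ray_slope => //; [exact: slope_cos_gt0|exact: slope_sin_gt0].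
  rewrite (join_ray_from hX1 hX2)//.
  apply: (le_trans (metric_triangle _ (join_ray theta s1 s2 (mdist o (orb gam))) _)).
  apply: lerD.
    by apply: (le_trans close); rewrite lerD2l ler_pM2l// mulr_gt0.
  rewrite (ray_dist (join_ray_is_ray (slope_cos_gt0 theta_itv) (slope_sin_gt0 theta_itv) ray1 ray2)) ?mdist_ge0//.
  by rewrite lerBlDr addrC -lerBlDr ltW.
apply: (@le_trans _ _ (Z' * expR (s0 * (Tmax + (K + 2 * k * n%:R + 1)) + (a + d / 4) * n%:R))).
  by rewrite ler_wpM2r ?expR_ge0// (le_trans (ler_norm _))// lerDl.
rewrite -{1}[Z']lnK// -expRD ler_expR.
have := hn0 n n0n; rewrite ler_pdivrMr; last by rewrite divr_gt0// mulr_gt0.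
have -> : s0 * (Tmax + (K + 2 * k * n%:R + 1)) = s0 * (Tmax + K + 1) + s0 * (2 * k) * n%:R by ring.
rewrite kd /A /a; have -> : a1 = alpha + d by rewrite /d; ring.
lra.
Qed.

Lemma nat_ceil (r : R) : 0 <= r -> exists m : nat, m%:R - 1 < r <= m%:R.
Proof.
move=> r0; have [n hn] := nat_ge r.
have ex : exists n, r <= n%:R by exists n; exact: hn.
case: (ex_minnP ex) => -[|m] rm hm; first by exists 0%N; rewrite rm andbT; lra.
exists m.+1; rewrite rm andbT ltNge; apply/negP => h.
have /hm : r <= m%:R by move: h; rewrite -natr1; lra.
by rewrite ltnn.
Qed.

(** Two limit rays near the same orbit point at time [n] are within [2 * cG <= c], so one [c]-ball
    of radius [exp (- n)] per orbit point covers the limit set. *)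
Lemma dim_le_exponent (c alpha : R) : 2 * cG <= c ->
  (0 < slope_exponent Gamma o theta)%E -> (slope_exponent Gamma o theta < alpha%:E)%E ->
  (hd o c alpha limset < +oo)%E.
Proof.
move=> cc pos lt.
have [a [a0 aalpha sa]] : exists a : R, [/\ 0 < a, a < alpha & (slope_exponent Gamma o theta < a%:E)%E].
  case: (slope_exponent _ _ _) pos lt => [r| |]; [|by []|by []].
  by rewrite !lte_fin => r0 ra; exists ((r + alpha) / 2); split; rewrite ?lte_fin; lra.
have [eps [n0 [eps0 cnt]]] := slope_count_le sa.
have [t0 ang] := dist_angle o theta_itv cG eps0.
(* Orbit points within [cG] of time [n] lie in the annuli [n - L] to [n + L], which are [2 * L + 1]
   in number. *)
have [L0 hL] := nat_ge (cG + 1); pose L := L0; have {}hL : cG + 1 <= L%:R by exact: hL.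
(* Each annulus has at most [exp (a * (n + L))] points of weight [exp (- alpha * n)]; as
   [a < alpha], the total is bounded independently of [n]. *)
pose M := (2 * L + 1)%:R * expR (a * L%:R).
apply: (@le_lt_trans _ _ M%:E); last exact: ltry.
rewrite hdE; apply: ub_ereal_sup => _ [e /andP[e0 _] <-].
have [n1 h1] := nat_ge t0; have [n2 h2] := nat_ge (c + 1); have [n3 h3] := nat_ge (1 - ln e).
(* In turn: all annuli are in the range of the count bound, angles are controlled, and the radius
   [exp (- n)] is below [exp (- c)] and [e]. *)
have [n [nL nt0 nc ne]] : exists n : nat,
    [/\ (n0 + L <= n)%N, t0 <= n%:R, c < n%:R & - ln e < n%:R].
  pose n := (n1 + n2 + n3 + (n0 + L))%N; exists n.
  have a1 : t0 <= n%:R by apply: h1; rewrite /n -!addnA leq_addr.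
  have a2 : c + 1 <= n%:R by apply: h2; rewrite /n -!addnA addnCA leq_addr.
  have a3 : 1 - ln e <= n%:R by apply: h3; rewrite /n -!addnA addnA addnCA leq_addr.
  by split; [exact: leq_addl|exact: a1|lra|lra].
have n0' : 0 < n%:R :> R by apply: lt_trans nc; apply: lt_le_trans cc; rewrite mulr_gt0.
pose Gn := [set gamma | Gamma gamma /\
  exists2 eta, limset eta & mdist (orb gamma) (ray_from o eta n%:R) < cG].
have near_n gamma : Gn gamma -> `|mdist o (orb gamma) - n%:R| <= cG /\
    `|orbit_angle o gamma - theta| < eps.
  move=> [Gg [eta Eeta h]]; split.
    rewrite -{1}(limit_dist hX1 hX2 theta_itv Eeta (ltW n0')).
    exact: le_trans (dist_diff _ _ _) (ltW h).
  have [s1 [s2 [ray1 ray2 s10 s20 etaE]]] := limit_ray hX1 hX2 theta_itv Eeta.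
  rewrite etaE (join_ray_from hX1 hX2 theta_itv ray1 ray2 s10 s20 (ltW n0')) in h.
  have c1 : 0 <= n%:R * cos theta by rewrite mulr_ge0// ltW// slope_cos_gt0.
  have c2 : 0 <= n%:R * sin theta by rewrite mulr_ge0// ltW// slope_sin_gt0.
  apply: (ang n%:R) => //.
    have -> : n%:R * cos theta = mdist o.1 (s1 (n%:R * cos theta)).
      by rewrite -s10 (ray_dist ray1)// subr0.
    apply: le_trans (dist_diff _ _ _) (le_trans _ (ltW h)).
    exact: (l2_ge1 (orb gamma) (join_ray theta s1 s2 n%:R)).
  have -> : n%:R * sin theta = mdist o.2 (s2 (n%:R * sin theta)).
    by rewrite -s20 (ray_dist ray2)// subr0.
  apply: le_trans (dist_diff _ _ _) (le_trans _ (ltW h)).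
  exact: (l2_ge2 (orb gamma) (join_ray theta s1 s2 n%:R)).
have /choice[lvl hlvl] := fun gamma : G => nat_ceil (mdist_ge0 o (orb gamma)).
have cntn : (counting Gn <= ((2 * L + 1)%:R * expR (a * (n + L)%:R))%:E)%E.
  apply: counting_le => s us sub.
  have lvl_in gamma : gamma \in s -> lvl gamma \in iota (n - L) (2 * L + 1).
    move=> /sub/near_n[+ _]; have /andP[b1 b2] := hlvl gamma.
    rewrite ler_norml => /andP[b3 b4].
    have l1 : n%:R <= (lvl gamma + L)%:R :> R.
      by rewrite natrD; move: b2 b3 hL; lra.
    have l2 : (lvl gamma)%:R < (n + L + 1)%:R :> R.
      by rewrite !natrD; move: b1 b4 hL; lra.
    rewrite ler_nat in l1; rewrite ltr_nat in l2.
    by rewrite mem_iota; apply/andP; split; move: l1 l2 nL; clear; lia.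
  rewrite (size_fibres (iota_uniq _ _) lvl_in) natr_sum.
  rewrite -[X in X%:R * _](size_iota (n - L)) -sum1_size natr_sum mulr_suml.
  rewrite big_seq [leRHS]big_seq; apply: ler_sum => m; rewrite mem_iota => /andP[m1 m2].
  rewrite mul1r; apply: (@le_trans _ _ (expR (a * m%:R))); last first.
    by rewrite ler_expR ler_pM2l// ler_nat; move: m1 m2 nL; clear; lia.
  rewrite -lee_fin; apply: le_trans (cnt m _); last by move: m1 nL; clear; lia.
  apply: counting_ge; first by rewrite filter_uniq.
  move=> gamma /=; rewrite mem_filter => /andP[/eqP <- gs].
  have Gng := sub gamma gs; split; [by case: Gng|exact: hlvl|].
  by case: (near_n gamma Gng).
have [s [us GnE sz]] := counting_seq cntn.
have /choice[cen hcen] : forall gamma : G, exists eta, Gn gamma -> limset eta /\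
    mdist (orb gamma) (ray_from o eta n%:R) < cG.
  move=> gamma; have [[Gg [eta Eeta h]]|nG] := pselect (Gn gamma); first by exists eta.
  by exists set0.
have lnn : - ln (expR (- n%:R)) = n%:R :> R by rewrite expRK opprK.
apply: (le_trans (@finite_cover_hd_pre _ _ o c limset alpha e (expR (- n%:R)) (map cen s) _ _ _ _ _)).
- exact: expR_gt0.
- by rewrite ltr_expR ltrN2.
- by rewrite -[ltRHS]lnK// ltr_expR ltrNl.
- by move=> x /mapP[gamma gs ->]; have [|[[bd _] _] _] := hcen gamma; first by rewrite GnE.
- move=> eta Eeta; have [gamma Gg h] := coc (proj1 Eeta) n0'.
  have Gng : Gn gamma by split=> //; exists eta.
  have [_ h'] := hcen gamma Gng.
  exists (cen gamma); first by apply: map_f; move: Gng; rewrite GnE.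
  split; first by case: Eeta => -[].
  rewrite lnn; apply: (le_lt_trans (metric_triangle _ (orb gamma) _)).
  by rewrite (metric_sym _ (orb gamma)); move: h h' cc; lra.
rewrite size_map lee_fin -expRM /M.
apply: (le_trans (ler_wpM2r (expR_ge0 _) sz)).
rewrite -mulrA -expRD ler_wpM2l// ler_expR natrD mulrDr.
have : a * n%:R <= alpha * n%:R by rewrite ler_wpM2r// ltW.
by lra.
Qed.

End Dimension.

Theorem theoremG (R : realType) (X1 X2 : metricType R)
    (hX1 : hadamard X1) (hX2 : hadamard X2)
    (lcX1 : locally_compact [set: X1]) (lcX2 : locally_compact [set: X2])
    (o : l2prod X1 X2)
    (Gamma : set ({compact-open, X1 -> X1} * {compact-open, X2 -> X2}))
    (grpG : is_isometry_group Gamma) (discG : is_discrete Gamma)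
    (rk1G : exists g h, [/\ Gamma g, Gamma h,
       independent_rank_one g.1 h.1 & independent_rank_one g.2 h.2])
    (deltaG : (critical_exponent Gamma o < +oo)%E)
    (cocG : radially_cocompact Gamma o) :
  exists2 c0 : R, 0 < c0 & forall c : R, c0 <= c ->
    forall theta : R, 0 < theta < pi / 2 ->
      (0 < slope_exponent Gamma o theta)%E ->
      hd_dim o c (radial_limit_set Gamma o `&` boundary_slope theta)
        = slope_exponent Gamma o theta.
Proof.
have [cG cG0 coc] := cocG; exists (2 * cG); first by rewrite mulr_gt0.
move=> c cc theta theta_itv pos.
have c0 : 0 < c by apply: lt_le_trans cc; rewrite mulr_gt0.
have prop1 : proper_space X1.
  by have [comp geo _] := hX1; exact: locally_compact_proper.
have prop2 : proper_space X2.
  by have [comp geo _] := hX2; exact: locally_compact_proper.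
have [K _ shadow] := shadow_ray hX1 hX2 theta_itv grpG prop1 prop2 rk1G
  (orbit_approx pos).
apply/eqP; rewrite eq_le; apply/andP; split; last first.
  apply: le_ereal_inf_tmp => _ [alpha [alpha0 fin] <-].
  exact: (exponent_le_dim hX1 hX2 theta_itv grpG cG0 coc prop1 prop2 deltaG shadow c0 alpha0 fin).
(* Finiteness is known only strictly above the exponent, so equality is reached by letting [e] tend
   to zero. *)
have upper (alpha : R) : (slope_exponent Gamma o theta < alpha%:E)%E ->
    (hd_dim o c (radial_limit_set Gamma o `&` boundary_slope theta) <= alpha%:E)%E.
  move=> lt; apply: ereal_inf_lbound; exists alpha => //; split.
    by rewrite -lee_fin; apply: ltW; exact: lt_trans lt.
  exact: (dim_le_exponent hX1 hX2 theta_itv cG0 coc cc pos lt).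
case: (slope_exponent _ _ _) pos upper => [d| |] //; last by rewrite leey.
move=> _ upper; apply/lee_addgt0Pr => e e0; rewrite -EFinD; apply: upper.
by rewrite lte_fin ltrDl.
Qed.
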